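(* Let $T$ be a theory of continuous first order logic. The following are equivalent for a formula $\varphi(x,y)$: (i) $\varphi$ is stable in $T$. (ii) For every $M\models T$, every $p\in \mathrm S_\varphi(M)$ is definable. (iii) For every $M\models T$, $\|\mathrm S_\varphi(M)\|\le\|M\|$. (iv) There exists a cardinal $\lambda\ge|T|$ such that whenever $M\models T$ and $\|M\|\le\lambda$ then $\|\mathrm S_\varphi(M)\|\le\lambda$ as well.
   Context: **Continuous logic.** Truth values lie in $[0,1]$, $0$ meaning true. A (metric, possibly many-sorted) continuous signature $\mathcal L$ consists of function and predicate symbols of finite arities, a distinguished binary predicate symbol $d$ on each sort, and for each symbol and each argument a uniform continuity modulus. An $\mathcal L$-structure interprets function symbols by functions and predicate symbols by $[0,1]$-valued functions, with $d$ a complete metric and each symbol respecting its moduli in each argument. Formulae are built from atomic ones using the connectives $\neg x=1-x$, $x/2$, $x\dot- y=\max(x-y,0)$ and the quantifiers $\sup,\inf$. A condition is $\varphi=0$; a theory (not necessarily complete) is a set of conditions without free variables. Finite tuples of variables are treated as single variables. $|T|$ denotes the (infinite) cardinality of the set of $\mathcal L$-formulae. **Stability.** $\varphi(x,y)$ is $\varepsilon$-stable ($\varepsilon>0$) if in no model of $T$ is there an infinite sequence $(a_i,b_i)_{i<\omega}$ with $|\varphi(a_i,b_j)-\varphi(a_j,b_i)|\ge\varepsilon$ for all $i<j$; it is stable if $\varepsilon$-stable for all $\varepsilon>0$. **Types.** $\mathrm S_x(M)$ is the space of complete types over $M$ in the variable $x$ (sets of conditions with parameters in $M$ satisfied by some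 element of an elementary extension of $M$), with the coarsest topology making $p\mapsto\psi^p$ continuous for every formula $\psi(x)$ with parameters in $M$, where $\psi^p$ is the value of $\psi$ at a realisation of $p$. $\mathrm S_\varphi(M)$ is the quotient space of $\mathrm S_x(M)$ identifying two types when they give the same value to $\varphi(x,b)$ for every $b\in M$. It carries the metric $d(p,q)=\sup_{b\in M}|\varphi(x,b)^p-\varphi(x,b)^q|$. $\|M\|$ and $\|\mathrm S_\varphi(M)\|$ denote the density character (least cardinality of a dense subset) for the metric of $M$ and the metric $d(p,q)=\sup_{b\in M}|\varphi(x,b)^p-\varphi(x,b)^q|$ of $\mathrm S_\varphi(M)$ respectively. An $M$-definable predicate $\psi(y)$ is a continuous function $\mathrm S_y(M)\to[0,1]$ (equivalently a uniform limit of formulae with parameters in $M$), evaluated at $b$ through $\mathrm{tp}(b/M)$. A type $p\in\mathrm S_\varphi(M)$ is definable if there is an $M$-definable predicate $\psi(y)$ with $\varphi(x,b)^p=\psi(b)$ for all $b\in M$. **Standing convention.** $\mathcal L$ is assumed to have, for every stable formula $\varphi(x,y)$, a sort $S_{d\varphi}$ of canonical parameters for instances of the predicate $d\varphi(y,X)$ defined as follows. For a sequence $(a_n)$ in $[0,1]$ put $a_{*,0}=a_0$, let $a_{*,n+1}$ be the point of $[a_{*,n}-2^{-n-1},a_{*,n}+2^{-n-1}]$ closest to $a_{n+1}$, and $\mathrm{flim}_n a_n=\lim_n a_{*,n}$. $N(\varphi,\varepsilon)$ is the least $N$ such that in no model of $T$ is there a sequence $(a_i,b_i)_{i<N+1}$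 with $|\varphi(a_j,b_i)-\varphi(a_j,b_k)|\ge\varepsilon$ for all $i<j<k$. $d^\varepsilon\varphi(y,x_{<2N(\varphi,\varepsilon)-1})$ is the median of the $2N(\varphi,\varepsilon)-1$ values $\varphi(x_i,y)$; $X=(x^n_i:n<\omega,i<2N(\varphi,2^{-n})-1)$ and $d\varphi(y,X)=\mathrm{flim}_n d^{2^{-n}}\varphi(y,x^n_{<2N(\varphi,2^{-n})-1})$. In a structure $M$, $S_{d\varphi}$ is the completion of the quotient of the set of families $C$ of elements of $M$ indexed like $X$ by the pseudo-metric $\sup_y|d\varphi(y,C)-d\varphi(y,C')|$, with the induced metric and with the predicate $P(y,[C])=d\varphi(y,C)$. Adding these sorts does not change $\|M\|$ when $\|M\|\ge|\mathcal L|$. *)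

(* Defs.v *)
From HB Require Import structures.
From mathcomp Require Import all_boot all_order all_algebra.
From mathcomp Require Import all_classical all_reals all_analysis.
Set Implicit Arguments.
Unset Strict Implicit.
Unset Printing Implicit Defensive.
Import Order.TTheory GRing.Theory Num.Theory.
Import numFieldNormedType.Exports.
Local Open Scope classical_set_scope.
Local Open Scope card_scope.
Local Open Scope ring_scope.
Local Open Scope quotient_scope.

(* Signatures, carriers of structures and cardinals (represented by types) all
   live in this one universe. *)
Definition univ := Type.

(* A finite tuple of sorts: the sorts of a tuple of variables (de Bruijn
   indices), or the arity of a symbol. *)
Record ctx (S : univ) := Ctx { arity : nat; csort :> 'I_arity -> S }.

Definition ctx0 (S : univ) : ctx S :=
  @Ctx S 0 (fun i => let: Ordinal _ h := i in False_rect _ (notF h)).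

Definition ctx1 (S : univ) (s : S) : ctx S := @Ctx S 1 (fun _ => s).

Definition ctx2 (S : univ) (s : S) : ctx S := @Ctx S 2 (fun _ => s).

(* The new variable has index 0. *)
Definition ctx_ext (S : univ) (G : ctx S) (s : S) : ctx S :=
  @Ctx S (arity G).+1 (fun i => if unlift ord0 i is Some j then G j else s).

Definition ctx_cat (S : univ) (G H : ctx S) : ctx S :=
  @Ctx S (arity G + arity H)
    (fun i => match fintype.split i with inl j => G j | inr k => H k end).

Record symbols := Symbols {
  lsort : univ;
  fsym : univ;
  fdom : fsym -> ctx lsort;
  fcod : fsym -> lsort;
  rsym : univ;
  rdom : rsym -> ctx lsort }.

Inductive psym (L : symbols) : univ := Dist of lsort L | Rel of rsym L.

Definition pdom (L : symbols) (P : psym L) : ctx (lsort L) :=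
  match P with Dist s => ctx2 s | Rel r => rdom r end.

Record signature (R : realType) := Signature {
  syms :> symbols;
  fmod : forall f : fsym syms, 'I_(arity (fdom f)) -> R -> R;
  pmod : forall P : psym syms, 'I_(arity (pdom P)) -> R -> R;
  fmod_gt0 : forall f i e, 0 < e -> 0 < fmod (f := f) i e;
  pmod_gt0 : forall P i e, 0 < e -> 0 < pmod (P := P) i e }.

Inductive term (L : symbols) (G : ctx (lsort L)) : lsort L -> univ :=
| Var (i : 'I_(arity G)) : term G (G i)
| App (f : fsym L) (ts : forall i : 'I_(arity (fdom f)), term G (fdom f i)) :
    term G (fcod f).

Inductive formula (L : symbols) (G : ctx (lsort L)) : univ :=
| Atom (P : psym L) (ts : forall i : 'I_(arity (pdom P)), term G (pdom P i))
| Neg of formula G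
| Half of formula G
| Dotminus of formula G & formula G
| Sup (s : lsort L) of formula (ctx_ext G s)
| Inf (s : lsort L) of formula (ctx_ext G s).

(* The set of all L-formulas, whose cardinality is |T|. *)
Definition formulas (L : symbols) : univ := {G : ctx (lsort L) & formula G}.

(* A set of sentences phi, each standing for the condition phi = 0. *)
Definition theory (L : symbols) := set (formula (ctx0 (lsort L))).

Definition tup (S : univ) (M : S -> univ) (G : ctx S) : univ :=
  forall i : 'I_(arity G), M (G i).

Section Tuples.
Variables (S : univ) (M : S -> univ).

Definition tup0 : tup M (ctx0 S) :=
  fun i => match i return M (ctx0 S i) with
           | Ordinal _ h => False_rect _ (notF h) end.

Definition tup1 s (x : M s) : tup M (ctx1 s) := fun _ => x.

Definition tup2 s (x y : M s) : tup M (ctx2 s) :=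
  fun i => if i == ord0 then x else y.

Definition tup_ext G s (a : tup M G) (x : M s) : tup M (ctx_ext G s) :=
  fun i => match unlift ord0 i as o
             return M (if o is Some j then G j else s) with
           | Some j => a j | None => x end.

Definition tup_cat G H (a : tup M G) (b : tup M H) : tup M (ctx_cat G H) :=
  fun i => match fintype.split i as u
             return M (match u with inl j => G j | inr k => H k end) with
           | inl j => a j | inr k => b k end.

End Tuples.

Record structure (R : realType) (L : signature R) := Structure {
  carrier :> lsort L -> univ;
  fint : forall f : fsym L, tup carrier (fdom f) -> carrier (fcod f);
  pint : forall P : psym L, tup carrier (pdom P) -> R;
  dist : forall s, carrier s -> carrier s -> R :=
    fun s x y => pint (P := Dist s) (tup2 x y);
  carrier_inhabited : forall s, inhabited (carrier s);
  pint_itv : forall P a, 0 <= pint (P := P) a <= 1;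
  dist_eq0 : forall s (x y : carrier s), dist x y = 0 <-> x = y;
  dist_sym : forall s (x y : carrier s), dist x y = dist y x;
  dist_triangle : forall s (x y z : carrier s),
    dist x z <= dist x y + dist y z;
  dist_complete : forall s (u : nat -> carrier s),
    (forall e, 0 < e -> exists N, forall m n, (N <= m)%N -> (N <= n)%N ->
       dist (u m) (u n) < e) ->
    exists l, forall e, 0 < e -> exists N, forall n, (N <= n)%N ->
       dist (u n) l < e;
  fint_unif : forall (f : fsym L) (i : 'I_(arity (fdom f))) e a b, 0 < e ->
    (forall j, j != i -> a j = b j) ->
    dist (a i) (b i) < fmod i e -> dist (fint a) (fint b) <= e;
  pint_unif : forall (P : psym L) (i : 'I_(arity (pdom P))) e a b, 0 < e ->
    (forall j, j != i -> a j = b j) ->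
    dist (a i) (b i) < pmod i e -> `|pint a - pint b| <= e }.

Section Semantics.
Variables (R : realType) (L : signature R).

Fixpoint teval (M : structure L) G (a : tup M G) s (t : term G s) : M s :=
  match t with
  | Var i => a i
  | App f ts => fint (fun i => teval a (ts i))
  end.

Fixpoint feval (M : structure L) (G : ctx (lsort L)) (phi : formula G) :
    tup M G -> R :=
  match phi with
  | Atom P ts => fun a => pint (fun i => teval a (ts i))
  | Neg p => fun a => 1 - feval p a
  | Half p => fun a => feval p a / 2
  | Dotminus p q => fun a => Num.max (feval p a - feval q a) 0
  | Sup s p => fun a => sup (range (fun x : M s => feval p (tup_ext a x)))
  | Inf s p => fun a => inf (range (fun x : M s => feval p (tup_ext a x)))
  end.

Definition models (M : structure L) (T : theory L) :=
  forall phi, T phi -> feval phi (tup0 M) = 0.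

Definition tup_map (M N : structure L) (j : forall s, M s -> N s) G
  (a : tup M G) : tup N G := fun i => j _ (a i).

(* Elementary extensions of M are taken up to isomorphism: N together with an
   elementary embedding of M in N. *)
Definition elementary (M N : structure L) (j : forall s, M s -> N s) :=
  forall G (phi : formula G) (a : tup M G),
    feval phi (tup_map j a) = feval phi a.

Definition eps_stable (T : theory L) xs ys (phi : formula (ctx_cat xs ys))
    (e : R) :=
  ~ exists (M : structure L) (a : nat -> tup M xs) (b : nat -> tup M ys),
      models M T /\ forall i j, (i < j)%N ->
        e <= `|feval phi (tup_cat (a i) (b j))
               - feval phi (tup_cat (a j) (b i))|.

Definition stable (T : theory L) xs ys (phi : formula (ctx_cat xs ys)) :=
  forall e : R, 0 < e -> eps_stable T phi e.

(* The values a_{*,n}; [Num.max lo (Num.min hi c)] is the point of [lo, hi]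
   closest to c. *)
Fixpoint flim_seq (a : nat -> R) (n : nat) : R :=
  match n with
  | 0%N => a 0%N
  | m.+1 => Num.max (flim_seq a m - 2 ^- n)
                    (Num.min (flim_seq a m + 2 ^- n) (a n))
  end.

Definition flim (a : nat -> R) : R := limn (flim_seq a).

Definition no_ladder (T : theory L) xs ys (phi : formula (ctx_cat xs ys))
    (e : R) (N : nat) :=
  ~ exists (M : structure L) (a : 'I_N.+1 -> tup M xs) (b : 'I_N.+1 -> tup M ys),
      models M T /\ forall i j k : 'I_N.+1, (i < j)%N -> (j < k)%N ->
        e <= `|feval phi (tup_cat (a j) (b i))
               - feval phi (tup_cat (a j) (b k))|.

(* N(phi, e); it exists for every e > 0 when phi is stable in T. *)
Definition ladder_bound (T : theory L) xs ys (phi : formula (ctx_cat xs ys))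
    (e : R) : nat :=
  xget 0%N [set N | no_ladder T phi e N /\
                    forall N', no_ladder T phi e N' -> (N <= N')%N].

Definition median (N : nat) (v : 'I_(N.*2.-1) -> R) : R :=
  nth 0 (sort <=%R (codom v)) N.-1.

(* Values of the infinite tuple of variables X. *)
Definition dfamily (T : theory L) xs ys (phi : formula (ctx_cat xs ys))
    (M : structure L) :=
  forall n : nat, 'I_((ladder_bound T phi (2 ^- n)).*2.-1) -> tup M xs.

Definition dphi (T : theory L) xs ys (phi : formula (ctx_cat xs ys))
    (M : structure L) (b : tup M ys) (C : dfamily T phi M) : R :=
  flim (fun n => median (fun i => feval phi (tup_cat (C n i) b))).

(* The sort s and the predicate P(y, z), z of sort s, are interpreted in every
   model of T as the sort S_dphi and its predicate.  As M s is complete, the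
   first two clauses say that it is the completion of the quotient of the set of
   families by the pseudo-metric, q sending C to its class [C]. *)
Definition canonical_sort (T : theory L) xs ys (phi : formula (ctx_cat xs ys))
    (s : lsort L) (P : rsym L) (e : ctx_cat ys (ctx1 s) = rdom P) :=
  forall M : structure L, models M T ->
    exists q : dfamily T phi M -> M s,
      [/\ forall C C', dist (q C) (q C') =
            sup (range (fun b : tup M ys => `|dphi b C - dphi b C'|)),
          forall (z : M s) (r : R), 0 < r -> exists C, dist z (q C) < r
        & forall (b : tup M ys) C,
            pint (P := Rel P) (eq_rect _ (tup M) (tup_cat b (tup1 (q C))) _ e)
            = dphi b C].

Definition has_canonical_sorts (T : theory L) :=
  forall xs ys (phi : formula (ctx_cat xs ys)), stable T phi ->
    exists (s : lsort L) (P : rsym L) (e : ctx_cat ys (ctx1 s) = rdom P),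
      canonical_sort T phi e.

Section Types.
Variable M : structure L.

Record pformula (xs : ctx (lsort L)) : univ := PFormula {
  pctx : ctx (lsort L);
  pbody : formula (ctx_cat xs pctx);
  ppar : tup M pctx }.
Arguments ppar {xs} p i.

Definition peval (N : structure L) (j : forall s, M s -> N s) xs
    (psi : pformula xs) (a : tup N xs) : R :=
  feval (pbody psi) (tup_cat a (tup_map j (ppar psi))).

(* psi belongs to p when the condition psi = 0 does. *)
Definition realises (N : structure L) (j : forall s, M s -> N s) xs
    (a : tup N xs) (p : set (pformula xs)) :=
  elementary j /\ p = [set psi | peval j psi a = 0].

Record ctype (xs : ctx (lsort L)) := CType {
  conds :> set (pformula xs);
  ctype_realised : exists (N : structure L) (j : forall s, M s -> N s)
    (a : tup N xs), realises j a conds }.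

Definition tvalue xs (psi : pformula xs) (p : ctype xs) : R :=
  xget 0%R [set r | exists (N : structure L) (j : forall s, M s -> N s)
    (a : tup N xs), realises j a p /\ r = peval j psi a].

HB.instance Definition _ xs := gen_eqMixin (ctype xs).
HB.instance Definition _ xs := gen_choiceMixin (ctype xs).

(* The coarsest topology making every [tvalue psi] continuous. *)
Definition tvalues xs (p : ctype xs) : prod_topology (fun _ : pformula xs => R) :=
  fun psi => tvalue psi p.
HB.instance Definition _ xs :=
  Topological.copy (ctype xs) (initial_topology (@tvalues xs)).

Lemma tp_subproof xs (b : tup M xs) :
  exists (N : structure L) (j : forall s, M s -> N s) (a : tup N xs),
    realises j a [set psi | peval (fun s (x : M s) => x) psi b = 0].
Proof. by exists M, (fun s x => x), b. Qed.

Definition tp xs (b : tup M xs) : ctype xs := CType (tp_subproof b).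

Section PhiTypes.
Variables (xs ys : ctx (lsort L)) (phi : formula (ctx_cat xs ys)).

Definition phi_inst (b : tup M ys) : pformula xs := PFormula phi b.

Definition phi_eq (p q : ctype xs) : bool :=
  `[< forall b, tvalue (phi_inst b) p = tvalue (phi_inst b) q >].

Lemma phi_eq_refl : reflexive phi_eq.
Proof. by move=> p; apply/asboolP. Qed.

Lemma phi_eq_sym : symmetric phi_eq.
Proof. by move=> p q; apply/asboolP/asboolP => h b; rewrite h. Qed.

Lemma phi_eq_trans : transitive phi_eq.
Proof.
by move=> q p r /asboolP h1 /asboolP h2; apply/asboolP => b; rewrite h1.
Qed.

Canonical phi_eq_equiv := EquivRel phi_eq phi_eq_refl phi_eq_sym phi_eq_trans.

Definition phitype := {eq_quot phi_eq}.

Definition phi_value (p : phitype) (b : tup M ys) : R :=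
  tvalue (phi_inst b) (repr p).

Definition phitype_dist (p q : phitype) : R :=
  sup (range (fun b => `|phi_value p b - phi_value q b|)).

Definition definable (p : phitype) :=
  exists psi : ctype ys -> R,
    [/\ continuous psi, forall r, 0 <= psi r <= 1
      & forall b, phi_value p b = psi (tp b)].

Definition phitype_dense (D : set phitype) :=
  forall (p : phitype) (e : R), 0 < e ->
    exists2 q, D q & phitype_dist p q < e.

End PhiTypes.

(* Dense subsets of the disjoint union of the sorts of M. *)
Definition structure_dense (D : set {s : lsort L & M s}) :=
  forall s (x : M s) (e : R), 0 < e ->
    exists2 y : M s, D (existT M s y) & dist x y < e.

End Types.

(* A dense set of least cardinality; the density character is its cardinality,
   and density characters are compared with [#<=]. *)
Definition density (X : Type) (dense : set (set X)) : set X :=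
  xget set0 [set D | dense D /\ forall E, dense E -> D #<= E].

Definition structure_density (M : structure L) : set {s : lsort L & M s} :=
  density (@structure_dense M).

Definition phitype_density (M : structure L) xs ys
    (phi : formula (ctx_cat xs ys)) : set (phitype M phi) :=
  density (@phitype_dense M xs ys phi).

End Semantics.
Arguments structure_density {R L} M.
Arguments phitype_density {R L} M {xs ys} phi.

(* Main.v *)
From mathcomp Require Import all_boot all_order all_algebra.
From mathcomp Require Import all_classical all_reals all_analysis.
From mathcomp Require Import lra zify.
From mathcomp Require wochoice.
Require Import Defs.
Set Implicit Arguments.
Unset Strict Implicit.
Unset Printing Implicit Defensive.
Import Order.TTheory GRing.Theory Num.Theory.
Import numFieldNormedType.Exports.
Local Open Scope classical_set_scope.
Local Open Scope card_scope.
Local Open Scope ring_scope.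

(** Everything passes through the double limit condition of Grothendieck: along a
    fixed non principal ultrafilter on nat, lim_i lim_j phi(a_i, b_j) is equal to
    lim_j lim_i phi(a_i, b_j) for all sequences in a model of T. If phi is not stable,
    the two limits differ on a sequence witnessing this; if they differ, a
    subsequence has values near one of them above the diagonal and near the other
    below it, so that phi is not stable ([stable_double_limit],
    [double_limit_stable]).

    A phi-type p over M is approximately satisfied by tuples of M on finitely many
    parameters. If p, as a function on M, were not uniformly continuous with respect to
    finitely many instances phi(c, y), one could build two arrays contradicting the
    double limit condition ([phi_value_unif]); so p extends continuously to the
    types over M ([extend_to_types]), which is definability. This is (i) => (ii).

    Conversely, if the limits differ on sequences a_i and b_j of M, let p be the limit of
    the types of the a_i over an ultrapower K of M, and q that of the types of the b_j.
    Since K is saturated enough, it has elements y as close to q as desired with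
    phi(a_i, y) = lim_j phi(a_i, b_j) for all i. A continuous definition of p takes one of
    the iterated limits at these y and tends to the other along the b_j, so it is not
    continuous at q ([definable_double_limit]). This gives (ii) => (i).

    For (iii), let phi be stable. Ladders have bounded length N, as long ones would
    have an ultraproduct contradicting the double limit condition. Choosing 2N - 1 tuples
    successively, each close to p at finitely many points where some of the
    previous ones err, one gets tuples fewer than N of which err at a given point on a
    given side: the medians of phi at these tuples approximate p ([median_approx]).
    Hence p is a uniform limit of instances of d phi, and by completeness the types embed
    isometrically in the sort of canonical parameters ([canonical_isometry]), whose
    density character bounds theirs. So (ii) => (iii) goes through (i), and (iii) => (iv)
    holds with |T| for the cardinal.

    For (iv) => (i), let Lambda be infinite. There is a tree of binary branches with at
    most Lambda nodes and more than Lambda branches ([many_branches],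
    [embeds_finally_false]). If phi is unstable, an ultrapower of a model contains a ladder
    indexed by the branches in lexicographic order. By the Lowenheim-Skolem theorem the
    part of it indexed by the nodes lies in an elementary submodel of density at most
    Lambda, over which different branches have types at a fixed positive distance
    ([few_types_double_limit]).

    The tools are ultraproducts with the theorem of Los ([Los]), finite satisfiability of
    types ([elementary_approx]), the Lowenheim-Skolem theorem ([lowenheim_skolem]), and
    the existence of least cardinals and the equality Lambda * Lambda = Lambda, which
    are derived from Zorn's lemma ([embeds_least], [embeds_square]). *)

(** * Cardinal arithmetic *)

Lemma dependent_choice_fun (I : Type) (F : I -> Type) (P : forall i, F i -> Prop) :
  (forall i, exists x, P i x) -> exists f : forall i, F i, forall i, P i (f i).
Proof.
by move=> h; exists (fun i => projT1 (cid (h i))) => i; exact: projT2 (cid (h i)).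
Qed.

(** Comparison of cardinals of types; [card_leE] relates it to the comparison
    of subsets. *)
Definition embeds (A B : Type) := exists f : A -> B, injective f.

Lemma embeds_trans B A C : embeds A B -> embeds B C -> embeds A C.
Proof. by move=> [f fI] [g gI]; exists (g \o f); apply: inj_comp. Qed.

Lemma embeds_sub T (A : set T) : embeds A T.
Proof. by exists set_val => x y /val_inj. Qed.

Lemma embeds_prod A B C D : embeds A C -> embeds B D -> embeds (A * B) (C * D).
Proof.
move=> [f fI] [g gI]; exists (fun p => (f p.1, g p.2)).
by case=> a b [c d] [/fI -> /gI ->].
Qed.

Lemma card_leTT A B : ([set: A] #<= [set: B]) <-> embeds A B.
Proof.
split=> [/card_leP[/= f]|[f fI]].
  pose v (x : A) : [set: A] := SigSub (in_setT x).
  have vI : injective v by move=> x y /(congr1 set_val).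
  exists (fun x => set_val (f (v x))) => x y /val_inj.
  by move=> /(@inj _ _ _ f) h; apply: vI; apply: h; rewrite inE.
apply: (@card_le_trans _ _ _ (range f)); last exact: card_leT.
have := inj_card_eq (A := setT) (f := f) (fun x y _ _ => @fI x y).
by rewrite card_eq_le => /andP[].
Qed.

Lemma card_leE T U (A : set T) (B : set U) : (A #<= B) <-> embeds A B.
Proof.
rewrite -card_leTT.
by rewrite (card_le_eql (card_setT A)) (card_le_eqr (card_setT B)).
Qed.

Lemma card_leT_embeds T U (A : set T) : (A #<= [set: U]) <-> embeds A U.
Proof. by rewrite -card_leTT (card_le_eql (card_setT A)). Qed.

(** Among the sets of choice functions which differ pairwise at every index,
    take a maximal one. If it missed a point of every member of the family, those
    points would form one more choice function; so it projects bijectively onto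
    some member, and its other projections are the embeddings. *)
Lemma embeds_least (I : Type) (F : I -> Type) (i0 : I) :
  exists i, forall j, embeds (F i) (F j).
Proof.
pose P (Z : set (forall i, F i)) :=
  forall z w, Z z -> Z w -> (exists i, z i = w i) -> z = w.
have [C CP Ctot z w [X CX Xz] [Y CY Yw]|Z [ZP Zmax]] := @Zorn_bigcup _ P.
  have [XY|YX] := Ctot _ _ CX CY.
    exact: (CP _ CY) (XY _ Xz) Yw.
  exact: (CP _ CX) Xz (YX _ Yw).
case: (pselect (exists i, forall y : F i, exists z, Z z /\ z i = y)) => [|noi].
  move=> [i hi]; exists i => j.
  pose g y := projT1 (cid (hi y)).
  have gP y : Z (g y) /\ g y i = y := projT2 (cid (hi y)).
  exists (fun y => g y j) => y y' gg.
  rewrite -(gP y).2 -(gP y').2; congr (_ i).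
  by apply: ZP (gP y).1 (gP y').1 _; exists j.
have new i : exists y : F i, forall z, Z z -> z i <> y.
  apply: contrapT => h; apply: noi; exists i => y.
  by apply: contrapT => h'; apply: h; exists y => z Zz zy; apply: h'; exists z.
pose z i := projT1 (cid (new i)).
have zP i w : Z w -> w i <> z i by apply: (projT2 (cid (new i))).
exfalso; apply: (Zmax (z |` Z)).
  split=> [w Zw|sub]; first by right.
  by have /zP/(_ erefl) := sub z (or_introl erefl) => /(_ i0).
move=> u v [->|Zu] [->|Zv] // [i].
- by move=> /esym/zP.
- by move=> /zP.
- by move=> e; apply: ZP => //; exists i.
Qed.

Lemma embeds_total A B : embeds A B \/ embeds B A.
Proof.
have [[] h] := embeds_least (fun b : bool => if b then A else B) true.
  by left; apply: (h false).
by right; apply: (h true).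
Qed.

Definition to_sub T (A : set T) x (Ax : A x) : set_type A := SigSub (mem_set Ax).

(** Hessenberg's theorem. The graphs of injections from A * A to A, for
    A a subset of T containing a fixed countable set, are partially ordered by
    inclusion. If (A, f) is maximal then the complement of A does not contain a
    copy B of A, for otherwise f would extend to the union of A and B: the pairs
    not in A * A are coded, with a tag, in A and thence in B. So the complement
    embeds in A, and T embeds in A by means of f and one tag. *)
Section Square.
Variables (T : Type) (h : nat -> T).
Hypothesis hI : injective h.

Local Notation triple := (T * T * T)%type.

Let rel_field (R : set triple) x :=
  exists y z, [\/ R (x, y, z), R (y, x, z) | R (y, z, x)].

(** R is the graph of an injection on the square of its field, with values in
    its field. *)
Let good (R : set triple) :=
  (forall x y z x' y' z', R (x, y, z) -> R (x', y', z') ->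
     z = z' <-> x = x' /\ y = y') /\
  (forall x y, rel_field R x -> rel_field R y -> exists z, R (x, y, z)).

Let base : set triple :=
  [set t | exists m n, t = (h m, h n, h (pickle (m, n)))].

Let good_base : good base.
Proof.
split=> [x y z x' y' z' [m [n [-> -> ->]]] [m' [n' [-> -> ->]]]|].
  split=> [/hI/(pcan_inj pickleK)[-> ->]//|[/hI-> /hI->]//].
have fb x : rel_field base x -> exists n, x = h n.
  by move=> [y [z [] [m [n [? ? ?]]]]]; eexists; eassumption.
by move=> x y /fb[m ->] /fb[n ->]; exists (h (pickle (m, n))), m, n.
Qed.

Let good_chain (F : set (set triple)) :
  F `<=` [set R | good (base `|` R)] -> total_on F subset ->
  good (base `|` \bigcup_(X in F) X).
Proof.
set G := base `|` _ => FP Ftot.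
have dir t t' : G t -> G t' -> exists R, [/\ good R, R `<=` G, R t & R t'].
  have sub X : F X -> base `|` X `<=` G.
    by move=> FX u [bu|Xu]; [left|right; exists X].
  move=> [bt|[X FX Xt]] [bt'|[Y FY Yt']].
  - by exists base; split=> // u bu; left.
  - by exists (base `|` Y); split; [exact: FP|exact: sub|left|right].
  - by exists (base `|` X); split; [exact: FP|exact: sub|right|left].
  - have [XY|YX] := Ftot _ _ FX FY.
      exists (base `|` Y); split; [exact: FP|exact: sub|right|by right].
      exact: XY.
    exists (base `|` X); split; [exact: FP|exact: sub|by right|right].
    exact: YX.
split=> [x y z x' y' z' Gt Gt'|x y].
  by have [R [[gR _] _ Rt Rt']] := dir _ _ Gt Gt'; apply: gR.
have fdir u : rel_field G u -> exists t, G t /\ forall R, R t -> rel_field R u.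
  by move=> [y1 [z1 [] Gt]]; eexists; split; try eassumption;
    move=> R Rt; exists y1, z1; [apply: Or31|apply: Or32|apply: Or33].
move=> /fdir[t [Gt tx]] /fdir[t' [Gt' ty]].
have [R [[_ gR] RG Rt Rt']] := dir _ _ Gt Gt'.
by have [z Rz] := gR x y (tx _ Rt) (ty _ Rt'); exists z; apply: RG.
Qed.

Lemma embeds_square_of : embeds (T * T) T.
Proof.
have [R [gR Rmax]] := Zorn_bigcup good_chain.
set G := base `|` R in gR; have [gI gtot] := gR.
pose A : set T := rel_field G.
have fex (p : T * T) : exists z, A p.1 -> A p.2 -> G (p.1, p.2, z).
  case: (pselect (A p.1 /\ A p.2)) => [[a b]|nab].
    by have [z ?] := gtot _ _ a b; exists z.
  by exists p.1 => a b; case: nab.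
have [f0 f0P] := choice fex; pose f x y := f0 (x, y).
have fG x y : A x -> A y -> G (x, y, f x y) by move=> *; exact: (f0P (x, y)).
have fA x y : A x -> A y -> A (f x y).
  by move=> Ax Ay; exists x, y; apply: Or33; apply: fG.
have fI x y x' y' : A x -> A y -> A x' -> A y' -> f x y = f x' y' ->
    x = x' /\ y = y'.
  by move=> Ax Ay Ax' Ay'; apply/(gI _ _ _ _ _ _ (fG x y Ax Ay) (fG x' y' Ax' Ay')).1.
have Ah n : A (h n).
  exists (h 0%N), (h (pickle (n, 0%N))); apply: Or31; left.
  by exists n, 0.
have [[g gNI]|[g gNI]] := embeds_total (~` A) A.
  pose k x := if pselect (A x) is right nA then
    f (set_val (g (@to_sub _ (~` A) x nA))) (h 1%N) else f x (h 0%N).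
  have gA x : A (set_val (g x)) by apply: set_mem; apply: valP.
  have kA x : A (k x) by rewrite /k; case: pselect => ?; apply: fA.
  have kI : injective k.
    move=> x y; rewrite /k; case: pselect => Ax; case: pselect => Ay.
    - by move=> /fI[].
    - by move=> /fI[] // _ /hI.
    - by move=> /fI[] // _ /hI.
    - by move=> /fI[] // /val_inj/gNI[].
  exists (fun p => f (k p.1) (k p.2)).
  by move=> [x y] [x' y'] /= /fI[] // /kI -> /kI ->.
pose k x := if pselect (A x) is left Ax then
    set_val (g (SigSub (mem_set Ax))) else x.
have kN x : A x -> ~ A (k x).
  move=> Ax; rewrite /k; case: pselect => // {}Ax.
  exact: (set_mem (valP (g _))).
have kI x y : A x -> A y -> k x = k y -> x = y.
  move=> Ax Ay; rewrite /k; case: pselect => // {}Ax.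
  by case: pselect => // {}Ay /val_inj/gNI[].
(* Points of the union of A and its copy are written pos b x with x in A. *)
pose pos (b : bool) x := if b then k x else x.
have posI b b' x x' : A x -> A x' -> pos b x = pos b' x' -> b = b' /\ x = x'.
  move=> Ax Ax'; case: b b' => [] [] /= e.
  - by rewrite (kI _ _ Ax Ax' e).
  - by case: (kN _ Ax); rewrite e.
  - by case: (kN _ Ax'); rewrite -e.
  - by [].
pose val_ (b b' : bool) x y := k (f (f x y) (h (b + b'.*2)%N)).
pose N : set triple := [set t | exists (b b' : bool) (x y : T),
  [/\ b || b', A x, A y & t = (pos b x, pos b' y, val_ b b' x y)]].
have Gfld x y z : G (x, y, z) -> [/\ A x, A y & A z].
  move=> Gt; split; [exists y, z; exact: Or31|exists x, z; exact: Or32|].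
  by exists x, y; exact: Or33.
have NA b b' x y : A x -> A y -> ~ A (val_ b b' x y).
  by move=> Ax Ay; apply: (kN); apply: (fA) => //; apply: fA.
exfalso; apply: (Rmax (G `|` N)).
  split=> [t Rt|sub]; first by left; right.
  have /sub Rn : (G `|` N) (k (h 0%N), h 0, val_ true false (h 0%N) (h 0%N)).
    by right; exists true, false, (h 0%N), (h 0%N).
  have [_ _] := Gfld _ _ _ (or_intror Rn : G _).
  exact: NA.
suff : good (G `|` N).
  move=> gGN; suff e : base `|` (G `|` N) = G `|` N by rewrite /= e.
  by rewrite setUA; congr (_ `|` _); rewrite /G setUA setUid.
have fldGN x : rel_field (G `|` N) x -> exists b x0, A x0 /\ x = pos b x0.
  move=> [y [z [] [Gt|[b [b' [x1 [y1 [_ Ax Ay [? ? ?]]]]]]]]]; subst.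
  - by exists false, x; have [] := Gfld _ _ _ Gt.
  - by exists b, x1.
  - by exists false, x; have [] := Gfld _ _ _ Gt.
  - by exists b', y1.
  - by exists false, x; have [] := Gfld _ _ _ Gt.
  - by exists true; eexists; split; last reflexivity; apply: (fA) => //; apply: fA.
split=> [x y z x' y' z'|x y /fldGN[b [x0 [Ax ->]]] /fldGN[b' [y0 [Ay ->]]]].
  have old_new : forall x y z x' y' z', G (x, y, z) -> N (x', y', z') ->
      z = z' <-> x = x' /\ y = y'.
    move=> {}x {}y {}z {}x' {}y' {}z' Gt [b [b' [x1 [y1 [bb Ax Ay [-> -> ->]]]]]].
    have [A1 A2 A3] := Gfld _ _ _ Gt.
    split=> [e|[e e']]; first by case: (NA b b' x1 y1); rewrite -?e.
    case: b b' bb e e' {Gt} => [] [] //= _ e e'.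
    - by case: (kN _ Ax); rewrite -e.
    - by case: (kN _ Ax); rewrite -e.
    - by case: (kN _ Ay); rewrite -e'.
  move=> [Gt|Nt] [Gt'|Nt'].
  - exact: gI.
  - exact: old_new.
  - by have [a b] := old_new _ _ _ _ _ _ Gt' Nt; split=> [/esym/a[]|[/esym ? /esym ?]] //;
      apply/esym/b.
  move: Nt Nt' => [b [c [u [v [bc Au Av [-> -> ->]]]]]].
  move=> [b' [c' [u' [v' [bc' Au' Av' [-> -> ->]]]]]].
  split=> [/kI|[/posI[]// -> -> /posI[]// -> -> //]].
  move=> /(_ (fA _ _ (fA _ _ Au Av) (Ah _)) (fA _ _ (fA _ _ Au' Av') (Ah _))).
  move=> /fI[]//; try exact: fA.
  move=> /fI[]// -> -> /hI.
  by case: b c b' c' {bc bc'} => [] [] [] [].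
case bb: (b || b').
  by exists (val_ b b' x0 y0); right; exists b, b', x0, y0.
move/negbT: bb; rewrite negb_or => /andP[/negbTE-> /negbTE->] /=.
by exists (f x0 y0); left; apply: fG.
Qed.

End Square.

Lemma embeds_square T : embeds nat T -> embeds (T * T) T.
Proof. by move=> [h hI]; apply: embeds_square_of hI. Qed.

(** Folding a pairing function is injective on the lists of a given length. *)
Lemma embeds_seq T : embeds nat T -> embeds (seq T) T.
Proof.
move=> nT; have [p pI] := embeds_square nT; have [h hI] := nT.
pose c := foldr (fun x r => p (x, r)) (h 0%N).
exists (fun s => p (h (size s), c s)) => s t /pI[/hI].
elim: s t => [|x s IH] [|y t] //= [st] /pI[-> /IH -> //].
Qed.

Lemma embeds_seqs A B : embeds A B -> embeds (seq A) (seq B).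
Proof. by move=> [f fI]; exists (map f); apply: inj_map. Qed.

Lemma embeds_image_sub T U (f : T -> U) (A : set U) :
  (forall y, A y -> exists x, f x = y) -> embeds A T.
Proof.
move=> fA; have ex (y : A) : exists x, f x = set_val y.
  exact: fA (set_mem (valP y)).
have [g gP] := choice ex; exists g => x y gxy; apply: val_inj.
by rewrite /= -[LHS]gP -[RHS]gP gxy.
Qed.

Lemma Cantor_embeds T : ~ embeds (T -> bool) T.
Proof.
move=> [f fI]; pose D x := `[< exists g, f g = x /\ g x = false >].
case E: (D (f D)); first by have /asboolP[g [/fI ->]] := E; rewrite E.
have /negP := negbT E; apply; apply/asboolP; by exists D.
Qed.

(** * Real numbers *)

Lemma pow2_gt0 (R : realType) n : (0 : R) < 2 ^- n.
Proof. by rewrite invr_gt0 exprn_gt0. Qed.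

Lemma pow2S (R : realType) n : (2 : R) ^- n = 2 ^- n.+1 + 2 ^- n.+1.
Proof. by rewrite exprS invfM -mulrDl [X in X * _](_ : _ = 1) ?mul1r//; lra. Qed.

Lemma pow2_small (R : realType) (e : R) : 0 < e -> exists n, 2 ^- n < e.
Proof.
move=> e0; have h : (0 : R) <= 1 / 2 by lra.
have /cvgrPdist_lt/(_ e e0)[n _ /(_ n (leqnn _))] :
    (fun n => (1 / 2 : R) ^+ n) @ \oo --> (0 : R).
  by apply: cvg_expr; rewrite ger0_norm; lra.
rewrite sub0r normrN ger0_norm; last exact: exprn_ge0.
by rewrite expr_div_n expr1n div1r => ne; exists n.
Qed.

Section SupInf.
Variables (R : realType) (T : Type) (f : T -> R).
Hypotheses (Ti : inhabited T) (f01 : forall x, 0 <= f x <= 1).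

Let f_sup : has_sup (range f).
Proof.
have [x] := Ti; split; first by exists (f x), x.
by exists 1 => _ [y _ <-]; case/andP: (f01 y).
Qed.

Let f_inf : has_inf (range f).
Proof.
have [x] := Ti; split; first by exists (f x), x.
by exists 0 => _ [y _ <-]; case/andP: (f01 y).
Qed.

Lemma le_sup_range x : f x <= sup (range f).
Proof. by apply: sup_upper_bound => //; exists x. Qed.

Lemma sup_range_le r : (forall x, f x <= r) -> sup (range f) <= r.
Proof. by move=> fr; apply: ge_sup => [|_ [x _ <-] //]; case: f_sup. Qed.

Lemma sup_range_adherent e : 0 < e -> exists x, sup (range f) - e < f x.
Proof. by move=> /sup_adherent/(_ f_sup)[_ [x _ <-] ?]; exists x. Qed.

Lemma inf_range_le x : inf (range f) <= f x.
Proof. by apply: ge_inf; [case: f_inf|exists x]. Qed.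

Lemma le_inf_range r : (forall x, r <= f x) -> r <= inf (range f).
Proof. by move=> fr; apply: lb_le_inf => [|_ [x _ <-] //]; case: f_inf. Qed.

Lemma inf_range_adherent e : 0 < e -> exists x, f x < inf (range f) + e.
Proof. by move=> /inf_adherent/(_ f_inf)[_ [x _ <-] ?]; exists x. Qed.

Lemma sup_range_itv : 0 <= sup (range f) <= 1.
Proof.
have [x] := Ti; apply/andP; split.
  by apply: le_trans (le_sup_range x); case/andP: (f01 x).
by apply: sup_range_le => y; case/andP: (f01 y).
Qed.

Lemma inf_range_itv : 0 <= inf (range f) <= 1.
Proof.
have [x] := Ti; apply/andP; split.
  by apply: le_inf_range => y; case/andP: (f01 y).
by apply: le_trans (inf_range_le x) _; case/andP: (f01 x).
Qed.

End SupInf.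

Lemma eq_sup_range (R : realType) T (f g : T -> R) :
  f =1 g -> sup (range f) = sup (range g).
Proof. by move=> /funext->. Qed.

Lemma eq_inf_range (R : realType) T (f g : T -> R) :
  f =1 g -> inf (range f) = inf (range g).
Proof. by move=> /funext->. Qed.

(** * Tuples, renaming of variables and quantification over tuples *)

Lemma split_lshift m n (i : 'I_m) : fintype.split (lshift n i) = inl i.
Proof. exact: (unsplitK (inl i)). Qed.

Lemma split_rshift m n (i : 'I_n) : fintype.split (rshift m i) = inr i.
Proof. exact: (unsplitK (inr i)). Qed.

Section TupleLemmas.
Variables (S : univ) (M : S -> univ).

Lemma existT_inj s (x y : M s) : existT M s x = existT M s y -> x = y.
Proof.
move=> e; have := projT2_eq e; rewrite /=.
by rewrite (Prop_irrelevance (projT1_eq e) (erefl s)).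
Qed.

(** A component with its sort. Components of tuples over different contexts have
    different types, but these pairs can be compared without casts. *)
Definition pt G (a : tup M G) i : {s & M s} := existT M (G i) (a i).

Lemma tup_eq G (a b : tup M G) : (forall i, pt a i = pt b i) -> a = b.
Proof.
by move=> ab; apply: (@functional_extensionality_dep _ (fun i => M (G i))) => i;
  apply: existT_inj (ab i).
Qed.

Lemma pt_catl G H (a : tup M G) (b : tup M H) i :
  pt (tup_cat a b) (lshift (arity H) i) = pt a i.
Proof.
rewrite /pt /tup_cat /=.
by rewrite split_lshift.
Qed.

Lemma pt_catr G H (a : tup M G) (b : tup M H) i :
  pt (tup_cat a b) (rshift (arity G) i) = pt b i.
Proof.
rewrite /pt /tup_cat /=.
by rewrite split_rshift.
Qed.

Lemma pt_ext0 G s (a : tup M G) (x : M s) :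
  pt (tup_ext a x) ord0 = existT M s x.
Proof. by rewrite /pt /tup_ext /= unlift_none. Qed.

Lemma pt_ext_lift G s (a : tup M G) (x : M s) i :
  pt (tup_ext a x) (lift ord0 i) = pt a i.
Proof. by rewrite /pt /tup_ext /= liftK. Qed.

End TupleLemmas.

Lemma ctx_ind (S : univ) (P : ctx S -> Prop) :
  (forall G, arity G = 0%N -> P G) ->
  (forall G s, P G -> P (ctx_ext G s)) -> forall G, P G.
Proof.
move=> P0 PS [n]; elim: n => [|n IH] G; first exact: P0.
suff -> : Ctx G = ctx_ext (Ctx (fun i => G (lift ord0 i))) (G ord0).
  by apply: PS; apply: IH.
rewrite /ctx_ext /=; congr Ctx; apply/funext => i.
by case: (unliftP ord0 i) => [j|] ->.
Qed.

Lemma sigT_at (S : univ) (M : S -> univ) (u : {s & M s}) s :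
  projT1 u = s -> exists x : M s, u = existT M s x.
Proof. by case: u => s' x /= <-; exists x. Qed.

Lemma tup_ext_surj (S : univ) (M : S -> univ) (G : ctx S) s
    (a : tup M (ctx_ext G s)) : exists (b : tup M G) x, a = tup_ext b x.
Proof.
have h i : exists x : M (G i), pt a (lift ord0 i) = existT M (G i) x.
  by apply: sigT_at; rewrite /= liftK.
have [x ax] : exists x : M s, pt a ord0 = existT M s x.
  by apply: sigT_at; rewrite /= unlift_none.
exists (fun i => projT1 (cid (h i))), x; apply: tup_eq => i.
case: (unliftP ord0 i) => [j|] ->; last by rewrite pt_ext0.
by rewrite pt_ext_lift (projT2 (cid (h j))).
Qed.

Section Renaming.
Variables (R : realType) (L : signature R).
Implicit Types G H : ctx (lsort L).

(** A renaming of variables is applied to tuples through this relation rather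
    than by a function, which would have to transport each component along an
    equality of sorts. *)
Definition reindexes (M : lsort L -> univ) G H (rho : 'I_(arity G) -> 'I_(arity H))
    (a : tup M H) (b : tup M G) :=
  forall i, pt a (rho i) = pt b i.

Lemma term_rename G H (rho : 'I_(arity G) -> 'I_(arity H))
    (hrho : forall i, H (rho i) = G i) s (t : term G s) :
  exists t' : term H s, forall (M : structure L) (a : tup M H) (b : tup M G),
    reindexes rho a b -> teval a t' = teval b t.
Proof.
elim: t => [i|f ts IH].
  have : exists t' : term H (G i), forall (M : structure L) (a : tup M H),
      existT M (G i) (teval a t') = pt a (rho i).
    by case: _ / (hrho i); exists (Var (rho i)).
  move=> [t' t'P]; exists t' => M a b /(_ i) ab.
  by apply: existT_inj; rewrite t'P ab.
exists (App (fun i => projT1 (cid (IH i)))) => M a b ab /=; congr fint.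
apply: (@functional_extensionality_dep _ (fun i => M (fdom f i))) => i.
exact: (projT2 (cid (IH i))).
Qed.

Definition rho_ext n m (rho : 'I_n -> 'I_m) (i : 'I_n.+1) : 'I_m.+1 :=
  if unlift ord0 i is Some j then lift ord0 (rho j) else ord0.

Lemma rho_extP G H (rho : 'I_(arity G) -> 'I_(arity H)) s
    (hrho : forall i, H (rho i) = G i) i :
  ctx_ext H s (@rho_ext (arity G) (arity H) rho i) = ctx_ext G s i.
Proof.
rewrite /rho_ext /=; case: (unliftP ord0 i) => [j _|_].
  by rewrite liftK hrho.
by rewrite unlift_none.
Qed.

Lemma reindexes_ext (M : lsort L -> univ) G H (rho : 'I_(arity G) -> 'I_(arity H))
    s (a : tup M H) (b : tup M G) (x : M s) :
  reindexes rho a b ->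
  @reindexes M (ctx_ext G s) (ctx_ext H s) (rho_ext rho) (tup_ext a x) (tup_ext b x).
Proof.
move=> ab i; rewrite /rho_ext; case: (unliftP ord0 i) => [j|] ->.
  by rewrite !pt_ext_lift ab.
by rewrite !pt_ext0.
Qed.

Lemma rename G H (rho : 'I_(arity G) -> 'I_(arity H))
    (hrho : forall i, H (rho i) = G i) (phi : formula G) :
  exists phi' : formula H, forall (M : structure L) (a : tup M H) (b : tup M G),
    reindexes rho a b -> feval phi' a = feval phi b.
Proof.
elim: phi H rho hrho => {G} [G P ts|G p IH|G p IH|G p IHp q IHq|G s p IH|G s p IH]
    H rho hrho.
- exists (Atom (fun i => projT1 (cid (term_rename hrho (ts i))))) => M a b ab /=.
  congr pint; apply: (@functional_extensionality_dep _ (fun i => M (pdom P i))) => i.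
  exact: (projT2 (cid (term_rename hrho (ts i)))).
- have [p' p'P] := IH _ _ hrho; exists (Neg p') => M a b /p'P /= -> //.
- have [p' p'P] := IH _ _ hrho; exists (Half p') => M a b /p'P /= -> //.
- have [p' p'P] := IHp _ _ hrho; have [q' q'P] := IHq _ _ hrho.
  by exists (Dotminus p' q') => M a b ab /=; rewrite (p'P _ _ _ ab) (q'P _ _ _ ab).
- have [p' p'P] := IH _ _ (rho_extP s hrho).
  exists (Sup p') => M a b ab /=; apply: eq_sup_range => x.
  exact: (p'P _ _ _ (reindexes_ext x ab)).
- have [p' p'P] := IH _ _ (rho_extP s hrho).
  exists (Inf p') => M a b ab /=; apply: eq_inf_range => x.
  exact: (p'P _ _ _ (reindexes_ext x ab)).
Qed.

Lemma feval_itv (M : structure L) G (phi : formula G) (a : tup M G) :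
  0 <= feval phi a <= 1.
Proof.
elim: phi a => {G} [G P ts|G p IH|G p IH|G p IHp q IHq|G s p IH|G s p IH] a /=.
- exact: pint_itv.
- by have /andP[? ?] := IH a; apply/andP; split; lra.
- by have /andP[? ?] := IH a; apply/andP; split; lra.
- have /andP[? ?] := IHp a; have /andP[? ?] := IHq a.
  by rewrite le_max ge_max lexx orbT /=; apply/andP; split; lra.
- by apply: sup_range_itv => [|x]; [exact: carrier_inhabited|exact: IH].
- by apply: inf_range_itv => [|x]; [exact: carrier_inhabited|exact: IH].
Qed.

Lemma tup_inhabited (M : structure L) G : inhabited (tup M G).
Proof.
have h i : exists x : M (G i), True by have [x] := carrier_inhabited M (G i); exists x.
by split; exact: (fun i => projT1 (cid (h i))).
Qed.

Lemma dist_ge0 (M : structure L) s (x y : M s) : 0 <= dist x y.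
Proof. by case/andP: (pint_itv (tup2 x y : tup M (pdom (Dist s)))). Qed.

Lemma dist_le1 (M : structure L) s (x y : M s) : dist x y <= 1.
Proof. by case/andP: (pint_itv (tup2 x y : tup M (pdom (Dist s)))). Qed.

Lemma distxx (M : structure L) s (x : M s) : dist x x = 0.
Proof. exact/dist_eq0. Qed.

(** The quantifiers bind one variable at a time; iterating Inf over the variables
    of xs gives the infimum over all tuples. The infimum is stated by its two
    properties, which compose, instead of an equality between iterated infima. *)
Lemma inf_over_tuple xs G (phi : formula (ctx_cat xs G)) :
  exists psi : formula G, forall (M : structure L) (g : tup M G),
    (forall x : tup M xs, feval psi g <= feval phi (tup_cat x g)) /\
    (forall e : R, 0 < e ->
       exists x : tup M xs, feval phi (tup_cat x g) < feval psi g + e).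
Proof.
elim/ctx_ind: xs phi => [xs xs0|xs s IH] phi.
  have rho0 (i : 'I_(arity xs)) : False by move: i; rewrite xs0 => -[].
  pose rho (i : 'I_(arity (ctx_cat xs G))) : 'I_(arity G) :=
    match fintype.split i with inl j => match rho0 j with end | inr k => k end.
  have hrho i : G (rho i) = ctx_cat xs G i.
    by rewrite /rho /=; case: (fintype.split i) => [j|k] //; case: (rho0 j).
  have [psi psiP] := rename hrho phi.
  have key (M : structure L) (g : tup M G) (x : tup M xs) :
      feval psi g = feval phi (tup_cat x g).
    apply: psiP => i; rewrite /rho; case: (split_ordP i) => [j|k] ->.
      by case: (rho0 j).
    by rewrite pt_catr.
  exists psi => M g; split=> [x|e e0]; first by rewrite (key _ _ x).
  have [x] := tup_inhabited M xs; by exists x; rewrite -key ltrDl.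
pose H := ctx_ext (ctx_cat xs G) s.
pose rho (i : 'I_(arity (ctx_cat (ctx_ext xs s) G))) : 'I_(arity H) :=
  match fintype.split i with
  | inl j => if unlift ord0 j is Some k then lift ord0 (lshift (arity G) k)
             else ord0
  | inr k => lift ord0 (rshift (arity xs) k) end.
have key (M : lsort L -> univ) (x' : tup M xs) (x : M s) (g : tup M G) :
    reindexes rho (tup_ext (tup_cat x' g) x) (tup_cat (tup_ext x' x) g).
  move=> i; rewrite /rho; case: (split_ordP i) => [j|k] ->.
    rewrite pt_catl; case: (unliftP ord0 j) => [k|] ->.
      by rewrite !pt_ext_lift pt_catl.
    by rewrite !pt_ext0.
  by rewrite pt_catr pt_ext_lift pt_catr.
(* The equality of sorts is read off from tuples of elements of unit. *)
have hrho i : H (rho i) = ctx_cat (ctx_ext xs s) G i.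
  have := key (fun _ => unit) (fun _ => tt) tt (fun _ => tt) i.
  by move/(congr1 (@projT1 _ _)).
have [phi' phi'P] := rename hrho phi.
have [psi psiP] := IH (Inf phi').
exists psi => M g; have [lepsi adh] := psiP M g.
have i01 z x : 0 <= feval phi' (tup_ext (tup_cat z g) x) <= 1 by exact: feval_itv.
split=> [x|e e0].
  have [x' [x0 ->]] := tup_ext_surj x.
  apply: le_trans (lepsi x') _ => /=.
  rewrite -(phi'P _ _ _ (key _ x' x0 g)).
  exact: (inf_range_le (carrier_inhabited M s)).
have e20 : 0 < e / 2 by lra.
have [x' x'P] := adh _ e20.
have [x0 x0P] := inf_range_adherent (carrier_inhabited M s) (i01 x') e20.
exists (tup_ext x' x0); rewrite -(phi'P _ _ _ (key _ x' x0 g)).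
by move: x'P x0P => /=; lra.
Qed.

End Renaming.

(** * Formulae with parameters and values of types *)

Notation par p := (ppar (p := p)).

Section ParameterFormulas.
Variables (R : realType) (L : signature R) (M : structure L).
Variables (xs : ctx (lsort L)).
Implicit Types psi chi : pformula M xs.

(** The formula chi does not depend on the extension N: it has the prescribed value
    both at the realisations of types in extensions and at the tuples of M. *)
Definition represents chi (F : forall N : structure L, (forall s, M s -> N s) ->
    tup N xs -> R) :=
  forall N j a, peval (N := N) j chi a = F N j a.

Lemma tup_map_cat (N : structure L) (j : forall s, M s -> N s) G H
    (a : tup M G) (b : tup M H) :
  tup_map j (tup_cat a b) = tup_cat (tup_map j a) (tup_map j b).
Proof.
apply: tup_eq => i; case: (split_ordP i) => [k|k] ->.
  by rewrite pt_catl /pt /tup_map /tup_cat /= split_lshift.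
by rewrite pt_catr /pt /tup_map /tup_cat /= split_rshift.
Qed.

Lemma peval_itv (N : structure L) (j : forall s, M s -> N s) psi (a : tup N xs) :
  0 <= peval j psi a <= 1.
Proof. exact: feval_itv. Qed.

Lemma represents_neg psi :
  exists chi, represents chi (fun N j a => 1 - peval j psi a).
Proof. by exists (PFormula (Neg (pbody psi)) (par psi)). Qed.

Lemma represents_half psi :
  exists chi, represents chi (fun N j a => peval j psi a / 2).
Proof. by exists (PFormula (Half (pbody psi)) (par psi)). Qed.

Lemma represents_dotminus psi psi' :
  exists chi, represents chi
    (fun N j a => Num.max (peval j psi a - peval j psi' a) 0).
Proof.
case: psi psi' => G p g [H q h].
pose K := ctx_cat xs (ctx_cat G H).
pose rl (i : 'I_(arity (ctx_cat xs G))) : 'I_(arity K) :=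
  match fintype.split i with
  | inl k => lshift _ k | inr k => rshift _ (lshift _ k) end.
pose rr (i : 'I_(arity (ctx_cat xs H))) : 'I_(arity K) :=
  match fintype.split i with
  | inl k => lshift _ k | inr k => rshift _ (rshift _ k) end.
have kl (N : lsort L -> univ) (a : tup N xs) (b : tup N G) (c : tup N H) :
    reindexes rl (tup_cat a (tup_cat b c)) (tup_cat a b).
  move=> i; rewrite /rl; case: (split_ordP i) => [k|k] ->.
    by rewrite !pt_catl.
  by rewrite !pt_catr pt_catl.
have kr (N : lsort L -> univ) (a : tup N xs) (b : tup N G) (c : tup N H) :
    reindexes rr (tup_cat a (tup_cat b c)) (tup_cat a c).
  move=> i; rewrite /rr; case: (split_ordP i) => [k|k] ->.
    by rewrite !pt_catl.
  by rewrite !pt_catr.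
have hl i : K (rl i) = ctx_cat xs G i.
  have := kl (fun _ => unit) (fun _ => tt) (fun _ => tt) (fun _ => tt) i.
  by move/(congr1 (@projT1 _ _)).
have hr i : K (rr i) = ctx_cat xs H i.
  have := kr (fun _ => unit) (fun _ => tt) (fun _ => tt) (fun _ => tt) i.
  by move/(congr1 (@projT1 _ _)).
have [p' p'P] := rename hl p; have [q' q'P] := rename hr q.
exists (PFormula (Dotminus p' q') (tup_cat g h)) => N j a.
rewrite /peval /= tup_map_cat.
by rewrite (p'P _ _ _ (kl _ _ _ _)) (q'P _ _ _ (kr _ _ _ _)).
Qed.

(** The connectives allow the dyadic constants, hence approximations of all
    the constants in [0, 1]. *)
Lemma represents_const psi (r e : R) : 0 <= r <= 1 -> 0 < e ->
  exists chi c, [/\ 0 <= c <= 1, `|c - r| <= e & represents chi (fun _ _ _ => c)].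
Proof.
move=> r01 e0.
have [n /ltW ne] := pow2_small e0.
elim: n r e r01 e0 ne => [|n IH] r e r01 e0 ne.
  have [chi chiP] := represents_dotminus psi psi.
  exists chi, 0; rewrite lexx ler01 sub0r normrN; split=> //.
    by rewrite ger0_norm; move: ne; rewrite expr0 invr1; lra.
  by move=> N j a; rewrite chiP subrr maxxx.
have {}ne : 2 ^- n <= 2 * e by rewrite pow2S; lra.
have [rle|rgt] := leP r (1 / 2).
  have [|||chi [c [c01 cr chiP]]] := IH (2 * r) (2 * e); try lra.
  have [chi' chi'P] := represents_half chi.
  exists chi', (c / 2); split=> [||N j a]; last by rewrite chi'P chiP.
    lra.
  by move: cr; rewrite !ler_norml; lra.
have [|||chi [c [c01 cr chiP]]] := IH (2 * (1 - r)) (2 * e); try lra.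
have [chi' chi'P] := represents_half chi.
have [chi2 chi2P] := represents_neg chi'.
exists chi2, (1 - c / 2); split=> [||N j a]; last by rewrite chi2P chi'P chiP.
  lra.
by move: cr; rewrite !ler_norml; lra.
Qed.

Lemma represents_max psi psi' :
  exists chi, represents chi (fun N j a => Num.max (peval j psi a) (peval j psi' a)).
Proof.
have [n nP] := represents_neg psi; have [n' n'P] := represents_neg psi'.
have [d dP] := represents_dotminus n n'; have [m mP] := represents_dotminus n d.
have [chi chiP] := represents_neg m; exists chi => N j a.
rewrite chiP mP dP nP n'P.
have := peval_itv j psi a; have := peval_itv j psi' a.
move: (peval j psi a) (peval j psi' a) => x y /andP[y0 y1] /andP[x0 x1].
case: (leP x y) => xy.
  rewrite [Num.max (_ - (1 - y)) 0]max_l; last by lra.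
  by rewrite max_l; lra.
rewrite [Num.max (_ - (1 - y)) 0]max_r; last by lra.
by rewrite max_l; lra.
Qed.

Lemma represents_dist psi psi' :
  exists chi, represents chi (fun N j a => `|peval j psi a - peval j psi' a|).
Proof.
have [d dP] := represents_dotminus psi psi'.
have [d' d'P] := represents_dotminus psi' psi.
have [chi chiP] := represents_max d d'; exists chi => N j a.
rewrite chiP dP d'P; set x := peval j psi a; set y := peval j psi' a.
have [xy|xy] := leP x y.
  rewrite ler0_norm ?subr_le0// [Num.max (x - y) 0]max_r ?subr_le0//.
  by rewrite [Num.max (y - x) 0]max_l ?subr_ge0// max_r ?subr_ge0// opprB.
rewrite gtr0_norm ?subr_gt0// [Num.max (x - y) 0]max_l ?subr_ge0 ?(ltW xy)//.
by rewrite [Num.max (y - x) 0]max_r ?subr_le0 ?(ltW xy)// max_l// subr_ge0 ltW.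
Qed.

(** The formula is a maximum of distances to constants approximating the r i, which
    need not be constants of the language. *)
Lemma represents_near (psi : nat -> pformula M xs) (r : nat -> R) n (e : R) :
  (forall i, 0 <= r i <= 1) -> 0 < e ->
  exists chi, forall (N : structure L) (j : forall s, M s -> N s) (a : tup N xs),
    ((forall i, (i <= n)%N -> peval j (psi i) a = r i) -> peval j chi a <= e) /\
    (forall i, (i <= n)%N -> `|peval j (psi i) a - r i| <= peval j chi a + e).
Proof.
move=> r01 e0.
have one i : exists chi, forall (N : structure L) (j : forall s, M s -> N s) a,
    (peval (N := N) j (psi i) a = r i -> peval j chi a <= e) /\
    `|peval j (psi i) a - r i| <= peval j chi a + e.
  have [k [c [c01 cr kP]]] := represents_const (psi 0%N) (r01 i) e0.
  have [chi chiP] := represents_dist (psi i) k; exists chi => N j a.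
  rewrite chiP kP; split=> [->|]; first by rewrite distrC.
  by apply: le_trans (ler_distD c _ _) _; rewrite lerD2l.
elim: n => [|n [chi IH]].
  have [chi chiP] := one 0%N; exists chi => N j a; have [A B] := chiP N j a.
  by split=> [/(_ _ (leqnn _))/A //|[]].
have [chi' chi'P] := one n.+1; have [m mP] := represents_max chi chi'.
exists m => N j a; have [A B] := IH N j a; have [A' B'] := chi'P N j a.
rewrite mP; split=> [h|i].
  by rewrite ge_max A => [|i il]; rewrite ?A' ?h// leqW.
rewrite leq_eqVlt ltnS => /orP[/eqP->|/B h].
  by apply: le_trans B' _; rewrite lerD2r le_max lexx orbT.
by apply: le_trans h _; rewrite lerD2r le_max lexx.
Qed.

(** Finite satisfiability: an elementary extension realises only what is
    approximately realised in M. *)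
Lemma elementary_approx (N : structure L) (j : forall s, M s -> N s)
    (psi : nat -> pformula M xs) (a : tup N xs) n (e : R) :
  elementary j -> 0 < e ->
  exists c : tup M xs, forall i, (i <= n)%N ->
    `|peval (fun s (x : M s) => x) (psi i) c - peval j (psi i) a| < e.
Proof.
move=> el e0; have e4 : 0 < e / 4 by lra.
have [chi chiP] := represents_near psi n
  (fun i => peval_itv j (psi i) a) e4.
have [theta thetaP] := inf_over_tuple (pbody chi).
have [low _] := thetaP N (tup_map j (par chi)).
have [_ /(_ _ e4)[c cP]] := thetaP M (par chi).
have [A _] := chiP N j a; have {}A := A (fun _ _ => erefl).
exists c => i ile; have [_ /(_ _ ile) B] := chiP M (fun s x => x) c.
have := low a; rewrite el => C; move: A B cP C.
by rewrite /peval; change (tup_map _ (par chi)) with (par chi) at 2; lra.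
Qed.

(** A type consists of conditions only, but these determine the values of the
    formulae, by comparison with constants. So the choice of the realisation in
    the definition of the value is immaterial. *)
Lemma tvalueE (N : structure L) (j : forall s, M s -> N s) psi (p : ctype M xs)
    (a : tup N xs) : realises j a p -> tvalue psi p = peval j psi a.
Proof.
move=> jap; apply: xget_unique; first by exists N, j, a.
move=> _ [N' [j' [a' [[_ e'] ->]]]]; case: jap => _ e.
have E chi : peval j chi a = 0 <-> peval j' chi a' = 0.
  have := congr1 (@^~ chi) e; rewrite e' /= => h.
  by have := congr1 (@id Prop) h; rewrite /= => ->.
have half (N1 N2 : structure L) (j1 : forall s, M s -> N1 s)
    (j2 : forall s, M s -> N2 s) (a1 : tup N1 xs) (a2 : tup N2 xs) :
    (forall chi, peval j1 chi a1 = 0 -> peval j2 chi a2 = 0) ->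
    peval j2 psi a2 <= peval j1 psi a1.
  move=> h; rewrite leNgt; apply/negP => lt.
  have /andP[u0 u1] := peval_itv j1 psi a1; have /andP[v0 v1] := peval_itv j2 psi a2.
  set u := peval j1 psi a1 in lt u0 u1; set v := peval j2 psi a2 in lt v0 v1.
  have [| |k [c [_ cr kP]]] := represents_const psi (r := (u + v) / 2) (e := (v - u) / 4).
  - by apply/andP; split; lra.
  - lra.
  move: cr; rewrite ler_norml => /andP[c1 c2].
  have [chi chiP] := represents_dotminus psi k.
  have := h chi; rewrite !chiP !kP -/u -/v.
  rewrite max_r; last by lra.
  by rewrite max_l; [lra|lra].
apply/eqP; rewrite eq_le; apply/andP.
by split; apply: half => chi /E.
Qed.

Lemma tvalue_realised (p : ctype M xs) :
  exists (N : structure L) (j : forall s, M s -> N s) (a : tup N xs),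
    elementary j /\ forall psi, tvalue psi p = peval j psi a.
Proof.
have [N [j [a h]]] := ctype_realised p.
by exists N, j, a; split=> [|psi]; [case: h|apply: tvalueE].
Qed.

Lemma tvalue_tp psi (c : tup M xs) :
  tvalue psi (tp c) = peval (fun s (x : M s) => x) psi c.
Proof. by apply: tvalueE; split. Qed.

Lemma tp_elementary (N : structure L) (j : forall s, M s -> N s) (a : tup N xs) :
  elementary j -> exists p : ctype M xs, forall psi, tvalue psi p = peval j psi a.
Proof.
move=> el.
pose p : set (pformula M xs) := [set psi | peval j psi a = 0].
have h : exists (N : structure L) (j : forall s, M s -> N s) (a : tup N xs),
  realises j a p by exists N, j, a.
by exists (CType h) => psi; apply: tvalueE; split.
Qed.

End ParameterFormulas.

Section Swap.
Variables (R : realType) (L : signature R) (M : structure L).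

(** The types in x are defined in terms of the instances of phi in the other
    variable. *)
Lemma represents_swap xs ys (phi : formula (ctx_cat xs ys)) (c : tup M xs) :
  exists chi : pformula M ys,
    represents chi (fun N j b => feval phi (tup_cat (tup_map j c) b)).
Proof.
pose K := ctx_cat ys xs.
pose rho (i : 'I_(arity (ctx_cat xs ys))) : 'I_(arity K) :=
  match fintype.split i with
  | inl k => rshift _ k | inr k => lshift _ k end.
have key (N : lsort L -> univ) (a : tup N xs) (b : tup N ys) :
    reindexes rho (tup_cat b a) (tup_cat a b).
  move=> i; rewrite /rho; case: (split_ordP i) => [k|k] ->.
    by rewrite pt_catl pt_catr.
  by rewrite pt_catl pt_catr.
have hrho i : K (rho i) = ctx_cat xs ys i.
  have := key (fun _ => unit) (fun _ => tt) (fun _ => tt) i.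
  by move/(congr1 (@projT1 _ _)).
have [phi' phi'P] := rename hrho phi.
by exists (PFormula phi' c) => N j b; apply: phi'P; apply: key.
Qed.

End Swap.

(** * Uniform continuity of formulae *)

Section UniformContinuity.
Variables (R : realType) (L : signature R).

(** Moduli in each argument separately give a joint modulus: the arguments are
    changed one after the other. The family of structures, indexed by K, is
    treated at once, since the modulus must not depend on the structure. *)
Lemma joint_modulus (S : univ) (G : ctx S) (Mod : 'I_(arity G) -> R -> R)
    (K : Type) (M : K -> S -> univ) (dst : forall k s, M k s -> M k s -> R)
    (F : forall k, tup (M k) G -> tup (M k) G -> R) :
  (forall k s (x : M k s), dst k _ x x = 0) ->
  (forall i e, 0 < e -> 0 < Mod i e) ->
  (forall k a, F k a a <= 0) ->
  (forall k a b c, F k a c <= F k a b + F k b c) ->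
  (forall k i e a b, 0 < e -> (forall j, j != i -> a j = b j) ->
     dst k _ (a i) (b i) < Mod i e -> F k a b <= e) ->
  forall e, 0 < e -> exists2 d, 0 < d & forall k (a b : tup (M k) G),
    (forall i, dst k _ (a i) (b i) < d) -> F k a b <= e.
Proof.
move=> dst0 Mod0 F0 Ftri Fmod e e0.
pose n := arity G; pose e' := e / n.+1%:R.
have e'0 : 0 < e' by rewrite divr_gt0.
pose d := \big[Num.min/1]_(i < n) Mod i e'.
have d0 : 0 < d.
  by rewrite /d; elim/big_ind: _ => // [x y x0 y0|i _]; [rewrite lt_min x0|exact: Mod0].
have dle i : d <= Mod i e' by rewrite /d (bigD1 i)//= ge_min lexx.
exists d => // k a b ab.
(* c m agrees with b on the first m arguments and with a on the others. *)
pose c m : tup (M k) G := fun i => if (i < m)%N then b i else a i.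
have step m : (m <= n)%N -> F k a (c m) <= e' *+ m.
  elim: m => [|m IH] mn.
    have -> : c 0%N = a by exact: (@functional_extensionality_dep _ (fun i => M k (G i))).
    by rewrite mulr0n.
  apply: le_trans (Ftri _ _ (c m) _) _.
  rewrite mulrSr; apply: lerD; first exact: (IH (ltnW mn)).
  apply: (Fmod k (Ordinal mn)) => // [j jm|].
    have jm' : (j == m :> nat) = false.
      by apply/negbTE; apply: contra jm => /eqP jm; apply/eqP/val_inj.
    by rewrite /c [in RHS]ltnS [in RHS]leq_eqVlt jm'.
  by rewrite /c /= ltnn leqnn; apply: lt_le_trans (ab _) (dle _).
have -> : b = c n.
  by apply: (@functional_extensionality_dep _ (fun i => M k (G i))) => i; rewrite /c ltn_ord.
apply: le_trans (step n (leqnn n)) _; rewrite -mulr_natr /e' -mulrA.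
by rewrite ler_piMr ?(ltW e0)// ler_pdivrMl// mulr1 ler_nat.
Qed.

Lemma fint_joint (f : fsym L) (e : R) : 0 < e ->
  exists2 d, 0 < d & forall (M : structure L) (a b : tup M (fdom f)),
    (forall i, dist (a i) (b i) < d) -> dist (fint a) (fint b) <= e.
Proof.
move: e; refine (@joint_modulus _ (fdom f) (fmod (f := f)) (structure L) (fun M => carrier M)
  (fun M s => @dist R L M s) (fun M a b => dist (fint a) (fint b)) _ _ _ _ _).
- by move=> M s x; rewrite distxx.
- exact: fmod_gt0.
- by move=> M a; rewrite distxx.
- by move=> M a b c; exact: dist_triangle.
- by move=> M i e' a b e'0; exact: fint_unif.
Qed.

Lemma pint_joint (P : psym L) (e : R) : 0 < e ->
  exists2 d, 0 < d & forall (M : structure L) (a b : tup M (pdom P)),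
    (forall i, dist (a i) (b i) < d) -> `|pint a - pint b| <= e.
Proof.
move: e; refine (@joint_modulus _ (pdom P) (pmod (P := P)) (structure L) (fun M => carrier M)
  (fun M s => @dist R L M s) (fun M a b => `|pint a - pint b|) _ _ _ _ _).
- by move=> M s x; rewrite distxx.
- exact: pmod_gt0.
- by move=> M a; rewrite subrr normr0.
- by move=> M a b c; exact: ler_distD.
- by move=> M i e' a b e'0; exact: pint_unif.
Qed.

Lemma common_modulus n (Q : 'I_n -> R -> Prop) :
  (forall i d d', d' <= d -> Q i d -> Q i d') ->
  (forall i, exists2 d, 0 < d & Q i d) -> exists2 d, 0 < d & forall i, Q i d.
Proof.
move=> Qle ex; pose d i := projT1 (cid2 (ex i)).
have dP i : 0 < d i /\ Q i (d i) by rewrite /d; case: (cid2 (ex i)).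
exists (\big[Num.min/1]_(i < n) d i).
  by elim/big_ind: _ => // [x y x0 y0|i _]; [rewrite lt_min x0|case: (dP i)].
by move=> i; apply: Qle (dP i).2; rewrite (bigD1 i)//= ge_min lexx.
Qed.

Lemma teval_unif G s (t : term G s) (e : R) : 0 < e ->
  exists2 d, 0 < d & forall (M : structure L) (a b : tup M G),
    (forall i, dist (a i) (b i) < d) -> dist (teval a t) (teval b t) < e.
Proof.
elim: t e => [i|f ts IH] e e0; first by exists e.
have e20 : 0 < e / 2 by lra.
have [d d0 dP] := fint_joint f e20.
have [|i|d' d'0 d'P] := @common_modulus _ (fun i d' => forall (M : structure L) (a b : tup M G),
    (forall i, dist (a i) (b i) < d') -> dist (teval a (ts i)) (teval b (ts i)) < d).
- by move=> i x y yx h M a b ab; apply: h => k; apply: lt_le_trans (ab k) yx.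
- exact: IH.
exists d' => // M a b ab /=; apply: le_lt_trans (dP M _ _ _) _ => [i|]; last by lra.
exact: d'P.
Qed.

(** Suprema and infima of functions with a common modulus have the same modulus. *)
Lemma feval_unif G (phi : formula G) (e : R) : 0 < e ->
  exists2 d, 0 < d & forall (M : structure L) (a b : tup M G),
    (forall i, dist (a i) (b i) < d) -> `|feval phi a - feval phi b| <= e.
Proof.
elim: phi e => {G} [G P ts|G p IH|G p IH|G p IHp q IHq|G s p IH|G s p IH] e e0.
- have [d d0 dP] := pint_joint P e0.
  have [|i|d' d'0 d'P] := @common_modulus _ (fun i d' => forall (M : structure L) (a b : tup M G),
      (forall i, dist (a i) (b i) < d') -> dist (teval a (ts i)) (teval b (ts i)) < d).
  + by move=> i x y yx h M a b ab; apply: h => k; apply: lt_le_trans (ab k) yx.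
  + exact: teval_unif.
  by exists d' => // M a b ab /=; apply: dP => i; apply: d'P.
- have [d d0 dP] := IH _ e0; exists d => // M a b /dP /=.
  by rewrite !ler_norml; lra.
- have [d d0 dP] := IH _ e0; exists d => // M a b /dP /=.
  by rewrite !ler_norml; lra.
- have e20 : 0 < e / 2 by lra.
  have [d d0 dP] := IHp _ e20; have [d' d'0 d'P] := IHq _ e20.
  exists (Num.min d d') => [|M a b ab /=]; first by rewrite lt_min d0.
  have {}dP : `|feval p a - feval p b| <= e / 2.
    by apply: dP => i; apply: lt_le_trans (ab i) _; rewrite ge_min lexx.
  have {}d'P : `|feval q a - feval q b| <= e / 2.
    by apply: d'P => i; apply: lt_le_trans (ab i) _; rewrite ge_min lexx orbT.
  move: dP d'P; rewrite !ler_norml => /andP[? ?] /andP[? ?].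
  by case: (leP (feval p a - feval q a) 0) => ?; case: (leP (feval p b - feval q b) 0) => ?;
    apply/andP; split; lra.
- have [d d0 dP] := IH _ e0; exists d => // M a b ab /=.
  have h : forall a b : tup M G, (forall i, dist (a i) (b i) < d) ->
      sup (range (fun x => feval p (tup_ext a x))) <=
      sup (range (fun x => feval p (tup_ext b x))) + e.
    move=> {ab} {}a {}b ab; apply: sup_range_le => [||x].
    - exact: carrier_inhabited.
    - by move=> x; exact: feval_itv.
    have := dP M (tup_ext a x) (tup_ext b x).
    have := le_sup_range (carrier_inhabited M s) (fun x => feval_itv p (tup_ext b x)) x.
    move=> /= h1 h2; have : `|feval p (tup_ext a x) - feval p (tup_ext b x)| <= e.
      apply: h2 => i; rewrite /tup_ext /=; case: (unliftP ord0 i) => [k|] _ //.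
      by rewrite distxx.
    by rewrite ler_norml; lra.
  have := h _ _ ab; have := h b a (fun i => eq_ind_r (fun z => z < d) (ab i) (dist_sym _ _)).
  by rewrite ler_norml; lra.
- have [d d0 dP] := IH _ e0; exists d => // M a b ab /=.
  have h : forall a b : tup M G, (forall i, dist (a i) (b i) < d) ->
      inf (range (fun x => feval p (tup_ext b x))) - e <=
      inf (range (fun x => feval p (tup_ext a x))).
    move=> {ab} {}a {}b ab; apply: le_inf_range => [||x].
    - exact: carrier_inhabited.
    - by move=> x; exact: feval_itv.
    have := dP M (tup_ext a x) (tup_ext b x).
    have := inf_range_le (carrier_inhabited M s) (fun x => feval_itv p (tup_ext b x)) x.
    move=> /= h1 h2; have : `|feval p (tup_ext a x) - feval p (tup_ext b x)| <= e.
      apply: h2 => i; rewrite /tup_ext /=; case: (unliftP ord0 i) => [k|] _ //.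
      by rewrite distxx.
    by rewrite ler_norml; lra.
  have := h _ _ ab; have := h b a (fun i => eq_ind_r (fun z => z < d) (ab i) (dist_sym _ _)).
  by rewrite ler_norml; lra.
Qed.

End UniformContinuity.

(** * Limits along an ultrafilter *)

Section UltraLimits.
Variables (R : realType) (J : Type) (U : set_system J).
Hypothesis UU : UltraFilter U.
Implicit Types f g : J -> R.

Definition bounded01 f := forall j, 0 <= f j <= 1.

Definition ulim f : R := lim (f @ U).

Lemma fmap_ultra f : UltraFilter (f @ U).
Proof.
split; first exact: fmap_proper_filter.
move=> G PG fG; apply/seteqP; split=> A GA; last exact: fG.
have [//|UnA] := in_ultra_setVsetC (f @^-1` A) UU.
have GnA : G (~` A) by apply: fG.
have : G set0 by rewrite -(setICr A); apply: filterI.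
by move=> /filter_ex[].
Qed.

Lemma ulim_cvg f : bounded01 f -> f @ U --> ulim f.
Proof.
move=> f01; have cI := @segment_compact R 0 1.
rewrite compact_ultra in cI.
have [|p [_ fp]] := cI _ (fmap_ultra f).
  rewrite /nbhs /=; apply: filterS filterT => j _ /=.
  by rewrite in_itv /=.
by apply: cvgP fp.
Qed.

Lemma ulimE f r : f @ U --> r -> ulim f = r.
Proof. by move=> fr; apply: cvg_lim => //; exact: norm_hausdorff. Qed.

Lemma ulim_near f (e : R) : bounded01 f -> 0 < e -> U [set j | `|f j - ulim f| < e].
Proof.
move=> /ulim_cvg/cvgrPdist_lt/[apply].
by apply: filterS => j /=; rewrite distrC.
Qed.

Lemma ulim_itv f : bounded01 f -> 0 <= ulim f <= 1.
Proof.
move=> f01; have fl := ulim_cvg f01; apply/andP; split.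
  by apply: (limr_ge (F := U) (f := f)); [apply: cvgP fl|apply: nearW => j; case/andP: (f01 j)].
by apply: (limr_le (F := U) (f := f)); [apply: cvgP fl|apply: nearW => j; case/andP: (f01 j)].
Qed.

Lemma ultra_cvg_le f g (l m : R) : f @ U --> l -> g @ U --> m ->
  U [set j | f j <= g j] -> l <= m.
Proof.
move=> fl gm fg; have h : (fun j => g j - f j) @ U --> m - l by apply: cvgB.
rewrite -subr_ge0 -(cvg_lim _ h); last exact: norm_hausdorff.
apply: limr_ge; first exact: cvgP h.
by apply: filterS fg => j; rewrite /= subr_ge0.
Qed.

Lemma ulim_le f g : bounded01 f -> bounded01 g -> U [set j | f j <= g j] ->
  ulim f <= ulim g.
Proof. by move=> f01 g01; apply: ultra_cvg_le; apply: ulim_cvg. Qed.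

Lemma ulim_le_add f g (e : R) : bounded01 f -> bounded01 g ->
  (forall j, f j <= g j + e) -> ulim f <= ulim g + e.
Proof.
move=> f01 g01 fg; apply: (@ultra_cvg_le f (fun j => g j + e)).
- exact: ulim_cvg.
- by apply: cvgD; [exact: ulim_cvg|exact: cvg_cst].
- exact: nearW.
Qed.

Lemma ulim_cst (r : R) : ulim (fun _ => r) = r.
Proof. by apply: ulimE; exact: cvg_cst. Qed.

Lemma ulim_le_cst f r : bounded01 f -> U [set j | f j <= r] -> ulim f <= r.
Proof.
move=> f01 fr; apply: (limr_le (F := U) (f := f)) => //.
by apply: cvgP (ulim_cvg f01).
Qed.

Lemma ulim_dist f g (e : R) : bounded01 f -> bounded01 g ->
  U [set j | `|f j - g j| <= e] -> `|ulim f - ulim g| <= e.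
Proof.
move=> f01 g01 fg.
have h : (fun j => `|f j - g j|) @ U --> `|ulim f - ulim g|.
  by apply: cvg_norm; apply: cvgB; apply: ulim_cvg.
rewrite -(cvg_lim _ h); last exact: norm_hausdorff.
by apply: limr_le; [apply: cvgP h|].
Qed.

Lemma ulim_dist_cst f (r e : R) : bounded01 f ->
  U [set j | `|f j - r| <= e] -> `|ulim f - r| <= e.
Proof.
move=> f01 fr.
have h : (fun j => `|f j - r|) @ U --> `|ulim f - r|.
  by apply: cvg_norm; apply: cvgB; [exact: ulim_cvg|exact: cvg_cst].
rewrite -(cvg_lim _ h); last exact: norm_hausdorff.
by apply: limr_le; [apply: cvgP h|].
Qed.

Lemma ulim_dist_ge f g (e : R) : bounded01 f -> bounded01 g ->
  U [set j | e <= `|f j - g j|] -> e <= `|ulim f - ulim g|.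
Proof.
move=> f01 g01 fg.
have h : (fun j => `|f j - g j|) @ U --> `|ulim f - ulim g|.
  by apply: cvg_norm; apply: cvgB; apply: ulim_cvg.
rewrite -(cvg_lim _ h); last exact: norm_hausdorff.
by apply: limr_ge; [apply: cvgP h|].
Qed.

Lemma eq_ulim f g : bounded01 f -> bounded01 g ->
  (forall e : R, 0 < e -> U [set j | `|f j - g j| <= e]) -> ulim f = ulim g.
Proof.
move=> f01 g01 fg; apply/eqP; rewrite -subr_eq0 -normr_le0.
by apply/ler_addgt0Pl => e e0; rewrite addr0; apply: ulim_dist => //; apply: fg.
Qed.

End UltraLimits.

(** * Ultraproducts *)

Lemma fast_cauchy (R : realType) (L : signature R) (M : structure L) s
    (w : nat -> M s) : (forall n, dist (w n) (w n.+1) <= 2 ^- n) ->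
  exists l, forall n, dist (w n) l <= 2 * 2 ^- n.
Proof.
have [p pE] : exists p : nat -> R, forall n, 2 ^- n = p n by exists (fun n => 2 ^- n).
have p0 n : 0 < p n by rewrite -pE pow2_gt0.
have pS n : p n = p n.+1 + p n.+1 by rewrite -!pE -pow2S.
move=> wP'; have wP n : dist (w n) (w n.+1) <= p n by rewrite -pE.
have tel n m : dist (w n) (w (n + m)%N) <= 2 * p n - 2 * p (n + m)%N.
  elim: m => [|m IH]; first by rewrite addn0 distxx subrr.
  apply: le_trans (dist_triangle _ (w (n + m)%N) _) _.
  rewrite addnS; have := wP (n + m)%N; have := pS (n + m)%N; lra.
have lt n m N : (N <= m)%N -> (N <= n)%N -> dist (w n) (w m) <= 4 * p N.
  move=> Nm Nn; have h k : (N <= k)%N -> dist (w N) (w k) <= 2 * p N.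
    move=> Nk; have := tel N (k - N)%N; rewrite subnKC//.
    by have := p0 k; lra.
  apply: le_trans (dist_triangle _ (w N) _) _.
  by have := h _ Nm; have := h _ Nn; rewrite (dist_sym (w n)); lra.
have small (e : R) : 0 < e -> exists n : nat, 4 * p n < e.
  move=> e0; have e4 : 0 < e / 4 by lra.
  by have [n] := pow2_small e4; rewrite pE => h; exists n; lra.
have [e e0|l lP] := @dist_complete _ _ M s w.
  have [N Ne] := small e e0; exists N => m n Nm Nn.
  exact: le_lt_trans (lt _ _ _ Nn Nm) Ne.
exists l => n; rewrite pE; apply/ler_addgt0Pl => e e0; have [N NP] := lP e e0.
apply: le_trans (dist_triangle _ (w (n + N)%N) _) _.
have := NP (n + N)%N (leq_addl _ _); have := tel n N; have := p0 (n + N)%N; lra.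
Qed.

Section Ultraproduct.
Variables (R : realType) (L : signature R) (J : univ) (U : set_system J).
Hypothesis UU : UltraFilter U.
Variable M : J -> structure L.
Implicit Types s : lsort L.

Local Notation ulim := (@ulim R J U).

Lemma bounded01_dist s (x y : forall j, M j s) :
  bounded01 (fun j => dist (x j) (y j)).
Proof. by move=> j; rewrite dist_ge0 dist_le1. Qed.
Local Hint Resolve bounded01_dist : core.

Lemma bounded01_pint P (x : forall j, tup (M j) (pdom P)) :
  bounded01 (fun j => pint (x j)).
Proof. by move=> j; exact: pint_itv. Qed.
Local Hint Resolve bounded01_pint : core.

Definition ueq s (x y : forall j, M j s) := ulim (fun j => dist (x j) (y j)) = 0.

Lemma ueq_refl s (x : forall j, M j s) : ueq x x.
Proof.
rewrite /ueq (_ : (fun j => _) = fun _ => 0) ?ulim_cst//.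
by apply/funext => j; rewrite distxx.
Qed.

Lemma udist_sym s (x y : forall j, M j s) :
  ulim (fun j => dist (x j) (y j)) = ulim (fun j => dist (y j) (x j)).
Proof. by congr ulim; apply/funext => j; exact: dist_sym. Qed.

Lemma udist_triangle s (x y z : forall j, M j s) :
  ulim (fun j => dist (x j) (z j)) <=
  ulim (fun j => dist (x j) (y j)) + ulim (fun j => dist (y j) (z j)).
Proof.
have hxy := ulim_cvg UU (bounded01_dist x y).
have hyz := ulim_cvg UU (bounded01_dist y z).
apply: (ultra_cvg_le UU (ulim_cvg UU (bounded01_dist x z)) (cvgD hxy hyz)).
by apply: nearW => j; exact: dist_triangle.
Qed.

Lemma udist_ge0 s (x y : forall j, M j s) : 0 <= ulim (fun j => dist (x j) (y j)).
Proof. by case/andP: (ulim_itv UU (bounded01_dist x y)). Qed.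

Lemma ueq_sym s (x y : forall j, M j s) : ueq x y -> ueq y x.
Proof. by rewrite /ueq udist_sym. Qed.

Lemma ueq_trans s (y x z : forall j, M j s) : ueq x y -> ueq y z -> ueq x z.
Proof.
rewrite /ueq => xy yz; apply/eqP; rewrite eq_le udist_ge0 andbT.
by have := udist_triangle x y z; rewrite xy yz addr0.
Qed.

Lemma ueq_near s (x y : forall j, M j s) (e : R) : ueq x y -> 0 < e ->
  U [set j | dist (x j) (y j) < e].
Proof.
move=> xy e0; have := ulim_near UU (bounded01_dist x y) e0.
rewrite xy; apply: filterS => j /=; rewrite subr0 ger0_norm//.
exact: dist_ge0.
Qed.

Lemma ueqP s (x y : forall j, M j s) :
  (forall e : R, 0 < e -> U [set j | dist (x j) (y j) <= e]) -> ueq x y.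
Proof.
move=> h; apply/eqP; rewrite eq_le udist_ge0 andbT.
by apply/ler_addgt0Pl => e e0; rewrite addr0; apply: ulim_le_cst => //; apply: h.
Qed.

(** A canonical representative of each class, so that the ultraproduct is a
    subtype of the product. *)
Definition urep s (x : forall j, M j s) : forall j, M j s :=
  projT1 (cid (ex_intro (fun y => ueq x y) x (ueq_refl x))).

Lemma ueq_urep s (x : forall j, M j s) : ueq x (urep x).
Proof. by rewrite /urep; case: cid. Qed.

Lemma urep_eq s (x y : forall j, M j s) : ueq x y -> urep x = urep y.
Proof.
move=> xy; have e : ueq x = ueq y.
  apply/funext => z; apply/propext; split; apply: ueq_trans => //.
  exact: ueq_sym.
rewrite /urep; move: (ex_intro _ x _) (ex_intro _ y _); rewrite e => p q.
by rewrite (Prop_irrelevance p q).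
Qed.

Definition ucarrier s : univ := {x : forall j, M j s | urep x = x}.

Definition ucls s (x : forall j, M j s) : ucarrier s :=
  exist _ (urep x) (urep_eq (ueq_sym (ueq_urep x))).

Lemma ucls_eq s (x y : forall j, M j s) : ueq x y -> ucls x = ucls y.
Proof. by move=> xy; apply: eq_exist; exact: urep_eq. Qed.

Lemma ucls_val s (x : ucarrier s) : ucls (sval x) = x.
Proof. by case: x => x xP; apply: eq_exist. Qed.

Lemma ueq_val s (x : forall j, M j s) : ueq (sval (ucls x)) x.
Proof. exact: ueq_sym (ueq_urep x). Qed.

Definition ufint f (a : tup ucarrier (fdom f)) : ucarrier (fcod f) :=
  ucls (fun j => fint (fun i => sval (a i) j)).

Definition upint P (a : tup ucarrier (pdom P)) : R :=
  ulim (fun j => pint (fun i => sval (a i) j)).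

Lemma upint_dist s (x y : ucarrier s) :
  upint (P := Dist s) (tup2 x y) = ulim (fun j => dist (sval x j) (sval y j)).
Proof.
congr ulim; apply/funext => j; congr pint.
apply: (@functional_extensionality_dep _ (fun i => M j (pdom (Dist s) i))) => i.
by rewrite /tup2; case: ifP.
Qed.

Let udist s (x y : ucarrier s) := upint (P := Dist s) (tup2 x y).

Let upint_itv P (a : tup ucarrier (pdom P)) : 0 <= upint a <= 1.
Proof. exact: ulim_itv. Qed.

Let ucarrier_inhabited s : inhabited (ucarrier s).
Proof.
have h j : exists x : M j s, True by have [x] := carrier_inhabited (M j) s; exists x.
by split; exact: (ucls (fun j => projT1 (cid (h j)))).
Qed.

Let udist_eq0 s (x y : ucarrier s) : udist x y = 0 <-> x = y.
Proof.
rewrite /udist upint_dist; split=> [xy|->]; last exact: ueq_refl.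
by rewrite -[x]ucls_val -[y]ucls_val; exact: ucls_eq.
Qed.

Let udist_sym' s (x y : ucarrier s) : udist x y = udist y x.
Proof. by rewrite /udist !upint_dist udist_sym. Qed.

Let udist_triangle' s (x y z : ucarrier s) : udist x z <= udist x y + udist y z.
Proof. by rewrite /udist !upint_dist udist_triangle. Qed.

Lemma udist_ucls s (x y : forall j, M j s) :
  ulim (fun j => dist (sval (ucls x) j) (sval (ucls y) j)) =
  ulim (fun j => dist (x j) (y j)).
Proof.
apply/eqP; rewrite eq_le; apply/andP; split.
  apply: le_trans (udist_triangle _ x _) _; rewrite ueq_val add0r.
  apply: le_trans (udist_triangle _ y _) _.
  by rewrite [X in _ + X](ueq_sym (ueq_val y)) addr0.
apply: le_trans (udist_triangle _ (sval (ucls x)) _) _.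
rewrite (ueq_sym (ueq_val x)) add0r.
apply: le_trans (udist_triangle _ (sval (ucls y)) _) _.
by rewrite [X in _ + X](ueq_val y) addr0.
Qed.

Let ufint_unif (f : fsym L) (i : 'I_(arity (fdom f))) e a b : 0 < e ->
  (forall j, j != i -> a j = b j) ->
  udist (a i) (b i) < fmod i e -> udist (ufint a) (ufint b) <= e.
Proof.
move=> e0 ab; rewrite /udist !upint_dist udist_ucls => lt.
apply: ulim_le_cst => //.
have lt' : 0 < fmod i e - ulim (fun j => dist (sval (a i) j) (sval (b i) j)).
  by rewrite subr_gt0.
have := ulim_near UU (bounded01_dist (sval (a i)) (sval (b i))) lt'.
apply: filterS => j /=; rewrite ltr_norml => /andP[_ h].
by apply: (fint_unif (i := i)) => // [k /ab->//|]; lra.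
Qed.

Let upint_unif (P : psym L) (i : 'I_(arity (pdom P))) e a b : 0 < e ->
  (forall j, j != i -> a j = b j) ->
  udist (a i) (b i) < pmod i e -> `|upint a - upint b| <= e.
Proof.
move=> e0 ab; rewrite /udist !upint_dist => lt.
apply: ulim_dist => //.
have lt' : 0 < pmod i e - ulim (fun j => dist (sval (a i) j) (sval (b i) j)).
  by rewrite subr_gt0.
have := ulim_near UU (bounded01_dist (sval (a i)) (sval (b i))) lt'.
apply: filterS => j /=; rewrite ltr_norml => /andP[_ h].
by apply: (pint_unif (i := i)) => // [k /ab->//|]; lra.
Qed.

(** On each factor the subsequence of representatives is frozen as soon as it
    ceases to be fast Cauchy there; almost every factor sees each term. *)
Let udist_complete s (u : nat -> ucarrier s) :
  (forall e, 0 < e -> exists N, forall m n, (N <= m)%N -> (N <= n)%N ->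
     udist (u m) (u n) < e) ->
  exists l, forall e, 0 < e -> exists N, forall n, (N <= n)%N ->
     udist (u n) l < e.
Proof.
move=> uC; have p0 n := @pow2_gt0 R n.
(* The terms of index k n form a subsequence of steps less than 2 ^- n. *)
have [N NP] := choice (fun n => uC _ (p0 n)).
pose k n := (\sum_(i < n.+1) N i)%N.
have kN n : (N n <= k n)%N by rewrite /k big_ord_recr leq_addl.
have kS n : (k n <= k n.+1)%N by rewrite /k [X in (_ <= X)%N]big_ord_recr leq_addr.
pose v n (j : J) : M j s := sval (u (k n)) j.
pose B n (j : J) := dist (v n j) (v n.+1 j) < 2 ^- n.
have UB n : U [set j | B n j].
  have := NP n (k n) (k n.+1) (kN n) (leq_trans (kN n) (kS n)).
  rewrite /udist upint_dist -subr_gt0 => lt.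
  have := ulim_near UU (bounded01_dist (v n) (v n.+1)) lt.
  by apply: filterS => j /=; rewrite ltr_norml /B => /andP[_ h]; lra.
pose A n (j : J) := [forall i : 'I_n, B i j].
have UA n : U [set j | A n j].
  elim: n => [|n IH]; first by apply: filterS filterT => j _; apply/forallP => -[].
  apply: filterS (filterI IH (UB n)) => j [/= /forallP An Bn].
  apply/forallP => i; have := ltn_ord i; rewrite ltnS leq_eqVlt => /orP[/eqP->//|lt].
  exact: (An (Ordinal lt)).
pose w := fix w n (j : J) : M j s := if n is m.+1 then if A m.+1 j then v m.+1 j else w m j
                       else v 0%N j.
have wv n j : A n j -> w n j = v n j by case: n => //= n ->.
have wC j n : dist (w n j) (w n.+1 j) <= 2 ^- n.
  rewrite /=; case: ifP => [/forallP An|_]; last by rewrite distxx ltW.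
  rewrite wv; first exact: ltW (An ord_max).
  by apply/forallP => i; exact: (An (widen_ord (leqnSn n) i)).
have [l lP] := dependent_choice_fun (fun j => fast_cauchy (wC j)).
have vl n : udist (u (k n)) (ucls l) <= 2 * 2 ^- n.
  rewrite -[u (k n)]ucls_val /udist upint_dist udist_ucls.
  apply: ulim_le_cst => //; apply: filterS (UA n) => j /= /wv e.
  by have := lP j n; rewrite e.
exists (ucls l) => e e0.
have [n ne] : exists n, 3 * 2 ^- n < e.
  have e3 : 0 < e / 3 by lra.
  by have [n h] := pow2_small e3; exists n; lra.
exists (k n) => m km.
apply: le_lt_trans (udist_triangle' _ (u (k n)) _) _.
have := vl n; have := NP n m (k n) (leq_trans (kN n) km) (kN n); lra.
Qed.

Definition ultraproduct : structure L :=
  @Structure R L ucarrier ufint upint ucarrier_inhabited upint_itv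
    udist_eq0 udist_sym' udist_triangle' udist_complete ufint_unif upint_unif.

Lemma teval_ultra G (u : forall i : 'I_(arity G), forall j, M j (G i)) s (t : term G s) :
  teval (M := ultraproduct) (fun i => ucls (u i)) t =
  ucls (fun j => teval (fun i => u i j) t).
Proof.
elim: t => [//|f ts IH] /=.
have -> : (fun i => teval (M := ultraproduct) (fun i => ucls (u i)) (ts i)) =
    (fun i => ucls (fun j => teval (fun i => u i j) (ts i))).
  exact: (@functional_extensionality_dep _ (fun i => ucarrier (fdom f i))).
apply: ucls_eq; apply: ueqP => e e0; have [d d0 dP] := fint_joint f e0.
pose x i := fun j => teval (fun i => u i j) (ts i).
have : U [set j | forall i, dist (sval (ucls (x i)) j) (x i j) < d].
  by apply: filter_forall => i; apply: ueq_near => //; exact: ueq_val.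
by apply: filterS => j /= h; apply: dP.
Qed.

Lemma bounded01_feval G (phi : formula G) (a : forall j, tup (M j) G) :
  bounded01 (fun j => feval phi (a j)).
Proof. by move=> j; exact: feval_itv. Qed.
Local Hint Resolve bounded01_feval : core.

(** Los's theorem. It is stated for arbitrary representatives of the classes, so
    that in the quantifier step a witness may be chosen in each factor. *)
Lemma Los G (phi : formula G) (u : forall i : 'I_(arity G), forall j, M j (G i)) :
  feval (M := ultraproduct) phi (fun i => ucls (u i)) =
  ulim (fun j => feval phi (fun i => u i j)).
Proof.
have ext G' s (v : forall i : 'I_(arity G'), forall j, M j (G' i)) (x : forall j, M j s) :
    tup_ext (fun i => ucls (v i)) (ucls x) =
    (fun i => ucls (fun j => tup_ext (fun k => v k j) (x j) i)) :> tup ucarrier _.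
  apply: (@functional_extensionality_dep _ (fun i => ucarrier (ctx_ext G' s i))) => i.
  by rewrite /tup_ext /=; case: (unlift ord0 i).
elim: phi u => {G} [G P ts|G p IH|G p IH|G p IHp q IHq|G s p IH|G s p IH] u /=.
- have -> : (fun i => teval (M := ultraproduct) (fun i => ucls (u i)) (ts i)) =
      (fun i => ucls (fun j => teval (fun i => u i j) (ts i))).
    apply: (@functional_extensionality_dep _ (fun i => ucarrier (pdom P i))) => i.
    exact: teval_ultra.
  apply: eq_ulim => // e e0; have [d d0 dP] := pint_joint P e0.
  pose x i := fun j => teval (fun i => u i j) (ts i).
  have : U [set j | forall i, dist (sval (ucls (x i)) j) (x i j) < d].
    by apply: filter_forall => i; apply: ueq_near => //; exact: ueq_val.
  by apply: filterS => j /= h; apply: dP.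
- rewrite IH; apply/esym/ulimE; apply: cvgB; first exact: cvg_cst.
  exact: ulim_cvg.
- by rewrite IH; apply/esym/ulimE; apply: cvgMl; exact: ulim_cvg.
- rewrite IHp IHq; apply/esym/ulimE.
  have -> : (fun j => Num.max (feval p (fun i => u i j) - feval q (fun i => u i j)) 0) =
      (fun j => (feval p (fun i => u i j) - feval q (fun i => u i j) +
        `|feval p (fun i => u i j) - feval q (fun i => u i j)|) / 2).
    by apply/funext => j; rewrite maxr_absE addr0 subr0.
  rewrite maxr_absE addr0 subr0; apply: cvgMl; apply: cvgD; last apply: cvg_norm.
    by apply: cvgB; apply: ulim_cvg.
  by apply: cvgB; apply: ulim_cvg.
- have b01 : bounded01 (fun j => sup (range (fun x : M j s =>
      feval p (tup_ext (fun i => u i j) x)))).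
    by move=> j; exact: (feval_itv (Sup p)).
  apply/eqP; rewrite eq_le; apply/andP; split.
    apply: sup_range_le => [||x].
    - exact: ucarrier_inhabited.
    - by move=> x; exact: feval_itv.
    rewrite -[x]ucls_val ext IH; apply: ulim_le => //; apply: nearW => j /=.
    apply: (le_sup_range (f := fun x : M j s => _) (carrier_inhabited (M j) s)) => y.
    exact: feval_itv.
  apply/ler_addgt0Pr => e e0.
  have h j := sup_range_adherent (carrier_inhabited (M j) s)
    (fun x => feval_itv p (tup_ext (fun i => u i j) x)) e0.
  pose x j := projT1 (cid (h j)).
  have xP j : sup (range (fun x : M j s => feval p (tup_ext (fun i => u i j) x))) - e <
    feval p (tup_ext (fun i => u i j) (x j)) by exact: (projT2 (cid (h j))).
  have := le_sup_range (ucarrier_inhabited s) (fun x => feval_itv (M := ultraproduct)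
    p (tup_ext (fun i => ucls (u i)) x)) (ucls x).
  rewrite ext IH -lerBlDr; apply: le_trans; rewrite lerBlDr.
  by apply: ulim_le_add => // j; have := xP j; lra.
- have b01 : bounded01 (fun j => inf (range (fun x : M j s =>
      feval p (tup_ext (fun i => u i j) x)))).
    by move=> j; exact: (feval_itv (Inf p)).
  apply/eqP; rewrite eq_le; apply/andP; split; last first.
    apply: le_inf_range => [||x].
    - exact: ucarrier_inhabited.
    - by move=> x; exact: feval_itv.
    rewrite -[x]ucls_val ext IH; apply: ulim_le => //; apply: nearW => j /=.
    apply: (inf_range_le (f := fun x : M j s => _) (carrier_inhabited (M j) s)) => y.
    exact: feval_itv.
  apply/ler_addgt0Pr => e e0.
  have h j := inf_range_adherent (carrier_inhabited (M j) s)
    (fun x => feval_itv p (tup_ext (fun i => u i j) x)) e0.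
  pose x j := projT1 (cid (h j)).
  have xP j : feval p (tup_ext (fun i => u i j) (x j)) <
      inf (range (fun x : M j s => feval p (tup_ext (fun i => u i j) x))) + e
    by exact: (projT2 (cid (h j))).
  have := inf_range_le (ucarrier_inhabited s) (fun x => feval_itv (M := ultraproduct)
    p (tup_ext (fun i => ucls (u i)) x)) (ucls x).
  rewrite ext IH => /le_trans; apply.
  by apply: ulim_le_add => // j; have := xP j; lra.
Qed.

Lemma ultraproduct_models (T : theory L) :
  (forall j, models (M j) T) -> models ultraproduct T.
Proof.
move=> MT phi Tphi.
have -> : tup0 ultraproduct =
    (fun i => ucls (fun j => tup0 (M j) i)) by apply: tup_eq => -[].
rewrite Los (_ : (fun j => _) = fun _ => 0) ?ulim_cst//.
apply/funext => j; rewrite -(MT j phi Tphi); congr feval.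
Qed.

End Ultraproduct.

Section Ultrapower.
Variables (R : realType) (L : signature R) (J : univ) (U : set_system J).
Hypothesis UU : UltraFilter U.
Variable M : structure L.

Definition ultrapower : structure L := ultraproduct UU (fun _ => M).

Definition diag s (x : M s) : ultrapower s := ucls UU (fun _ => x).

Lemma diag_elementary : elementary diag.
Proof. by move=> G phi a; rewrite Los ulim_cst. Qed.

Definition utup G (a : J -> tup M G) : tup ultrapower G :=
  fun i => ucls UU (fun j => a j i).

Lemma utup_cat G H (a : J -> tup M G) (b : J -> tup M H) :
  tup_cat (utup a) (utup b) = utup (fun j => tup_cat (a j) (b j)).
Proof.
apply: tup_eq => i; rewrite /pt /tup_cat /utup /=.
by case: (fintype.split i).
Qed.

Lemma feval_utup G (phi : formula G) (a : J -> tup M G) :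
  feval phi (utup a) = ulim U (fun j => feval phi (a j)).
Proof. exact: Los. Qed.

Lemma utup_surj G (a : tup ultrapower G) : exists b, a = utup b.
Proof.
exists (fun j i => sval (a i) j).
apply: (@functional_extensionality_dep _ (fun i => ultrapower (G i))) => i.
by rewrite /utup ucls_val.
Qed.

End Ultrapower.

(** * Stability and the double limit condition *)

(** Dependent choice where each term is chosen in view of all the previous ones. *)
Lemma chain_choice (T : Type) (P : T -> Prop) (Q : T -> T -> Prop) :
  (forall s : seq T, (forall x, List.In x s -> P x) ->
     exists y, P y /\ forall x, List.In x s -> Q x y) ->
  exists f : nat -> T, (forall n, P (f n)) /\
    forall m n, (m < n)%N -> Q (f m) (f n).
Proof.
move=> h.
have h' s : exists y, (forall x, List.In x s -> P x) ->
    P y /\ forall x, List.In x s -> Q x y.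
  case: (pselect (forall x, List.In x s -> P x)) => [/h[y yP]|ns]; first by exists y.
  by have [y _] := h [::] (fun _ => False_ind _); exists y => /ns.
have [step stepP] := choice h'.
pose g := fix g n := if n is m.+1 then step (g m) :: g m else [::].
have gP n x : List.In x (g n) -> P x.
  elim: n x => [//|n IH] x /= [<-|/IH//].
  by have [] := stepP _ IH.
have gin m n : (m < n)%N -> List.In (step (g m)) (g n).
  elim: n => // n IH; rewrite ltnS leq_eqVlt => /orP[/eqP->|/IH]; first by left.
  by right.
exists (fun n => step (g n)); split=> [n|m n mn].
  by have [] := stepP _ (@gP n).
by have [_] := stepP _ (@gP n); apply; apply: gin.
Qed.

Lemma nat_ultrafilter : exists V : set_system nat, UltraFilter V /\ \oo `<=` V.
Proof. exact: ultraFilterLemma. Qed.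

Section DoubleLimits.
Variables (R : realType) (V : set_system nat).
Hypotheses (VU : UltraFilter V) (Voo : \oo `<=` V).
Implicit Types F : nat -> nat -> R.

Let lim_rows F : R := ulim V (fun i => ulim V (fun j => F i j)).

Let lim_cols F : R := lim_rows (fun i j => F j i).

Definition in01 F := forall i j, 0 <= F i j <= 1.

Lemma eventually_V n : V [set i | (n < i)%N].
Proof. by apply: Voo; exists n.+1. Qed.

Lemma in01_row F i : in01 F -> bounded01 (fun j => F i j).
Proof. by move=> h j; exact: h. Qed.

Lemma bounded01_ulim F : in01 F -> bounded01 (fun i => ulim V (fun j => F i j)).
Proof. by move=> h j; apply: ulim_itv => // i; exact: h. Qed.

Lemma in01_swap F : in01 F -> in01 (fun i j => F j i).
Proof. by move=> h i j; exact: h. Qed.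

Lemma lim_rows_dist_ge F G (e : R) : in01 F -> in01 G ->
  (forall i j, (i < j)%N -> e <= `|F i j - G i j|) ->
  e <= `|lim_rows F - lim_rows G|.
Proof.
move=> F01 G01 h; apply: ulim_dist_ge => //; try exact: bounded01_ulim.
apply: filterS filterT => i _ /=; apply: ulim_dist_ge => //; try exact: in01_row.
by apply: filterS (eventually_V i) => j /= /h.
Qed.

Lemma lim_rows_dist F G (e : R) : in01 F -> in01 G ->
  (forall i j, (i < j)%N -> `|F i j - G i j| <= e) ->
  `|lim_rows F - lim_rows G| <= e.
Proof.
move=> F01 G01 h; apply: ulim_dist => //; try exact: bounded01_ulim.
apply: filterS filterT => i _ /=; apply: ulim_dist => //; try exact: in01_row.
by apply: filterS (eventually_V i) => j /= /h.
Qed.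

Lemma filter_In (s : seq nat) (A : nat -> set nat) :
  (forall i, V (A i)) -> V [set m | forall i, List.In i s -> A i m].
Proof.
move=> VA; elim: s => [|i s IH]; first by apply: filterS filterT => m _ i [].
by apply: filterS (filterI (VA i) IH) => m [Ai As] k /= [<-|/As].
Qed.

(** The iterated limits are attained, up to d, on both sides of the diagonal of
    a subsequence. *)
Lemma subladder F (d : R) : in01 F -> 0 < d ->
  exists n : nat -> nat, forall l k, (l < k)%N ->
    `|F (n l) (n k) - lim_rows F| < d /\ `|F (n k) (n l) - lim_cols F| < d.
Proof.
move=> F01 d0; have d20 : 0 < d / 2 by lra.
have F01' := in01_swap F01.
pose al i := ulim V (fun j => F i j); pose be i := ulim V (fun j => F j i).
pose P i := `|al i - lim_rows F| < d / 2 /\ `|be i - lim_cols F| < d / 2.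
pose Q i j := `|F i j - al i| < d / 2 /\ `|F j i - be i| < d / 2.
have VP : V P.
  apply: filterS (filterI (ulim_near VU (bounded01_ulim F01) d20)
    (ulim_near VU (bounded01_ulim F01') d20)) => i [/= ? ?].
  by split.
have VQ i : V (Q i).
  apply: filterS (filterI (ulim_near VU (in01_row i F01) d20)
    (ulim_near VU (in01_row i F01') d20)) => j [/= ? ?].
  by split.
have [s _|n [nP nQ]] := @chain_choice nat P Q.
  have : V (P `&` [set m | forall i, List.In i s -> Q i m]).
    by apply: filterI => //; exact: filter_In.
  by move=> /filter_ex[m [? ?]]; exists m.
exists n => l k lk; have [p1 p2] := nP l; have [q1 q2] := nQ _ _ lk.
by move: p1 p2 q1 q2; rewrite !ltr_norml => /andP[? ?] /andP[? ?] /andP[? ?] /andP[? ?];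
  split; apply/andP; split; lra.
Qed.

Section Stability.
Variables (L : signature R) (T : theory L).
Variables (xs ys : ctx (lsort L)) (phi : formula (ctx_cat xs ys)).

Definition array (M : structure L) (a : nat -> tup M xs) (b : nat -> tup M ys) i j :=
  feval phi (tup_cat (a i) (b j)).

Lemma array01 (M : structure L) (a : nat -> tup M xs) (b : nat -> tup M ys) :
  in01 (array a b).
Proof. by move=> i j; exact: feval_itv. Qed.

(** Grothendieck's double limit condition, along a fixed ultrafilter. It is the
    form of stability with which the implications are proved. *)
Definition double_limit := forall (M : structure L) (a : nat -> tup M xs)
  (b : nat -> tup M ys), models M T ->
  lim_rows (array a b) = lim_cols (array a b).

Lemma double_limit_stable : double_limit -> stable T phi.
Proof.
move=> DL e e0 [M [a [b [MT ab]]]].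
have := lim_rows_dist_ge (array01 a b) (in01_swap (array01 a b)) ab.
rewrite -/(lim_cols (array a b)) (DL M a b MT) subrr normr0; lra.
Qed.

(** By [subladder], where r and s are the two limits and e is so small that the values
    above and below the diagonal remain far from each other. *)
Lemma unstable_subladder : ~ double_limit ->
  exists (M : structure L) (a : nat -> tup M xs) (b : nat -> tup M ys) (r s e : R),
  [/\ models M T, 0 < e, e <= `|r - s| / 4 & forall l k, (l < k)%N ->
    `|array a b l k - r| < e /\ `|array a b k l - s| < e].
Proof.
move=> nDL; apply: contrapT => h; apply: nDL => M a b MT.
apply: contrapT => /eqP ne; apply: h.
pose r := lim_rows (array a b); pose s := lim_cols (array a b).
have rs : 0 < `|r - s| by rewrite normr_gt0 subr_eq0.
have e0 : 0 < `|r - s| / 4 by lra.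
have [n nP] := subladder (array01 a b) e0.
by exists M, (a \o n), (b \o n), r, s, (`|r - s| / 4).
Qed.

Lemma stable_double_limit : stable T phi -> double_limit.
Proof.
move=> st; apply: contrapT => /unstable_subladder.
move=> [M [a [b [r [s [e [MT e0 ers ab]]]]]]].
apply: (st e e0); exists M, a, b; split=> // i j /ab[].
rewrite -/(array a b i j) -/(array a b j i).
have := ler_distD (array a b i j) r s; have := ler_distD (array a b j i) (array a b i j) s.
by rewrite (distrC r (array a b i j)); lra.
Qed.

(** Long finite ladders in models of T converge, along an ultrafilter, to an
    infinite one. *)
Lemma double_limit_no_ladder (e : R) : double_limit -> 0 < e ->
  exists N, no_ladder T phi e N.
Proof.
move=> DL e0; apply: contrapT => h.
have h' N : exists Z : {M : structure L & ('I_N.+1 -> tup M xs) * ('I_N.+1 -> tup M ys)}%type,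
    models (projT1 Z) T /\ forall i j k : 'I_N.+1, (i < j)%N -> (j < k)%N ->
        e <= `|feval phi (tup_cat ((projT2 Z).1 j) ((projT2 Z).2 i))
               - feval phi (tup_cat ((projT2 Z).1 j) ((projT2 Z).2 k))|.
  apply: contrapT => nZ; apply: h; exists N => -[M [a [b [MT ab]]]].
  by apply: nZ; exists (existT _ M (a, b)).
have {h'}[Z ZP] := dependent_choice_fun h'.
pose M N := projT1 (Z N).
pose a N i : tup (M N) xs := (projT2 (Z N)).1 (inord i).
pose b N i : tup (M N) ys := (projT2 (Z N)).2 (inord i).
pose Om := ultraproduct VU M.
pose A i : tup Om xs := fun k => ucls VU (fun N => a N i k).
pose B i : tup Om ys := fun k => ucls VU (fun N => b N i k).
have AB i j : array A B i j = ulim V (fun N => feval phi (tup_cat (a N i) (b N j))).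
  rewrite /array (_ : tup_cat _ _ = fun k => ucls VU (fun N => tup_cat (a N i) (b N j) k)).
    exact: Los.
  apply: (@tup_eq _ Om) => k; rewrite /pt /tup_cat /A /B /=.
  by case: (fintype.split k).
have key i j k : (i < j)%N -> (j < k)%N -> e <= `|array A B j i - array A B j k|.
  move=> ij jk; rewrite !AB; apply: ulim_dist_ge => //; try by move=> N; exact: feval_itv.
  apply: filterS (eventually_V k) => N /= kN; have [_] := ZP N; apply.
    by rewrite !inordK ?ltnS// ltnW// ?(ltn_trans jk)// (ltn_trans ij) ?(ltn_trans jk).
  by rewrite !inordK ?ltnS// ltnW// (ltn_trans jk).
have OT : models Om T by apply: ultraproduct_models => N; case: (ZP N).
have : e <= `|lim_cols (array A B) - lim_rows (array A B)|.
  have a01 := array01 A B.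
  rewrite -[X in _ - X](ulim_cst VU).
  apply: ulim_dist_ge => //; first exact: (bounded01_ulim (in01_swap a01)).
    by move=> i; exact: (ulim_itv VU (bounded01_ulim a01)).
  apply: filterS filterT => i _ /=.
  apply: ulim_dist_ge => //; first exact: (bounded01_ulim a01).
  apply: filterS (eventually_V i) => j /= ij.
  rewrite -[X in X - _](ulim_cst VU).
  apply: ulim_dist_ge => //.
  by apply: filterS (eventually_V j) => k /= jk; exact: key.
by rewrite (DL Om A B OT) subrr normr0; lra.
Qed.

Lemma ladder_boundP (e : R) : double_limit -> 0 < e ->
  no_ladder T phi e (ladder_bound T phi e).
Proof.
move=> DL /(double_limit_no_ladder DL)[N0 N0P].
have ex : exists N, `[< no_ladder T phi e N >] by exists N0; apply/asboolP.
rewrite /ladder_bound; case: xgetP => [N _ []//|/(_ (ex_minn ex))[]].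
case: ex_minnP => N /asboolP NP min; split=> // N' N'P.
by apply: min; apply/asboolP.
Qed.

End Stability.

End DoubleLimits.

(** * Topology of the spaces of types *)

Section TypeTopology.
Variables (R : realType) (L : signature R) (M : structure L).
Variable ys : ctx (lsort L).
Implicit Types (q : ctype M ys) (s : seq (pformula M ys)).

(** These form a base of neighbourhoods of q ([nbhs_type_ball],
    [type_ball_nbhs]). *)
Definition type_ball q (sd : seq (pformula M ys) * R) : set (ctype M ys) :=
  [set q' | forall chi, List.In chi sd.1 -> `|tvalue chi q' - tvalue chi q| < sd.2].

(** Stated for any family of functions: it serves for the types over M and for the
    tuples of M. *)
Lemma filter_balls (K T : Type) (val : K -> T -> R) (t : K -> R) :
  Filter (filter_from [set sd : seq K * R | 0 < sd.2]
    (fun sd => [set x | forall k, List.In k sd.1 -> `|val k x - t k| < sd.2])).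
Proof.
apply: filter_from_filter => [|[s d] [s' d'] /= d0 d'0].
  by exists ([::], 1) => /=.
exists (s ++ s', Num.min d d'); first by rewrite /= lt_min d0.
move=> x /= h; split=> k /= ks.
  have := h k; rewrite lt_min => /(_ (List.in_or_app _ _ _ (or_introl ks))).
  by case/andP.
have := h k; rewrite lt_min => /(_ (List.in_or_app _ _ _ (or_intror ks))).
by case/andP.
Qed.

Lemma nbhs_type_ball q (A : set (ctype M ys)) :
  nbhs q A -> exists2 sd, 0 < sd.2 & type_ball q sd `<=` A.
Proof.
rewrite nbhsE => -[B [[W Wo WB] Bq] BA].
pose t : prod_topology (fun _ : pformula M ys => R) := tvalues q.
pose G : set_system (prod_topology (fun _ : pformula M ys => R)) :=
  filter_from [set sd : seq (pformula M ys) * R | 0 < sd.2]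
  (fun sd => [set x | forall k, List.In k sd.1 -> `|x k - t k| < sd.2]).
have GF : Filter G by exact: (filter_balls (fun k x => x k) t).
have Gt : G --> t.
  apply/cvg_sup => chi C; rewrite nbhsE => -[D [[E Eo ED] Dt] DC].
  have Et : E (t chi) by rewrite -ED in Dt.
  have /nbhs_ballP[d /= d0 dE] : nbhs (t chi) E by exact: open_nbhs_nbhs.
  exists ([:: chi], d) => //= x h; apply: DC; rewrite -ED /=; apply: dE.
  by rewrite /ball /= distrC; apply: h; left.
have Wt : W t by rewrite -WB in Bq.
have [sd sd0 sdW] : G W by apply: Gt; exact: open_nbhs_nbhs.
exists sd => // q' q'B; apply: BA; rewrite -WB /=; apply: sdW => chi /q'B //.
Qed.

Lemma tvalue_near chi q (e : R) : 0 < e ->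
  nbhs q [set q' | `|tvalue chi q' - tvalue chi q| < e].
Proof.
move=> e0; have c : {for q, continuous (@tvalues _ _ M ys : ctype M ys -> _)}.
  exact: initial_continuous.
have /cvg_sup/(_ chi) c' := c.
have pc := @initial_continuous _ _ (fun x : forall _ : pformula M ys, R => x chi) (tvalues q).
have /cvgrPdist_lt/(_ e e0) : (tvalue chi) @ q --> tvalue chi q.
  by refine (cvg_comp _ _ (c' _) pc); exact: (@fmap_filter _ _ _ _ (nbhs_filter q)).
by apply: filterS => q' /=; rewrite distrC.
Qed.

Lemma type_ball_nbhs q sd : 0 < sd.2 -> nbhs q (type_ball q sd).
Proof.
case: sd => s d /= d0; elim: s => [|chi s IH].
  by apply: filterS filterT => q' _ chi [].
apply: filterS (filterI (tvalue_near chi q d0) IH) => q' [h h'] k /= [<- //|ks].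
exact: (h' k ks).
Qed.

Lemma elementary_approx_seq (N : structure L) (j : forall r, M r -> N r)
    s (a : tup N ys) (e : R) : elementary j -> 0 < e ->
  exists c : tup M ys, forall chi, List.In chi s ->
    `|peval (fun r (x : M r) => x) chi c - peval j chi a| < e.
Proof.
move=> el e0; case: s => [|chi0 s].
  by have [c] := tup_inhabited M ys; exists c.
have [c cP] := elementary_approx (fun i => List.nth i (chi0 :: s) chi0) a
  (size (chi0 :: s)) el e0.
exists c => chi /(List.In_nth _ _ chi0)[n [/ssrnat.ltP nlt <-]].
by apply: cP; apply: ltnW.
Qed.

(** The density of the realised types is finite satisfiability in M. *)
Lemma tp_dense q sd : 0 < sd.2 -> exists c, type_ball q sd (tp c).
Proof.
move=> sd0; have [N [j [a [el aq]]]] := tvalue_realised q.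
have [c cP] := elementary_approx_seq sd.1 a el sd0.
by exists c => chi /cP; rewrite tvalue_tp aq.
Qed.

(** A function on M which is uniformly continuous for finitely many instances
    of formulae at a time extends continuously to the types over M: its value at q
    is its limit along any ultrafilter of tuples whose types converge to q. *)
Lemma extend_to_types (f : tup M ys -> R) :
  (forall b, 0 <= f b <= 1) ->
  (forall e : R, 0 < e -> exists s (d : R), 0 < d /\ forall b b',
     (forall chi, List.In chi s -> `|tvalue chi (tp b) - tvalue chi (tp b')| < d) ->
     `|f b - f b'| <= e) ->
  exists psi : ctype M ys -> R,
    [/\ continuous psi, forall q, 0 <= psi q <= 1 & forall b, f b = psi (tp b)].
Proof.
move=> f01 fU.
have lim q : exists r : R, 0 <= r <= 1 /\ forall (e : R) s (d : R), 0 < d ->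
    (forall b b', (forall chi, List.In chi s ->
       `|tvalue chi (tp b) - tvalue chi (tp b')| < d) -> `|f b - f b'| <= e) ->
    forall b, type_ball q (s, d / 2) (tp b) -> `|f b - r| <= e.
  pose F : set_system (tup M ys) := filter_from
    [set sd : seq (pformula M ys) * R | 0 < sd.2]
    (fun sd => [set b | type_ball q sd (tp b)]).
  have FF : Filter F := filter_balls (fun k b => tvalue k (tp b)) (fun k => tvalue k q).
  have PF : ProperFilter F.
    by apply: filter_from_proper => // sd sd0; exact: tp_dense.
  have [W [WU FW]] := ultraFilterLemma PF.
  exists (ulim W f); split=> [|e s d d0 sdP b qb]; first exact: ulim_itv.
  rewrite -(ulim_cst WU (f b)); apply: ulim_dist => //.
  have d20 : 0 < d / 2 by lra.
  have : W [set b' | type_ball q (s, d / 2) (tp b')] by apply: FW; exists (s, d / 2).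
  apply: filterS => b' qb'; apply: sdP => chi cs.
  have := qb _ cs; have := qb' _ cs => /= h1 h2.
  by apply: le_lt_trans (ler_distD (tvalue chi q) _ _) _; rewrite (distrC (tvalue chi q)); lra.
have [psi psiP] := choice lim; exists psi; split=> [q|q|b].
- have FF := @nbhs_filter _ q.
  suff : psi @ q --> psi q by [].
  apply/cvgrPdist_le => e e0.
  have e20 : 0 < e / 2 by lra.
  have [s [d [d0 sdP]]] := fU _ e20.
  have d40 : 0 < d / 4 by lra.
  have : nbhs q (type_ball q (s, d / 4)) by exact: type_ball_nbhs.
  apply: (@filterS _ _ (nbhs_filter q)) => q' q'q.
  have [b bP] := @tp_dense q' (s, d / 4) d40.
  have h : type_ball q (s, d / 2) (tp b).
    move=> chi cs; have := bP _ cs; have := q'q _ cs => /= h1 h2.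
    by apply: le_lt_trans (ler_distD (tvalue chi q') _ _) _; lra.
  have h' : type_ball q' (s, d / 2) (tp b).
    by move=> chi cs; apply: lt_trans (bP _ cs) _ => /=; lra.
  have := (psiP q).2 _ _ _ d0 sdP _ h; have := (psiP q').2 _ _ _ d0 sdP _ h' => k k'.
  by apply: le_trans (ler_distD (f b) _ _) _; rewrite (distrC (psi q)); lra.
- by have [] := psiP q.
apply/eqP; rewrite -subr_eq0 -normr_le0; apply/ler_addgt0Pl => e e0; rewrite addr0.
have [s [d [d0 sdP]]] := fU _ e0.
apply: ((psiP (tp b)).2 _ _ _ d0 sdP) => chi _ /=.
by rewrite subrr normr0; lra.
Qed.

End TypeTopology.

Section PhiTypes.
Variables (R : realType) (L : signature R) (M : structure L).
Variables (xs ys : ctx (lsort L)) (phi : formula (ctx_cat xs ys)).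

Lemma phi_value_realised (p : phitype M phi) :
  exists (N : structure L) (j : forall s, M s -> N s) (a : tup N xs),
    elementary j /\ forall b, phi_value p b = feval phi (tup_cat a (tup_map j b)).
Proof.
have [N [j [a [el ap]]]] := tvalue_realised (repr p).
by exists N, j, a; split=> // b; rewrite /phi_value ap.
Qed.

Lemma phi_value_pi (q : ctype M xs) b :
  phi_value (\pi_(phitype M phi) q)%qT b = tvalue (phi_inst phi b) q.
Proof.
rewrite /phi_value; have := reprK (\pi_(phitype M phi) q)%qT.
by move=> /eqmodP/asboolP/(_ b).
Qed.

Lemma phi_value_itv (p : phitype M phi) b : 0 <= phi_value p b <= 1.
Proof. by have [N [j [a [_ ->]]]] := phi_value_realised p; exact: feval_itv. Qed.

Lemma phi_value_approx (p : phitype M phi) (s : seq (tup M ys)) (e : R) : 0 < e ->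
  exists c : tup M xs, forall b, List.In b s ->
    `|feval phi (tup_cat c b) - phi_value p b| < e.
Proof.
move=> e0; have [N [j [a [el ap]]]] := phi_value_realised p.
have [c cP] := elementary_approx_seq (List.map (@phi_inst _ _ M xs ys phi) s) a el e0.
by exists c => b bs; rewrite ap; exact: (cP _ (List.in_map _ _ _ bs)).
Qed.

End PhiTypes.

(** * Stable formulae have definable types *)

Section Definability.
Variables (R : realType) (L : signature R) (T : theory L).
Variables (V : set_system nat) (VU : UltraFilter V) (Voo : \oo `<=` V).
Variables (xs ys : ctx (lsort L)) (phi : formula (ctx_cat xs ys)).
Hypothesis DL : double_limit V T phi.

(** Suppose not. Choose in turn b_n and b'_n, almost equal for the previous c_i but
    separated by p, and then c_n close to p at the b_i and b'_i chosen so far. The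
    arrays phi(c_i, b_j) and phi(c_i, b'_j) are close above the diagonal and apart
    below it, so they cannot both satisfy the double limit condition. *)
Lemma phi_value_unif (M : structure L) (p : phitype M phi) (e : R) :
  models M T -> 0 < e ->
  exists (s : seq (tup M xs)) (d : R), 0 < d /\ forall b b',
     (forall c, List.In c s ->
        `|feval phi (tup_cat c b) - feval phi (tup_cat c b')| < d) ->
     `|phi_value p b - phi_value p b'| <= e.
Proof.
move=> MT e0; apply: contrapT => nU.
have d0 : 0 < e / 4 by lra.
pose f b := phi_value p b.
pose P (x : tup M xs * (tup M ys * tup M ys)) := e < `|f x.2.1 - f x.2.2|.
pose Q (x y : tup M xs * (tup M ys * tup M ys)) :=
  [/\ `|feval phi (tup_cat x.1 y.2.1) - feval phi (tup_cat x.1 y.2.2)| < e / 4,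
      `|feval phi (tup_cat y.1 x.2.1) - f x.2.1| < e / 4 &
      `|feval phi (tup_cat y.1 x.2.2) - f x.2.2| < e / 4].
have [s _|u [uP uQ]] := @chain_choice _ P Q.
  have [[b b'] [bb' ne]] : exists bb : tup M ys * tup M ys,
      (forall c, List.In c (List.map fst s) ->
        `|feval phi (tup_cat c bb.1) - feval phi (tup_cat c bb.2)| < e / 4) /\
      e < `|f bb.1 - f bb.2|.
    apply: contrapT => h; apply: nU; exists (List.map fst s), (e / 4); split=> // b b' bb'.
    by rewrite leNgt; apply/negP => lt; apply: h; exists (b, b').
  have [c cP] := phi_value_approx p
    (List.map (fun x => x.2.1) s ++ List.map (fun x => x.2.2) s) d0.
  exists (c, (b, b')); split=> // x xs'; split=> /=.
  - by apply: bb'; exact: List.in_map.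
  - by apply: cP; apply: List.in_or_app; left; exact: (List.in_map (fun x => x.2.1)).
  - by apply: cP; apply: List.in_or_app; right; exact: (List.in_map (fun x => x.2.2)).
pose F := array phi (fun n => (u n).1) (fun n => (u n).2.1).
pose G := array phi (fun n => (u n).1) (fun n => (u n).2.2).
have F01 : in01 F by exact: array01.
have G01 : in01 G by exact: array01.
have := lim_rows_dist VU Voo F01 G01 (e := e / 4).
have := lim_rows_dist_ge VU Voo (in01_swap F01) (in01_swap G01) (e := e / 2).
rewrite (DL (fun n => (u n).1) (fun n => (u n).2.1) MT).
rewrite (DL (fun n => (u n).1) (fun n => (u n).2.2) MT) => h1 h2.
have {}h1 := h1 _; have {}h2 := h2 _.
suff : e / 2 <= e / 4 by lra.
apply: le_trans (h1 _) (h2 _) => i j /uQ[k1 k2 k3]; last by rewrite ltW.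
have := uP i; rewrite /P -/(F j i) -/(G j i) => k4.
have := ler_distD (F j i) (f (u i).2.1) (f (u i).2.2).
have := ler_distD (G j i) (F j i) (f (u i).2.2).
rewrite (distrC (f (u i).2.1) (F j i)); move: k1 k2 k3 k4; rewrite /F /G /array /=; lra.
Qed.

Lemma double_limit_definable (M : structure L) (p : phitype M phi) :
  models M T -> definable p.
Proof.
move=> MT; have [e e0|psi [c psi01 fpsi]] := extend_to_types (phi_value_itv p).
  have [s [d [d0 sP]]] := phi_value_unif p MT e0.
  have [chi chiP] := choice (represents_swap phi (M := M)).
  exists (List.map chi s), d; split=> // b b' h; apply: sP => c cs.
  by have := h _ (List.in_map chi _ _ cs); rewrite !tvalue_tp !chiP.
by exists psi; split.
Qed.

End Definability.

(** * If all types are definable then the formula is stable *)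

Lemma In_iota (m n i : nat) : (m <= i < m + n)%N -> List.In i (iota m n).
Proof.
elim: n m => [|n IH] m; first by rewrite addn0 => /andP[mi /(leq_ltn_trans mi)]; rewrite ltnn.
case/andP=> mi im /=; case: (ltngtP m i) mi => // [mi _|-> _]; last by left.
by right; apply: IH; rewrite mi addSnnS.
Qed.

Section DefinableStable.
Variables (R : realType) (L : signature R) (T : theory L).
Variables (V : set_system nat) (VU : UltraFilter V) (Voo : \oo `<=` V).
Variables (xs ys : ctx (lsort L)) (phi : formula (ctx_cat xs ys)).

(** Take for t m the greatest index t <= m such that m is in X t: it tends to
    infinity along V. *)
Lemma diagonal_index (X : nat -> set nat) : (forall t, V (X t)) ->
  exists t : nat -> nat, forall n, V [set m | (n <= t m)%N /\ X (t m) m].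
Proof.
move=> VX.
have h m : exists t, forall n, (n <= m)%N -> X n m -> (n <= t)%N /\ X t m.
  pose P n := `[< (n <= m)%N /\ X n m >].
  case: (pselect (exists n, P n)) => [ex|nex]; last first.
    by exists 0%N => n nm Xn; exfalso; apply: nex; exists n; apply/asboolP.
  have ub n : P n -> (n <= m)%N by move/asboolP => [].
  case: (ex_maxnP ex ub) => t /asboolP[_ Xt] max; exists t => n nm Xn.
  by split=> //; apply: max; apply/asboolP.
have [t tP] := choice h; exists t => n.
apply: filterS (filterI (VX n) (eventually_V Voo n)) => m [Xn /ltnW nm].
exact: tP.
Qed.

Section Saturation.
Variables (M : structure L) (a : nat -> tup M xs) (b : nat -> tup M ys).
Let K := ultrapower VU M.
Let A i : tup K xs := tup_map (diag VU (M := M)) (a i).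
Let B i : tup K ys := tup_map (diag VU (M := M)) (b i).
Local Notation idK := (fun s (x : K s) => x).

(** The ultrapower realises, up to d for the formulae of s and exactly for the
    instances phi(a_i, y), the limit of the types of the b_j. In the m-th factor the
    realisation is some b_j, with j growing slowly with m as the parameters of the
    formulae of s, which vary with m, allow. *)
Lemma ultrapower_saturated (s : seq (pformula K ys)) (d : R) : 0 < d ->
  exists n : tup K ys,
    (forall chi, List.In chi s ->
       `|peval idK chi n - ulim V (fun j => peval idK chi (B j))| < d) /\
    forall i, feval phi (tup_cat (A i) n) = ulim V (fun j => array phi a b i j).
Proof.
move=> d0; have d40 : 0 < d / 4 by lra.
have [g gP] : exists g : forall chi : pformula K ys, nat -> tup M (pctx chi),
    forall chi, par chi = utup VU (g chi).
  apply: (@dependent_choice_fun _ (fun chi : pformula K ys => nat -> tup M (pctx chi))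
    (fun chi g => par chi = utup VU g)) => chi.
  exact: utup_surj.
pose h (chi : pformula K ys) j m := feval (pbody chi) (tup_cat (b j) (g chi m)).
have hE chi (c : nat -> nat) :
    peval idK chi (utup VU (fun m => b (c m))) = ulim V (fun m => h chi (c m) m).
  rewrite /peval -feval_utup -utup_cat -gP; congr feval.
have h01 chi (c e : nat -> nat) : bounded01 (fun m => h chi (c m) (e m)).
  by move=> m; exact: feval_itv.
pose lim chi := ulim V (fun j => peval idK chi (B j)).
pose al i := ulim V (fun j => array phi a b i j).
have a01 := array01 phi a b.
have jex t : exists j,
    (forall chi, List.In chi s -> `|peval idK chi (B j) - lim chi| < d / 4) /\
    (forall i, List.In i (iota 0 t) -> `|array phi a b i j - al i| < 2 ^- t).
  apply: (@filter_ex _ V); apply: filterI.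
    elim: s => [|chi s IH]; first by apply: filterS filterT => j _ chi [].
    have c01 : bounded01 (fun j => peval idK chi (B j)) by move=> j; exact: feval_itv.
    apply: filterS (filterI (ulim_near VU c01 d40) IH) => j [cj IHj] k /= [<- //|ks].
    exact: IHj.
  apply: (filter_In VU) => i.
  exact: (ulim_near VU (fun j => a01 i j) (pow2_gt0 R _)).
have [j jP] := choice jex.
pose X t m := forall chi, List.In chi s -> `|h chi (j t) m - peval idK chi (B (j t))| < d / 4.
have VX t : V (X t).
  rewrite /X; elim: s {jP X jex} => [|chi r IH]; first by apply: filterS filterT => m _ chi [].
  have Vchi : V [set m | `|h chi (j t) m - peval idK chi (B (j t))| < d / 4].
    have -> : B (j t) = utup VU (fun _ => b (j t)) by [].
    by rewrite (hE chi (fun _ => j t)); exact: (ulim_near VU (h01 _ (fun _ => j t) id)).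
  by apply: filterS (filterI Vchi IH) => m [cm IHm] k /= [<- //|ks]; exact: IHm.
have [t tP] := diagonal_index VX.
exists (utup VU (fun m => b (j (t m)))); split=> [chi cs|i].
  rewrite (hE chi (fun m => j (t m))) -/(lim chi).
  suff : `|ulim V (fun m => h chi (j (t m)) m) - lim chi| <= d / 2 by lra.
  have lim01 : 0 <= lim chi <= 1 by apply: ulim_itv => k; exact: feval_itv.
  rewrite -(ulim_cst VU (lim chi)).
  apply: (ulim_dist VU (h01 _ (fun m => j (t m)) id) (fun _ => lim01)).
  apply: filterS (tP 0%N) => m [_ Xm] /=.
  apply: le_trans (ler_distD (peval idK chi (B (j (t m)))) _ _) _.
  by have := Xm _ cs; have := (jP (t m)).1 _ cs; lra.
have -> : feval phi (tup_cat (A i) (utup VU (fun m => b (j (t m))))) =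
    ulim V (fun m => array phi a b i (j (t m))).
  by rewrite /array -feval_utup -utup_cat.
have al01 : 0 <= al i <= 1 by apply: ulim_itv => k; exact: a01.
rewrite -/(al i) -(ulim_cst VU (al i)).
apply: (eq_ulim VU (fun m => a01 i (j (t m))) (fun _ => al01)) => e e0; have [n ne] := pow2_small e0.
apply: filterS (tP (maxn n i.+1)) => m [nt _] /=.
apply/ltW; apply: lt_trans ne; apply: lt_le_trans ((jP (t m)).2 i _) _.
  by apply: In_iota; rewrite leq0n add0n; apply: leq_trans nt; exact: leq_maxr.
rewrite lef_pV2 ?posrE ?exprn_gt0// ler_eXn2l ?ltr1n//.
exact: leq_trans (leq_maxl _ _) nt.
Qed.

End Saturation.

(** Definability over M itself would not suffice: the argument needs elements near the
    limit of the b_j, as seen from the parameters of the definition.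
    Over the ultrapower K of M, let p be the limit of the types of the a_i.
    The value of a continuous definition of p at the limit q of the types of the
    b_j is one of the iterated limits, computed along the b_j, and the other,
    computed along elements of K close to q. *)
Lemma definable_double_limit :
  (forall M : structure L, models M T -> forall p : phitype M phi, definable p) ->
  double_limit V T phi.
Proof.
move=> def M a b MT.
pose K := ultrapower VU M; pose N := ultrapower VU K.
pose A i : tup K xs := tup_map (diag VU (M := M)) (a i).
pose B i : tup K ys := tup_map (diag VU (M := M)) (b i).
have KT : models K T by exact: ultraproduct_models.
have [p pP] := tp_elementary (utup VU A) (diag_elementary VU (M := K)).
have [q qP] := tp_elementary (utup VU B) (diag_elementary VU (M := K)).
have [psi [psiC psi01 psiP]] := def K KT (\pi_(phitype K phi) p)%qT.
have psiE n : psi (tp n) = ulim V (fun i => feval phi (tup_cat (A i) n)).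
  rewrite -psiP phi_value_pi pP /peval -feval_utup -utup_cat; congr feval.
have qE chi : tvalue chi q = ulim V (fun j => peval (fun s (x : K s) => x) chi (B j)).
  by rewrite qP /peval -feval_utup -utup_cat.
have AB i j : feval phi (tup_cat (A i) (B j)) = array phi a b i j.
  by rewrite /A /B -tup_map_cat diag_elementary.
have a01 := array01 phi a b.
set al := ulim V _; set be := ulim V _.
have near (e : R) : 0 < e -> `|al - psi q| <= e /\ `|be - psi q| <= e.
  move=> e0.
  have : nbhs q [set q' | `|psi q - psi q'| < e].
    by have /cvgrPdist_lt/(_ e e0) : psi @ q --> psi q by exact: psiC.
  move=> /nbhs_type_ball[[s d] /= d0 qball]; split.
    have [n [nP n_eq]] := @ultrapower_saturated M a b s d d0.
    have : type_ball q (s, d) (tp n).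
      by move=> chi cs; rewrite tvalue_tp qE; exact: nP.
    move=> /qball /=; rewrite distrC psiE => /ltW.
    by congr (`|ulim V _ - _| <= _); apply/funext => i; exact: n_eq.
  rewrite -(ulim_cst VU (psi q)).
  apply: (ulim_dist VU (bounded01_ulim VU (in01_swap a01)) (fun _ => psi01 q)).
  - have : V [set j | type_ball q (s, d) (tp (B j))].
      rewrite /type_ball; elim: s {qball} => [|chi s IH].
        by apply: filterS filterT => j _ chi [].
      have c01 : bounded01 (fun j => peval (fun s (x : K s) => x) chi (B j)).
        by move=> j; exact: feval_itv.
      apply: filterS (filterI (ulim_near VU c01 d0) IH) => j [/= cj IHj] k /= [<-|ks].
        by rewrite tvalue_tp qE.
      exact: IHj.
    apply: filterS => j /qball /=; rewrite distrC psiE => /ltW.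
    by congr (`|ulim V _ - _| <= _); apply/funext => i; exact: AB.
apply/eqP; rewrite -subr_eq0 -normr_le0; apply/ler_addgt0Pl => e e0; rewrite addr0.
have e20 : 0 < e / 2 by lra.
have [h1 h2] := near _ e20; apply: le_trans (ler_distD (psi q) _ _) _.
by rewrite (distrC (psi q)); lra.
Qed.

End DefinableStable.

(** * Medians and forced limits *)

Section ForcedLimits.
Variable R : realType.

Lemma median_le N (v : 'I_(N.*2.-1) -> R) (t : R) : (0 < N)%N ->
  (count (fun x => (t < x)%R) (codom v) < N)%N -> median v <= t.
Proof.
move=> N0; apply: contraTT; rewrite -ltNge -leqNgt /median => lt.
set s := sort _ _ in lt *.
have szs : size s = N.*2.-1 by rewrite size_sort size_codom card_ord.
have ss : sorted <=%R s by apply: sort_sorted; exact: le_total.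
have -> : count (fun x => t < x) (codom v) = count (fun x => t < x) s.
  by apply/permP; rewrite perm_sym perm_sort.
rewrite -[X in count _ X](cat_take_drop N.-1) count_cat.
apply: leq_trans (leq_addl _ _).
have : all (fun x => t < x) (drop N.-1 s).
  apply/(all_nthP 0) => i; rewrite size_drop szs nth_drop => il.
  apply: lt_le_trans lt _; apply: (sorted_leq_nth le_trans le_refl) => //.
  - by rewrite inE szs; case: N N0 {v s szs ss il} => // n _; rewrite doubleS /=; lia.
  - by rewrite inE szs; move: il; lia.
  - exact: leq_addr.
rewrite all_count => /eqP->; rewrite size_drop szs.
by case: N N0 {v s szs ss lt} => // n _; rewrite doubleS /= -addnn; lia.
Qed.

Lemma median_ge N (v : 'I_(N.*2.-1) -> R) (t : R) : (0 < N)%N ->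
  (count (fun x => (x < t)%R) (codom v) < N)%N -> t <= median v.
Proof.
move=> N0; apply: contraTT; rewrite -ltNge -leqNgt /median => lt.
set s := sort _ _ in lt *.
have szs : size s = N.*2.-1 by rewrite size_sort size_codom card_ord.
have ss : sorted <=%R s by apply: sort_sorted; exact: le_total.
have -> : count (fun x => x < t) (codom v) = count (fun x => x < t) s.
  by apply/permP; rewrite perm_sym perm_sort.
rewrite -[X in count _ X](cat_take_drop N) count_cat.
apply: leq_trans (leq_addr _ _).
have szt : size (take N s) = N.
  by rewrite size_take szs; case: ltnP => //; case: N N0 {v s szs ss lt} => // n _;
    rewrite doubleS /= -addnn; lia.
have : all (fun x => x < t) (take N s).
  apply/(all_nthP 0) => i; rewrite szt => il; rewrite nth_take//.
  apply: le_lt_trans lt; apply: (sorted_leq_nth le_trans le_refl) => //.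
  - by rewrite inE szs -addnn; move: il; lia.
  - by rewrite inE szs -addnn; lia.
  - by move: il; lia.
by rewrite all_count => /eqP->; rewrite szt.
Qed.

(** The forced limit is non expansive: errors below 2^-n + eta are reduced to
    eta. *)
Lemma flim_near (a : nat -> R) (r eta : R) : 0 <= eta ->
  (forall n, `|a n - r| <= 2 ^- n + eta) -> `|flim a - r| <= eta.
Proof.
move=> eta0 ar.
have xr n : `|flim_seq a n - r| <= 2 ^- n + eta.
  elim: n => [|n IH]; first exact: ar.
  rewrite [flim_seq _ _]/=; have := ar n.+1; have := pow2S R n; have := pow2_gt0 R n.+1.
  move: IH; move: (flim_seq a n) (a n.+1) (2 ^- n) (2 ^- n.+1) => x y p q.
  rewrite !ler_norml => /andP[h1 h2] q0 pq /andP[h3 h4].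
  case: (leP (x + q) y) => h5.
    by rewrite max_r; [apply/andP; split; lra|lra].
  by case: (leP (x - q) y) => h6; apply/andP; split; lra.
pose y n := flim_seq a n + 2 ^- n.
have ycvg : cvgn y.
  apply: nonincreasing_is_cvgn.
    apply/nonincreasing_seqP => n; rewrite /y [flim_seq _ n.+1]/=.
    have := pow2S R n; have := pow2_gt0 R n.+1.
    move: (flim_seq a n) (a n.+1) (2 ^- n) (2 ^- n.+1) => x z p q q0 pq.
    case: (leP (x + q) z) => h5; first by rewrite max_r; lra.
    by case: (leP (x - q) z) => h6; lra.
  exists (r - eta) => _ [n _ <-]; rewrite /y; have := xr n.
  by rewrite ler_norml => /andP[h _]; lra.
have pcvg : (fun n => (2 : R) ^- n) @ \oo --> (0 : R).
  apply/cvgrPdist_lt => e e0; have [n ne] := pow2_small e0.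
  exists n => // m /= nm; rewrite sub0r normrN ger0_norm; last exact: ltW (pow2_gt0 R m).
  apply: le_lt_trans ne; rewrite lef_pV2 ?posrE ?exprn_gt0//.
  by rewrite ler_eXn2l ?ltr1n.
have xcvg : flim_seq a @ \oo --> flim a.
  have h : flim_seq a @ \oo --> limn y - 0.
    have -> : flim_seq a = (fun n => y n - 2 ^- n) by apply/funext => n; rewrite /y addrK.
    exact: cvgB.
  by apply: cvgP h.
have h1 : (fun n => `|flim_seq a n - r|) @ \oo --> `|flim a - r|.
  by apply: cvg_norm; apply: cvgB => //; exact: cvg_cst.
have h2 : (fun n => 2 ^- n + eta) @ \oo --> 0 + eta.
  by apply: cvgD => //; exact: cvg_cst.
rewrite add0r in h2.
rewrite -(cvg_lim _ h1); last exact: norm_hausdorff.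
rewrite -[leRHS](cvg_lim _ h2); last exact: norm_hausdorff.
by apply: ler_lim; [exact: cvgP h1|exact: cvgP h2|apply: nearW].
Qed.

End ForcedLimits.

(** * Types over a stable formula are limits of canonical definitions *)

Section Sublists.
Variable T : Type.
Implicit Types s t u : seq T.

Fixpoint sublists s : seq (seq T) :=
  if s is x :: s' then sublists s' ++ map (cons x) (sublists s') else [:: [::]].

Lemma sublists_self s : List.In s (sublists s).
Proof.
elim: s => [|x s IH] /=; first by left.
by apply: List.in_or_app; right; exact: (List.in_map (cons x)).
Qed.

Lemma in_map_cons x (l : seq (seq T)) u :
  List.In u (map (cons x) l) -> exists2 v, List.In v l & u = x :: v.
Proof.
elim: l => [//|v l IH] /= [<-|/IH[w wl ->]]; first by exists v => //; left.
by exists w => //; right.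
Qed.

Lemma sublists_trans s t u : List.In t (sublists s) -> List.In u (sublists t) ->
  List.In u (sublists s).
Proof.
elim: s t u => [|x s IH] t u /=; first by case=> [<-|[]].
move=> /(List.in_app_or _ _ _)[/IH h /h us|]; first by apply: List.in_or_app; left.
move=> /in_map_cons[t' t's ->] /(List.in_app_or _ _ _)[/(IH _ _ t's) us|].
  by apply: List.in_or_app; left.
move=> /in_map_cons[u' u't' ->]; apply: List.in_or_app; right.
by apply: (List.in_map (cons x)); exact: IH u't'.
Qed.

Lemma sublists_filter (P : pred T) s : List.In (seq.filter P s) (sublists s).
Proof.
elim: s => [|x s IH] /=; first by left.
case: (P x); apply: List.in_or_app; last by left.
by right; exact: (List.in_map (cons x)).
Qed.

Lemma sublists_drop n s : List.In (drop n s) (sublists s).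
Proof.
elim: s n => [|x s IH] [|n] //=; try by left.
  by rewrite -[_ ++ _]/(sublists (x :: s)); exact: sublists_self.
by apply: List.in_or_app; left.
Qed.

Lemma sublists_take n s : List.In (take n s) (sublists s).
Proof.
elim: s n => [|x s IH] [|n] //=; try by left.
  by apply: List.in_or_app; left; rewrite -(take0 s).
by apply: List.in_or_app; right; exact: (List.in_map (cons x)).
Qed.

Lemma In_nth x0 s i : (i < size s)%N -> List.In (nth x0 s i) s.
Proof. by elim: s i => [//|x s IH] [|i] /=; [left|rewrite ltnS => /IH; right]. Qed.

Lemma In_filter (P : pred T) s x : List.In x (seq.filter P s) -> P x /\ List.In x s.
Proof.
elim: s => [//|y s IH] /=; case: ifP => Py /=.
  by case=> [<-|/IH[Px xs]]; split=> //; [left|right].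
by move=> /IH[Px xs]; split=> //; right.
Qed.

End Sublists.

Section MedianDefinition.
Variables (R : realType) (L : signature R) (T : theory L).
Variables (V : set_system nat) (VU : UltraFilter V) (Voo : \oo `<=` V).
Variables (xs ys : ctx (lsort L)) (phi : formula (ctx_cat xs ys)).
Hypothesis DL : double_limit V T phi.
Variables (M : structure L) (p : phitype M phi).
Hypothesis MT : models M T.

Local Notation f := (phi_value p).
Local Notation ph c b := (feval phi (tup_cat c b)).

Section OneError.
Variables (e eta : R).
Hypotheses (e0 : 0 < e) (eta0 : 0 < eta).

Let kap := eta / 3.

(** The points b at which all members of l err by at least e + eta, on the side sg.
    The values of f are cut into cells of width kap, so that witnesses attached to
    different lists have comparable values of f. *)
Let bad (l : seq (tup M xs)) (t : nat) (sg : bool) (b : tup M ys) :=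
  `|f b - t%:R * kap| <= kap /\
  forall c, List.In c l -> e + eta <= if sg then ph c b - f b else f b - ph c b.

Lemma bad_witness : exists W : seq (tup M xs) -> nat -> bool -> tup M ys,
  forall l t sg b, bad l t sg b -> bad l t sg (W l t sg).
Proof.
have h (i : seq (tup M xs) * nat * bool) :
    exists w, forall b, bad i.1.1 i.1.2 i.2 b -> bad i.1.1 i.1.2 i.2 w.
  case: (pselect (exists b, bad i.1.1 i.1.2 i.2 b)) => [[w ?]|nb]; first by exists w.
  by have [w] := tup_inhabited M ys; exists w => b ?; case: nb; exists b.
have [W WP] := choice h; exists (fun l t sg => W (l, t, sg)) => l t sg b.
exact: (WP (l, t, sg)).
Qed.

Lemma cell_exists : exists K, forall r : R, 0 <= r <= 1 ->
  exists2 t, (t < K)%N & `|r - t%:R * kap| <= kap.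
Proof.
have k0 : 0 < kap by rewrite divr_gt0.
exists (Num.truncn kap^-1).+1 => r /andP[r0 r1].
have rk0 : 0 <= r / kap by rewrite divr_ge0// ltW.
exists (Num.truncn (r / kap)).
  rewrite ltnS; apply: le_truncn; rewrite -[leRHS]mul1r.
  by rewrite ler_pM2r ?invr_gt0.
have /andP[] := truncn_itv rk0; rewrite ler_pdivlMr// ltr_pdivrMr// => h1.
rewrite -natr1 mulrDl mul1r; move: h1; move: (_%:R * kap) => q h1 h2.
by rewrite ger0_norm ?subr_ge0// lerBlDl ltW.
Qed.

(** Lists grow at the head: a member is chosen after those which follow it, and is
    then close to p at all the witnesses attached to their sublists. *)
Let coherent (W : seq (tup M xs) -> nat -> bool -> tup M ys) (K : nat) := fix coherent (l : seq (tup M xs)) : Prop :=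
  if l is x :: l' then coherent l' /\
    forall u t sg, List.In u (sublists l') -> (t < K)%N ->
      `|ph x (W u t sg) - f (W u t sg)| < kap
  else True.

Lemma coherent_exists W K n : exists l, size l = n /\ coherent W K l.
Proof.
elim: n => [|n [l [sl cl]]]; first by exists [::].
have k0 : 0 < kap by rewrite divr_gt0.
pose ws := List.flat_map (fun u => List.flat_map (fun t => [:: W u t true; W u t false])
  (iota 0 K)) (sublists l).
have [c cP] := phi_value_approx p ws k0.
exists (c :: l); split; first by rewrite /= sl.
split=> // u t sg ul tK; apply: cP; apply/List.in_flat_map; exists u; split=> //.
apply/List.in_flat_map; exists t; split; first by apply: In_iota; rewrite leq0n.
by case: sg; [left|right; left].
Qed.

Lemma coherent_sublist W K l u : coherent W K l ->
  List.In u (sublists l) -> coherent W K u.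
Proof.
elim: l u => [|x l IH] u /=; first by move=> _ [<-|[]].
move=> [cl xP] uin; have [ul|uin'] := List.in_app_or _ _ _ uin; first exact: IH.
have [v vl ->] := in_map_cons uin'; split; first exact: IH.
by move=> w t sg wv; apply: xP; exact: sublists_trans vl wv.
Qed.

(** The members of a coherent list which all err at one point b form a ladder with
    the witnesses of the final segments of the list. A member x is close to p at the
    witnesses of the segments after x, and errs at those of the segments containing
    x; since all these witnesses are in the cell of b, the values of phi(x, y) at the
    former and at the latter differ by at least e. *)
Lemma coherent_bad_lt W K l t sg b N :
  (forall l t sg b, bad l t sg b -> bad l t sg (W l t sg)) ->
  (t < K)%N -> coherent W K l -> bad l t sg b -> no_ladder T phi e N ->
  (size l < N)%N.
Proof.
move=> WP tK cl bl nl; rewrite ltnNge; apply/negP => Nl; apply: nl.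
pose w := take N l.
have sw : size w = N by rewrite size_takel.
have cw : coherent W K w by apply: coherent_sublist cl _; exact: sublists_take.
have bw u : List.In u (sublists w) -> (forall c, List.In c u -> List.In c l) -> bad u t sg b.
  by move=> _ h; case: bl => h1 h2; split=> // c /h/h2.
have inwl c : List.In c w -> List.In c l.
  by move=> h; rewrite -(cat_take_drop N l); apply: List.in_or_app; left.
have indrop k c : List.In c (drop k w) -> List.In c l.
  by move=> h; apply: inwl; rewrite -(cat_take_drop k w); apply: List.in_or_app; right.
have [x0] := tup_inhabited M xs.
pose be (k : nat) := W (drop (N - k) w) t sg.
have beP k : bad (drop (N - k) w) t sg (be k).
  by apply: (WP _ _ _ b); apply: bw; [exact: sublists_drop|exact: indrop].
(* be k is the witness of the k members chosen first, and the j-th chosen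
   member is at position N - j. *)
exists M, (fun j => nth x0 w (N - j)), (fun k => be k); split=> // i j k ij jk.
have j0 : (0 < j)%N by apply: leq_ltn_trans ij.
have jN : (j <= N)%N by rewrite -ltnS.
have kN : (k <= N)%N by rewrite -ltnS.
set c := nth x0 w (N - j).
have ck : List.In c (drop (N - k) w).
  have -> : c = nth x0 (drop (N - k) w) (k - j)%N.
    by rewrite nth_drop /c; congr nth; lia.
  by apply: In_nth; rewrite size_drop sw; lia.
have near : `|ph c (be i) - f (be i)| < kap.
  have := coherent_sublist cw (sublists_drop (N - j) w).
  rewrite (drop_nth x0) ?sw; last by lia.
  move=> [_]; apply=> //.
  rewrite (_ : drop (N - i) w = drop (j - i - 1) (drop (N - j).+1 w)).
    exact: sublists_drop.
  by rewrite drop_drop; congr drop; lia.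
have [fk /(_ _ ck) big] := beP k; have [fi _] := beP i.
move: fk fi near; rewrite ler_norml ltr_norml ler_norml /kap.
move=> /andP[h1 h2] /andP[h3 h4] /andP[h5 h6].
case: sg @be beP big h1 h2 h3 h4 h5 h6 {bl bw} => be beP big h1 h2 h3 h4 h5 h6.
  by rewrite distrC; apply: le_trans (ler_norm _); lra.
by apply: le_trans (ler_norm _); lra.
Qed.

(** Fewer than N of the 2N - 1 members err on a given side at a given point, so the
    median does not err. *)
Lemma median_approx : let N := ladder_bound T phi e in
  exists c : 'I_(N.*2.-1) -> tup M xs, forall b,
    `|median (fun i => ph (c i) b) - f b| <= e + eta.
Proof.
move=> N; have nl : no_ladder T phi e N by apply: ladder_boundP.
have N0 : (0 < N)%N.
  rewrite lt0n; apply/eqP => N0; apply: nl; rewrite N0.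
  have [a] := tup_inhabited M xs; have [b] := tup_inhabited M ys.
  by exists M, (fun _ => a), (fun _ => b); split=> // i j k ij; move: (ltn_ord j); lia.
have [W WP] := bad_witness; have [K KP] := cell_exists.
have [l [sl cl]] := coherent_exists W K N.*2.-1.
have [x0] := tup_inhabited M xs.
exists (fun i => nth x0 l i) => b.
have cod : codom (fun i : 'I_(N.*2.-1) => ph (nth x0 l i) b) = [seq ph c b | c <- l].
  apply: (@eq_from_nth _ 0) => [|i]; first by rewrite size_codom card_ord size_map sl.
  rewrite size_codom card_ord => il.
  rewrite (nth_map x0) ?sl// /codom /image_mem (nth_map (Ordinal il)) ?size_enum_ord//.
  by rewrite nth_enum_ord.
have few sg : (count (fun c => (e + eta < if sg then ph c b - f b else f b - ph c b)%R) l < N)%N.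
  rewrite -size_filter.
  have [t tK ft] := KP (f b) (phi_value_itv p b).
  apply: (@coherent_bad_lt W K _ t sg b N WP tK) => //.
    by apply: coherent_sublist cl _; exact: sublists_filter.
  by split=> // c cin; have [h _] := In_filter cin; exact: ltW.
rewrite ler_distl; apply/andP; split.
  apply: median_ge => //; rewrite cod count_map.
  rewrite (eq_count (a2 := fun c => (e + eta < f b - ph c b)%R)); first exact: (few false).
  by move=> c /=; apply/idP/idP; lra.
apply: median_le => //; rewrite cod count_map.
rewrite (eq_count (a2 := fun c => (e + eta < ph c b - f b)%R)); first exact: (few true).
by move=> c /=; apply/idP/idP; lra.
Qed.

End OneError.

(** The error eta is not 0, because the witnesses must have a definite excess over
    2 ^- n; but it is the same for all n, so that it is the error of the forced
    limit. *)
Lemma dphi_approx (eta : R) : 0 < eta ->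
  exists C : dfamily T phi M, forall b, `|dphi b C - f b| <= eta.
Proof.
move=> eta0.
have [C CP] := dependent_choice_fun (fun n => median_approx (pow2_gt0 R n) eta0).
exists C => b; apply: flim_near; first exact: ltW.
by move=> n; exact: CP.
Qed.

End MedianDefinition.

(** * Density characters of spaces of phi-types *)

(** The cardinals of the dense subsets have a least element, by [embeds_least]. *)
Lemma density_least (X : Type) (dense : set (set X)) : (exists D, dense D) ->
  dense (density dense) /\ forall E, dense E -> density dense #<= E.
Proof.
move=> [D0 D0d]; pose F (i : {D | dense D}) : Type := set_type (sval i).
have [[D Dd] Dmin] := @embeds_least _ F (exist _ D0 D0d).
have Dleast : dense D /\ forall E, dense E -> D #<= E.
  by split=> // E Ed; apply/card_leE; exact: (Dmin (exist _ E Ed)).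
by rewrite /density; apply: (xgetPex set0 (P := [set D | dense D /\ _])); exists D.
Qed.

Section Density.
Variables (R : realType) (L : signature R) (M : structure L).
Variables (xs ys : ctx (lsort L)) (phi : formula (ctx_cat xs ys)).

Lemma phitype_dist_sup (p q : phitype M phi) (r : R) :
  (forall b, `|phi_value p b - phi_value q b| <= r) -> phitype_dist p q <= r.
Proof.
have [b0] := tup_inhabited M ys.
by move=> h; apply: ge_sup => [|_ [b _ <-] //]; exists `|phi_value p b0 - phi_value q b0|, b0.
Qed.

Lemma dist01 (x y : R) : 0 <= x <= 1 -> 0 <= y <= 1 -> 0 <= `|x - y| <= 1.
Proof.
by move=> /andP[? ?] /andP[? ?]; rewrite normr_ge0 ler_norml; apply/andP; split; lra.
Qed.

Lemma le_phitype_dist (p q : phitype M phi) b :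
  `|phi_value p b - phi_value q b| <= phitype_dist p q.
Proof.
apply: (le_sup_range (tup_inhabited M ys)
  (f := fun b => `|phi_value p b - phi_value q b|)) => c.
by apply: dist01; exact: phi_value_itv.
Qed.

Lemma phitype_dist_eq0 (p q : phitype M phi) : phitype_dist p q <= 0 -> p = q.
Proof.
move=> pq; rewrite -[p]reprK -[q]reprK; apply/eqmodP/asboolP => b.
apply/eqP; rewrite -subr_eq0 -normr_le0; apply: le_trans pq.
exact: le_phitype_dist.
Qed.

Lemma structure_density_dense : structure_dense (structure_density M).
Proof.
have [|//] := @density_least _ (@structure_dense _ _ M).
by exists setT => s x e e0; exists x => //; rewrite distxx.
Qed.

Lemma structure_density_le (D : set {s : lsort L & M s}) : structure_dense D -> structure_density M #<= D.
Proof. by move=> Dd; have [|_ ->] := @density_least _ (@structure_dense _ _ M); first by exists D. Qed.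

Lemma phitype_density_dense : phitype_dense (phitype_density M phi).
Proof.
have [|//] := @density_least _ (@phitype_dense _ _ M _ _ phi).
exists setT => p e e0; exists p => //; apply: le_lt_trans e0.
by apply: phitype_dist_sup => b; rewrite subrr normr0.
Qed.

Lemma phitype_density_le D : @phitype_dense _ _ M _ _ phi D -> phitype_density M phi #<= D.
Proof.
by move=> Dd; have [|_ ->] := @density_least _ (@phitype_dense _ _ M _ _ phi); first by exists D.
Qed.

(** The density character is monotone under isometric embeddings; a space
    with a finite dense subset is reduced to it, and otherwise one point is
    taken near each member of the dense set, for each radius 2^-n. *)
Lemma isometric_density s (z : phitype M phi -> M s) :
  (forall p q, dist (z p) (z q) = phitype_dist p q) ->
  phitype_density M phi #<= structure_density M.
Proof.
move=> ziso; set D := structure_density M.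
have Dd : structure_dense D := structure_density_dense.
pose X : Type := D.
have [natX|nX] := pselect (embeds nat X); last first.
  (* If z p were not in D, the points of D closer and closer to z p would form an
     infinite subset of D. *)
  have zD p : D (existT _ s (z p)).
    apply: contrapT => nz; apply: nX.
    have pos y : D (existT _ s y) -> 0 < dist (z p) y.
      rewrite lt_neqAle dist_ge0 andbT eq_sym => Dy; apply/eqP => /dist_eq0 e.
      by apply: nz; rewrite e.
    have [l lD|u [uD uQ]] := @chain_choice (M s) (fun y => D (existT _ s y))
        (fun x y => dist (z p) y < dist (z p) x).
      have [e e0 le] : exists2 e : R, 0 < e & forall x, List.In x l -> e <= dist (z p) x.
        elim: l lD => [|x l IH] lD; first by exists 1.
        have [|e e0 le] := IH; first by move=> y yl; apply: lD; right.
        exists (Num.min e (dist (z p) x)).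
          by rewrite lt_min e0; apply: pos; apply: lD; left.
        by move=> y [<-|/le h]; rewrite ge_min ?lexx ?h ?orbT.
      have [y Dy dy] := Dd s (z p) e e0; exists y; split=> // x /le.
      exact: lt_le_trans.
    exists (fun n => to_sub (uD n)) => m n /(congr1 set_val) smn.
    have umn : u m = u n by exact: existT_inj smn.
    by case: (ltngtP m n) => // lt; have := uQ _ _ lt; rewrite umn ltxx.
  apply: (card_le_trans (B := [set: phitype M phi])).
    apply: phitype_density_le => p e e0; exists p => //; apply: le_lt_trans e0.
    by apply: phitype_dist_sup => b; rewrite subrr normr0.
  apply/card_leE; apply: (embeds_trans (B := phitype M phi)); first exact: embeds_sub.
  exists (fun p => to_sub (zD p)) => p q /(congr1 set_val) spq.
  have zpq : z p = z q by exact: existT_inj spq.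
  by apply: phitype_dist_eq0; rewrite -ziso zpq distxx.
have [p0] : inhabited (phitype M phi).
  by have [c] := tup_inhabited M xs; split; exact: (\pi_(phitype M phi) (tp c))%qT.
have h (dn : X * nat) : exists p, forall q y, set_val dn.1 = existT M s y ->
    dist (z q) y < 2 ^- dn.2 -> dist (z p) y < 2 ^- dn.2.
  case: (pselect (exists q y, set_val dn.1 = existT M s y /\ dist (z q) y < 2 ^- dn.2)).
    move=> [q [y [ey qy]]]; exists q => q' y' ey' _.
    rewrite ey in ey'; have <- // : y = y' by exact: existT_inj ey'.
  by move=> nq; exists p0 => q y ey qy; case: nq; exists q, y.
have [g gP] := choice h.
apply: (card_le_trans (B := range g)); last first.
  apply/card_leE; apply: (embeds_trans (B := X * nat)).
    by apply: (embeds_image_sub (f := g)) => p [dn _ <-]; exists dn.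
  apply: (embeds_trans (B := X * X)); last exact: embeds_square.
  by apply: embeds_prod => //; exists id.
apply: phitype_density_le => p e e0; have e20 : 0 < e / 2 by lra.
have [n ne] := pow2_small e20.
have [y Dy py] := Dd s (z p) _ (pow2_gt0 R n).
exists (g (to_sub Dy, n)); first by exists (to_sub Dy, n).
have gy := gP (to_sub Dy, n) p y erefl py.
rewrite -ziso; apply: le_lt_trans (dist_triangle _ y _) _.
by rewrite (dist_sym y); move: gy py => /=; lra.
Qed.

(** Distances in the sort of canonical parameters are the distances of the
    types, and approximations converge there by completeness. *)
Lemma canonical_isometry (T : theory L) (V : set_system nat) (VU : UltraFilter V)
    (Voo : \oo `<=` V) s (P : rsym L) (e : ctx_cat ys (ctx1 s) = rdom P) :
  double_limit V T phi -> canonical_sort T phi e -> models M T ->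
  exists z : phitype M phi -> M s,
    forall p q, dist (z p) (z q) = phitype_dist p q.
Proof.
move=> DL cs MT; have [qq [qdist _ _]] := cs M MT.
have lim (p : phitype M phi) : exists z : M s, forall eta : R, 0 < eta ->
    exists C : dfamily T phi M, (forall b, `|dphi b C - phi_value p b| <= eta) /\
      dist (qq C) z <= eta.
  have [C CP] := dependent_choice_fun
    (fun n => dphi_approx VU Voo DL p MT (pow2_gt0 R n.+1)).
  have [n|z zP] := @fast_cauchy _ _ M s (fun n => qq (C n)).
    rewrite qdist.
    have [b0] := tup_inhabited M ys; apply: ge_sup.
      by exists `|dphi b0 (C n) - dphi b0 (C n.+1)|, b0.
    move=> _ [b _ <-]; apply: le_trans (ler_distD (phi_value p b) _ _) _.
    have := CP n b; have := CP n.+1 b; rewrite (distrC (phi_value p b)).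
    have := pow2S R n; have := pow2S R n.+1; have := pow2_gt0 R n.+2; lra.
  exists z => eta eta0; have eta20 : 0 < eta / 2 by lra.
  have [n ne] := pow2_small eta20; exists (C n); split=> [b|].
    apply: le_trans (CP n b) _; have := pow2S R n; have := pow2_gt0 R n.+1; lra.
  by apply: le_trans (zP n) _; lra.
have [z zP] := choice lim; exists z => p q.
apply/eqP; rewrite -subr_eq0 -normr_le0; apply/ler_addgt0Pl => eta eta0; rewrite addr0.
have eta40 : 0 < eta / 4 by lra.
have [C [CP Cz]] := zP p _ eta40; have [C' [C'P C'z]] := zP q _ eta40.
have dphi_le : dist (qq C) (qq C') <= phitype_dist p q + eta / 2.
  rewrite qdist; have [b0] := tup_inhabited M ys; apply: ge_sup.
    by exists `|dphi b0 C - dphi b0 C'|, b0.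
  move=> _ [b _ <-]; have := le_phitype_dist p q b; have := CP b; have := C'P b.
  rewrite !ler_norml => /andP[? ?] /andP[? ?] /andP[? ?].
  by apply/andP; split; lra.
have le_dphi : phitype_dist p q <= dist (qq C) (qq C') + eta / 2.
  apply: phitype_dist_sup => b.
  have : `|dphi b C - dphi b C'| <= dist (qq C) (qq C').
    rewrite qdist; apply: sup_upper_bound; last by exists b.
    split; first by exists `|dphi b C - dphi b C'|, b.
    exists (1 + eta) => _ [b' _ <-]; move: (phi_value_itv p b') (phi_value_itv q b').
    move=> /andP[? ?] /andP[? ?]; move: (CP b') (C'P b').
    rewrite !ler_norml => /andP[? ?] /andP[? ?]; apply/andP; split; lra.
  have := CP b; have := C'P b.
  rewrite !ler_norml => /andP[? ?] /andP[? ?] /andP[? ?].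
  by apply/andP; split; lra.
have t1 := dist_triangle (z p) (qq C) (z q).
have t2 := dist_triangle (qq C) (qq C') (z q).
have t3 := dist_triangle (qq C) (z p) (qq C').
have t4 := dist_triangle (z p) (z q) (qq C').
rewrite (dist_sym (z p) (qq C)) in t1; rewrite (dist_sym (z q) (qq C')) in t4.
by rewrite ler_norml; apply/andP; split; lra.
Qed.

Lemma double_limit_density (T : theory L) (V : set_system nat) :
  UltraFilter V -> \oo `<=` V ->
  has_canonical_sorts T -> stable T phi -> models M T ->
  phitype_density M phi #<= structure_density M.
Proof.
move=> VU Voo hT st MT; have [s [P [e cs]]] := hT xs ys phi st.
have [z zP] := canonical_isometry VU Voo (stable_double_limit VU st) cs MT.
exact: isometric_density zP.
Qed.

End Density.

(** * The downward Lowenheim-Skolem theorem *)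

Section SkolemHull.
Variables (R : realType) (L : signature R) (N : structure L).

Local Notation elt := {s : lsort L & N s}.

Lemma skolem_exists G s (chi : formula (ctx_ext G s)) (a : tup N G) (k : nat) :
  exists x : N s, feval chi (tup_ext a x) < feval (Inf chi) a + 2 ^- k.
Proof.
exact: (inf_range_adherent (carrier_inhabited N s)
  (fun x => feval_itv chi (tup_ext a x)) (pow2_gt0 R k)).
Qed.

Definition skolem G s (chi : formula (ctx_ext G s)) (a : tup N G) (k : nat) : N s :=
  projT1 (cid (skolem_exists chi a k)).

Lemma skolemP G s (chi : formula (ctx_ext G s)) (a : tup N G) (k : nat) :
  feval chi (tup_ext a (skolem chi a k)) < feval (Inf chi) a + 2 ^- k.
Proof. exact: projT2 (cid (skolem_exists chi a k)). Qed.

Definition skolem_step (Q : set elt) : set elt :=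
  Q `|` [set y | exists G s (chi : formula (ctx_ext G s)) (a : tup N G) k,
    (forall i, Q (pt a i)) /\ y = existT _ s (skolem chi a k)].

Definition hull (B : set elt) : set elt := \bigcup_n iter n skolem_step B.

Lemma hull_sub B : B `<=` hull B.
Proof. by move=> y By; exists 0%N. Qed.

Lemma iter_skolem_mono B m n : (m <= n)%N ->
  iter m skolem_step B `<=` iter n skolem_step B.
Proof.
move=> /subnK <-; elim: (n - m)%N => [//|k IH]; rewrite addSn iterS => y /IH.
by left.
Qed.

Lemma hull_skolem B G s (chi : formula (ctx_ext G s)) (a : tup N G) k :
  (forall i, hull B (pt a i)) -> hull B (existT _ s (skolem chi a k)).
Proof.
move=> aB; have aB' i : exists n, iter n skolem_step B (pt a i).
  by have [n _ an] := aB i; exists n.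
have [n nP] := choice aB'.
exists (\max_(i < arity G) n i).+1 => //=; right.
exists G, s, chi, a, k; split=> // i.
exact: (iter_skolem_mono (leq_bigmax i)) (nP i).
Qed.

(** Skolem functions are indexed by the formulae of the form inf chi. *)
Let index := {G : ctx (lsort L) & {s : lsort L & formula (ctx_ext G s)}}.

Let index_embeds : embeds index (formulas L).
Proof.
pose f (F : index) : formulas L := existT _ (projT1 F) (Inf (projT2 (projT2 F))).
pose g (F : formulas L) : option index :=
  match F with existT G chi =>
    match chi with Inf s p => Some (existT _ G (existT _ s p)) | _ => None end end.
exists f; apply: (@pcan_inj _ _ _ g) => -[G [s p]] //.
Qed.

(** A new point is given by a Skolem function, an integer and a list of old points. *)
Lemma embeds_skolem_step (Lambda : univ) (Q : set elt) :
  embeds nat Lambda -> embeds (formulas L) Lambda -> embeds Q Lambda ->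
  embeds (skolem_step Q) Lambda.
Proof.
move=> natL formL QL; have sqL := embeds_square natL.
pose param := {F : index & (nat * {a : tup N (projT1 F) | forall i, Q (pt a i)})%type}.
pose val_ (p : param) : elt :=
  let: existT F (k, a) := p in existT _ _ (skolem (projT2 (projT2 F)) (sval a) k).
pose tl (p : param) : seq Q :=
  let: existT F (k, a) := p in
  [seq to_sub (svalP a i) | i <- enum 'I_(arity (projT1 F))].
have paramL : embeds param Lambda.
  apply: (embeds_trans (B := index * nat * seq Q)); last first.
    apply: (embeds_trans (B := Lambda * Lambda * seq Lambda)).
      apply: embeds_prod; last exact: embeds_seqs.
      by apply: embeds_prod => //; apply: embeds_trans formL; exact: index_embeds.
    apply: (embeds_trans (B := Lambda * Lambda)) => //.
    by apply: embeds_prod => //; exact: embeds_seq.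
  exists (fun p => (projT1 p, (projT2 p).1, tl p)) => -[F [k [a aQ]]] [F' [k' [a' a'Q]]] /=.
  move=> []; move: a' a'Q => a' a'Q eF; case: _ / eF a' a'Q => a' a'Q <- /eq_in_map e.
  suff ea : a = a'.
    by move: a'Q {e}; rewrite -ea => a'Q; rewrite (Prop_irrelevance aQ a'Q).
  apply: tup_eq => i; have := e i; rewrite mem_enum => /(_ isT)/(congr1 set_val).
  by [].
apply: (embeds_trans (B := Q + param)).
  apply: (embeds_image_sub (f := fun u => match u with inl y => set_val y | inr p => val_ p end)).
  move=> y [Qy|[G [s [chi [a [k [aQ ->]]]]]]]; first by exists (inl (to_sub Qy)).
  by exists (inr (existT _ (existT _ G (existT _ s chi)) (k, exist _ a aQ))).
have [f fI] := QL; have [g gI] := paramL; have [h hI] := natL.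
apply: embeds_trans sqL.
exists (fun u => match u with inl y => (h 0%N, f y) | inr p => (h 1%N, g p) end).
by move=> [x|x] [y|y] [] => [/fI->|/hI|/hI|/gI->].
Qed.

Lemma embeds_hull (Lambda : univ) (B : set elt) :
  embeds nat Lambda -> embeds (formulas L) Lambda -> embeds B Lambda ->
  embeds (hull B) Lambda.
Proof.
move=> natL formL BL.
have iL n : exists f : iter n skolem_step B -> Lambda, injective f.
  elim: n => [//|n IH]; exact: embeds_skolem_step.
have [f fI] := dependent_choice_fun iL.
have ex (y : hull B) : exists n, iter n skolem_step B (set_val y).
  by have [n _ yn] := set_mem (valP y); exists n.
have [n nP] := choice ex.
apply: (embeds_trans (B := nat * Lambda)); last first.
  apply: (embeds_trans (B := Lambda * Lambda)); last exact: embeds_square.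
  by apply: embeds_prod => //; exists id.
exists (fun y => (n y, f _ (to_sub (nP y)))) => x y [nxy].
move: (nP x) (nP y); rewrite nxy => px py /fI/(congr1 set_val)/= e.
exact: val_inj.
Qed.

Section ClosedSubstructure.
Variable B : set elt.

Definition closure_of s (x : N s) :=
  forall e : R, 0 < e -> exists2 y : N s, hull B (existT _ s y) & dist x y < e.

Lemma hull_closure s (x : N s) : hull B (existT _ s x) -> closure_of x.
Proof. by move=> Bx e e0; exists x => //; rewrite distxx. Qed.

(** Skolem functions give the condition at the tuples of the hull, and uniform
    continuity at those of the closure. *)
Lemma tarski_vaught G s (chi : formula (ctx_ext G s)) (a : tup N G) (y : N s) (e : R) :
  (forall i, closure_of (a i)) -> 0 < e ->
  exists2 x : N s, hull B (existT _ s x) &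
    feval chi (tup_ext a x) < feval chi (tup_ext a y) + e.
Proof.
move=> aC e0; have e30 : 0 < e / 3 by lra.
have [d d0 dP] := feval_unif chi e30.
have [a' a'P] := @dependent_choice_fun _ (fun i => N (G i))
  (fun i y => hull B (existT _ (G i) y) /\ dist (a i) y < d)
  (fun i => let: ex_intro2 y By ay := aC i d d0 in ex_intro _ y (conj By ay)).
have [k ke] := pow2_small e30.
have near z : `|feval chi (tup_ext a z) - feval chi (tup_ext a' z)| <= e / 3.
  apply: dP => i; rewrite /tup_ext /=; case: (unlift ord0 i) => [j|].
    by have [] := a'P j.
  by rewrite distxx.
exists (skolem chi a' k); first by apply: hull_skolem => i; have [] := a'P i.
have := near (skolem chi a' k); have := near y; have := skolemP chi a' k.
have := inf_range_le (carrier_inhabited N s) (fun x => feval_itv chi (tup_ext a' x)) y.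
move=> h1 h2; rewrite !ler_norml => /andP[h3 h4] /andP[h5 h6].
by move: h1 h2 => /=; lra.
Qed.

(** The variable 0, whose sort reduces to s only propositionally. *)
Lemma var0_term G s : exists t : term (ctx_ext G s) s,
  forall (M : structure L) (a : tup M G) (x : M s), teval (tup_ext a x) t = x.
Proof.
pose rho (i : 'I_1) : 'I_(arity (ctx_ext G s)) := ord0.
have hrho (i : 'I_(arity (ctx1 s))) : ctx_ext G s (rho i) = ctx1 s i.
  by rewrite /= unlift_none.
have [t tP] := @term_rename R L (ctx1 s) (ctx_ext G s) rho hrho s
  (@Var L (ctx1 s) ord0).
exists t => M a x; rewrite (tP M _ (tup1 x))// => i.
by rewrite /rho pt_ext0.
Qed.

(** The value of a function symbol minimises the distance to itself, so that the
    Tarski-Vaught condition gives points of the hull close to it. *)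
Lemma closure_fint (f : fsym L) (a : tup N (fdom f)) :
  (forall i, closure_of (a i)) -> closure_of (fint a).
Proof.
move=> aC e e0; pose G := fdom f; pose s := fcod f.
have hrho (i : 'I_(arity G)) : ctx_ext G s (lift ord0 i) = G i by rewrite /= liftK.
have [t tP] := term_rename hrho (App (fun i => Var i) : term G s).
have [v vP] := var0_term G s.
pose chi : formula (ctx_ext G s) :=
  @Atom L (ctx_ext G s) (Dist s) (fun i => if i == ord0 then v else t).
have chiE x : feval chi (tup_ext a x) = dist x (fint a).
  congr pint; apply: (@functional_extensionality_dep _ (fun i => N (pdom (Dist s) i))) => i.
  rewrite /tup2; case: ifP => _; first exact: vP.
  by rewrite (tP N _ a)// => j; rewrite pt_ext_lift.
have [x Bx] := tarski_vaught chi (fint a) aC e0.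
by rewrite !chiE distxx add0r dist_sym; exists x.
Qed.

Let scarrier s : univ := {x : N s | closure_of x}.

Let sfint f (a : tup scarrier (fdom f)) : scarrier (fcod f) :=
  exist _ (fint (fun i => sval (a i))) (closure_fint (fun i => svalP (a i))).

Let spint P (a : tup scarrier (pdom P)) : R := pint (fun i => sval (a i)).

Let sdist s (x y : scarrier s) := spint (P := Dist s) (tup2 x y).

Let sdistE s (x y : scarrier s) : sdist x y = dist (sval x) (sval y).
Proof.
congr pint; apply: (@functional_extensionality_dep _ (fun i => N (pdom (Dist s) i))) => i.
by rewrite /tup2; case: ifP.
Qed.

Let sinhabited s : inhabited (scarrier s).
Proof.
have [y] := carrier_inhabited N s.
have [v _] := var0_term (ctx0 (lsort L)) s.
have [|x Bx _] := @tarski_vaught (ctx0 _) s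
  (@Atom L _ (Dist s) (fun _ => v)) (tup0 N) y 1 _ ltr01; first by case.
by split; exact: (exist _ x (hull_closure Bx)).
Qed.

Let spint_itv P (a : tup scarrier (pdom P)) : 0 <= spint a <= 1.
Proof. exact: pint_itv. Qed.

Let sdist_eq0 s (x y : scarrier s) : sdist x y = 0 <-> x = y.
Proof.
rewrite sdistE; split=> [/dist_eq0|->]; last exact: distxx.
by case: x y => x xC [y yC] /= exy; apply: eq_exist.
Qed.

Let sdist_sym s (x y : scarrier s) : sdist x y = sdist y x.
Proof. by rewrite !sdistE dist_sym. Qed.

Let sdist_triangle s (x y z : scarrier s) : sdist x z <= sdist x y + sdist y z.
Proof. by rewrite !sdistE dist_triangle. Qed.

Let sdist_complete s (u : nat -> scarrier s) :
  (forall e, 0 < e -> exists N, forall m n, (N <= m)%N -> (N <= n)%N ->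
     sdist (u m) (u n) < e) ->
  exists l, forall e, 0 < e -> exists N, forall n, (N <= n)%N ->
     sdist (u n) l < e.
Proof.
move=> uC; have [e e0|l lP] := @dist_complete _ _ N s (fun n => sval (u n)).
  have [k kP] := uC e e0; exists k => m n km kn; rewrite -sdistE; exact: kP.
have lC : closure_of l.
  move=> e e0; have e20 : 0 < e / 2 by lra.
  have [k kP] := lP _ e20; have [y By uy] := svalP (u k) _ e20.
  exists y => //; apply: le_lt_trans (dist_triangle _ (sval (u k)) _) _.
  by have := kP k (leqnn k); rewrite dist_sym; lra.
by exists (exist _ l lC) => e /lP[k kP]; exists k => n /kP; rewrite sdistE.
Qed.

Let sfint_unif (f : fsym L) (i : 'I_(arity (fdom f))) e a b : 0 < e ->
  (forall j, j != i -> a j = b j) ->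
  sdist (a i) (b i) < fmod i e -> sdist (sfint a) (sfint b) <= e.
Proof.
by move=> e0 ab; rewrite !sdistE; apply: fint_unif => // j /ab ->.
Qed.

Let spint_unif (P : psym L) (i : 'I_(arity (pdom P))) e a b : 0 < e ->
  (forall j, j != i -> a j = b j) ->
  sdist (a i) (b i) < pmod i e -> `|spint a - spint b| <= e.
Proof.
by move=> e0 ab; rewrite !sdistE; apply: pint_unif => // j /ab ->.
Qed.

Definition hull_structure : structure L :=
  @Structure R L scarrier sfint spint sinhabited spint_itv
    sdist_eq0 sdist_sym sdist_triangle sdist_complete sfint_unif spint_unif.

Definition hull_incl s (x : hull_structure s) : N s := sval x.

Lemma teval_hull G (a : tup hull_structure G) s (t : term G s) :
  teval (tup_map hull_incl a) t = hull_incl (teval a t).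
Proof.
elim: t => [//|f ts IH] /=; congr fint.
exact: (@functional_extensionality_dep _ (fun i => N (fdom f i))).
Qed.

Lemma tup_map_ext G s (a : tup hull_structure G) (x : hull_structure s) :
  tup_map hull_incl (tup_ext a x) = tup_ext (tup_map hull_incl a) (hull_incl x).
Proof.
apply: (@functional_extensionality_dep _ (fun i => N (ctx_ext G s i))) => i.
by rewrite /tup_map /tup_ext /=; case: (unlift ord0 i).
Qed.

Lemma hull_elementary : elementary hull_incl.
Proof.
have aC G (a : tup hull_structure G) i : closure_of (tup_map hull_incl a i).
  exact: svalP (a i).
move=> G phi; elim: phi => {G} [G P ts|G p IH|G p IH|G p IHp q IHq|G s p IH|G s p IH] a /=.
- congr pint; apply: (@functional_extensionality_dep _ (fun i => N (pdom P i))) => i.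
  exact: teval_hull.
- by rewrite IH.
- by rewrite IH.
- by rewrite IHp IHq.
- have IH' x : feval p (tup_ext a x) =
      feval p (tup_ext (tup_map hull_incl a) (hull_incl x)) by rewrite -tup_map_ext IH.
  apply/eqP; rewrite eq_le; apply/andP; split.
    apply: sup_range_le => [||y]; [exact: carrier_inhabited|by move=> ?; exact: feval_itv|].
    apply/ler_addgt0Pr => e e0.
    have [x Bx /= xy] := tarski_vaught (Neg p) y (aC _ a) e0.
    have := le_sup_range (carrier_inhabited hull_structure s)
      (fun x => feval_itv p (tup_ext a x)) (exist _ x (hull_closure Bx)).
    by rewrite IH' /=; move: xy; rewrite /hull_incl /=; lra.
  apply: sup_range_le => [||x]; [exact: sinhabited|by move=> ?; exact: feval_itv|].
  rewrite IH'; apply: (le_sup_range (f := fun x => feval p (tup_ext _ x))).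
    exact: carrier_inhabited.
  by move=> ?; exact: feval_itv.
- have IH' x : feval p (tup_ext a x) =
      feval p (tup_ext (tup_map hull_incl a) (hull_incl x)) by rewrite -tup_map_ext IH.
  apply/eqP; rewrite eq_le; apply/andP; split; last first.
    apply: le_inf_range => [||y]; [exact: carrier_inhabited|by move=> ?; exact: feval_itv|].
    apply/ler_addgt0Pr => e e0.
    have [x Bx /= xy] := tarski_vaught p y (aC _ a) e0.
    have := inf_range_le (carrier_inhabited hull_structure s)
      (fun x => feval_itv p (tup_ext a x)) (exist _ x (hull_closure Bx)).
    by rewrite IH' /=; move: xy; rewrite /hull_incl /=; lra.
  apply: le_inf_range => [||x]; [exact: sinhabited|by move=> ?; exact: feval_itv|].
  rewrite IH'; apply: (inf_range_le (f := fun x => feval p (tup_ext _ x))).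
    exact: carrier_inhabited.
  by move=> ?; exact: feval_itv.
Qed.

Lemma hull_structure_density (Lambda : univ) :
  embeds nat Lambda -> embeds (formulas L) Lambda -> embeds B Lambda ->
  structure_density hull_structure #<= [set: Lambda].
Proof.
move=> natL formL BL.
pose D : set {s : lsort L & hull_structure s} :=
  [set y | hull B (existT _ (projT1 y) (hull_incl (projT2 y)))].
apply: (card_le_trans (B := D)).
  apply: structure_density_le => s x e e0; have [y By xy] := svalP x e e0.
  by exists (exist _ y (hull_closure By)) => //; rewrite -[dist _ _]/(sdist _ _) sdistE.
apply/card_leT_embeds; apply: (embeds_trans (B := hull B)); last exact: embeds_hull.
exists (fun y : D => to_sub (set_mem (valP y) : hull B (existT _ _ (hull_incl (projT2 (set_val y)))))).
move=> [[s x] px] [[s' x'] px'] /(congr1 set_val)/= exx; apply: val_inj => /=.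
have es := congr1 (@projT1 _ _) exx; rewrite /= in es.
case: _ / es x' px' exx => x' px' exx'; have exx := existT_inj exx'.
by congr existT; clear exx' px px'; case: x x' exx => x xC [x' x'C] /= e; apply: eq_exist.
Qed.

End ClosedSubstructure.

End SkolemHull.

(** The submodel is the metric closure of a Skolem hull of B: the hull has at most
    Lambda points and is dense in it. *)
Theorem lowenheim_skolem (R : realType) (L : signature R) (N : structure L)
    (Lambda : univ) (B : set {s : lsort L & N s}) :
  embeds nat Lambda -> embeds (formulas L) Lambda -> embeds B Lambda ->
  exists (M : structure L) (j : forall s, M s -> N s),
    [/\ elementary j, structure_density M #<= [set: Lambda] &
      forall s x, B (existT _ s x) -> exists y, j s y = x].
Proof.
move=> natL formL BL; exists (hull_structure B), (@hull_incl _ _ N B).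
split; [exact: hull_elementary|exact: hull_structure_density|].
by move=> s x Bx; exists (exist _ x (hull_closure (hull_sub Bx))).
Qed.

(** * An unstable formula has many types *)

Lemma strict_well_order (T : Type) : exists lt : T -> T -> Prop,
  [/\ forall x, ~ lt x x, forall x y z, lt x y -> lt y z -> lt x z,
      forall x y, [\/ lt x y, x = y | lt y x] &
      forall P : T -> Prop, (exists x, P x) ->
        exists x, P x /\ forall y, P y -> ~ lt y x].
Proof.
have [R Rwo] := wochoice.well_ordering_principle {classic T}.
have min (P : T -> Prop) : (exists x, P x) -> exists x, [/\ P x, forall y, P y -> R x y &
    forall x', P x' -> (forall y, P y -> R x' y) -> x = x'].
  move=> [x0 Px0].
  have [|x [[/asboolP Px xmin] xuniq]] := Rwo [pred x : {classic T} | `[< P x >]].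
    by exists x0; apply/asboolP.
  exists x; split=> // [y Py|x' Px' x'min]; first by apply: xmin; apply/asboolP.
  by apply: xuniq; split; [apply/asboolP|move=> y /asboolP; exact: x'min].
have total x y : R x y \/ R y x.
  have [|m [[->|->] mmin _]] := min (fun z => z = x \/ z = y); first by exists x; left.
    by left; apply: mmin; right.
  by right; apply: mmin; left.
have refl x : R x x by case: (total x x).
have anti x y : R x y -> R y x -> x = y.
  move=> xy yx; have [|m [_ _ uniq]] := min (fun z => z = x \/ z = y); first by exists x; left.
  have <- : m = x by apply: uniq; [left|move=> z [->|->]].
  by apply: uniq; [right|move=> z [->|->]].
have trans x y z : R x y -> R y z -> R x z.
  move=> xy yz.
  have [|m [mP mmin _]] := min (fun w => [\/ w = x, w = y | w = z]); first by exists x; apply: Or31.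
  have mx := mmin x (Or31 _ _ erefl); have my := mmin y (Or32 _ _ erefl).
  have mz := mmin z (Or33 _ _ erefl).
  case: mP => e; subst m => //.
    by rewrite (anti _ _ xy mx).
  by rewrite -(anti _ _ yz my).
exists (fun x y => R x y /\ x <> y); split.
- by move=> x [].
- move=> x y z [xy nxy] [yz nyz]; split; first exact: trans xy yz.
  by move=> xz; subst z; apply: nxy; apply: anti.
- move=> x y; case: (pselect (x = y)) => [|nxy]; first by move=> ?; apply: Or32.
  by have [?|?] := total x y; [apply: Or31|apply: Or33; split=> // /esym].
- move=> P /min[x [Px xmin _]]; exists x; split=> // y /xmin xy [yx nyx].
  by apply: nyx; apply: anti.
Qed.

(** The set few_below of the points y such that there are at most Lambda branches below each
    point up to y is an initial segment. Branches along it that are finally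
    false are the nodes of a tree with at most Lambda nodes, while the tree has more
    than Lambda branches. *)
Section Branches.
Variables (Lambda : Type) (natL : embeds nat Lambda).
Variable lt : Lambda -> Lambda -> Prop.
Hypotheses (lt_irr : forall x, ~ lt x x)
  (lt_trans : forall x y z, lt x y -> lt y z -> lt x z)
  (lt_total : forall x y, [\/ lt x y, x = y | lt y x])
  (lt_min : forall P : Lambda -> Prop, (exists x, P x) ->
        exists x, P x /\ forall y, P y -> ~ lt y x).

Local Notation branch := (Lambda -> bool).

Definition supported (Q : Lambda -> Prop) : set branch :=
  [set h | forall z, ~ Q z -> h z = false].

Definition few_below (y : Lambda) :=
  forall z, z = y \/ lt z y -> embeds (supported (fun w => lt w z)) Lambda.

Lemma few_below_le y z : few_below y -> z = y \/ lt z y -> few_below z.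
Proof.
move=> Ky zy w wz; apply: Ky.
by case: wz zy => [->//|wz] [<-|zy]; right => //; exact: lt_trans wz zy.
Qed.

(** If the segment is everything this is Cantor's theorem; otherwise it consists of
    the predecessors of the first point outside it. *)
Lemma many_branches : ~ embeds (supported few_below) Lambda.
Proof.
case: (pselect (forall y, few_below y)) => [allK|/existsNP[y1 ny1]].
  move=> /(embeds_trans (A := branch)) h; apply: (@Cantor_embeds Lambda); apply: h.
  have sup (h : branch) : supported few_below h by move=> z nz; case: nz; exact: allK.
  by exists (fun h => to_sub (sup h)) => h h' /(congr1 set_val).
have [|y0 [ny0 y0min]] := lt_min (P := fun y => ~ few_below y); first by exists y1.
have Kbelow z : lt z y0 -> few_below z.
  by move=> zy; apply: contrapT => /y0min; apply.
have KE z : few_below z = lt z y0.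
  apply/propext; split=> [Kz|]; last exact: Kbelow.
  case: (lt_total z y0) => // [e|lt']; exfalso; apply: ny0; first by rewrite -e.
  by apply: few_below_le Kz _; right.
have -> : few_below = (fun w => lt w y0) by apply/funext.
move=> h; apply: ny0 => z [->//|zy]; apply: (Kbelow z zy); by left.
Qed.

Definition finally_false : set branch :=
  [set h | exists d, few_below d /\ forall z, lt d z -> h z = false].

(** A node is given by its last level, its restriction below that level and its value
    at that level. *)
Lemma embeds_finally_false : embeds finally_false Lambda.
Proof.
have ex (h : finally_false) : exists d, few_below d /\ forall z, lt d z -> set_val h z = false.
  exact: set_mem (valP h).
have [d dP] := choice ex.
have exc (y : Lambda) : exists c : branch -> Lambda, few_below y ->
    forall h h', supported (fun w => lt w y) h -> supported (fun w => lt w y) h' ->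
    c h = c h' -> h = h'.
  case: (pselect (few_below y)) => [Ky|nK]; last by exists (fun _ => y).
  have [c cI] := Ky y (or_introl erefl).
  exists (fun h => if pselect (supported (fun w => lt w y) h) is left sh
    then c (to_sub sh) else y) => _ h h' sh sh'.
  case: pselect => // {}sh; case: pselect => // {}sh'.
  by move=> /cI/(congr1 set_val).
have [c cP] := choice exc.
pose cut (h : branch) (y : Lambda) : branch := fun z => `[< lt z y >] && h z.
have cutS h y : supported (fun w => lt w y) (cut h y).
  by move=> z nz; rewrite /cut; case: asboolP.
have [k kI] := natL.
apply: embeds_trans (embeds_square natL).
apply: (embeds_trans (B := Lambda * Lambda * Lambda)); last first.
  by apply: embeds_prod; [exact: embeds_square|exists id].
exists (fun h => (d h, c (d h) (cut (set_val h) (d h)), k (nat_of_bool (set_val h (d h))))).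
move=> h h' [dd]; have [Kd hd] := dP h; have [_ hd'] := dP h'.
rewrite -dd in hd' *; move=> /(cP _ Kd _ _ (cutS _ _) (cutS _ _)) cc /kI bb.
apply: val_inj; apply/funext => z /=; case: (lt_total z (d h)) => [zd|->|dz].
- by have := congr1 (@^~ z) cc; rewrite /cut /=; case: asboolP.
- by have := congr1 odd bb; rewrite !oddb.
- exact: etrans (hd _ dz) (esym (hd' _ dz)).
Qed.

Definition lex (h h' : branch) :=
  exists d, [/\ forall z, lt z d -> h z = h' z, h d = false & h' d = true].

Lemma lex_irr h : ~ lex h h.
Proof. by move=> [d [_ ->]]. Qed.

Lemma lex_trans h1 h2 h3 : lex h1 h2 -> lex h2 h3 -> lex h1 h3.
Proof.
move=> [d [dE d1 d2]] [d' [d'E d'2 d'3]].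
case: (lt_total d d') => [dd'|e|d'd].
- exists d; split=> [z zd|//|]; last by rewrite -d'E.
  by rewrite dE// d'E//; exact: lt_trans zd dd'.
- by move: d2; rewrite e d'2.
- exists d'; split=> [z zd'||//]; last by rewrite dE.
  by rewrite dE ?d'E//; exact: lt_trans zd' d'd.
Qed.

(** As for Dedekind cuts, h < i <= h'; the second inequality is stated in the form
    which compares the ranks below. *)
Definition cut_between h i h' := lex h i /\ forall w, lex w i -> lex w h'.

(** The node i follows the greater of the two branches up to the first level where they
    differ, and is false after it. *)
Lemma branch_cut h h' : supported few_below h -> supported few_below h' -> h <> h' ->
  exists2 i, finally_false i & cut_between h i h' \/ cut_between h' i h.
Proof.
move=> hK hK' hh'.
have [z0 z0P] : exists z, h z <> h' z.
  by apply: contrapT => n; apply: hh'; apply/funext => z; apply: contrapT => ?; apply: n; exists z.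
have [|d [dP dmin]] := lt_min (P := fun z => h z <> h' z); first by exists z0.
have eqb z : lt z d -> h z = h' z.
  by move=> zd; apply: contrapT => /dmin; apply.
have main (g g' : branch) : (forall z, lt z d -> g z = g' z) ->
    supported few_below g' -> g d = false -> g' d = true ->
    exists2 i, finally_false i & cut_between g i g'.
  move=> gg' gK gd gd'.
  pose i z := (`[< lt z d >] && g' z) || `[< z = d >].
  have ib z : lt z d -> i z = g' z.
    move=> zd; rewrite /i; case: asboolP => //= _; rewrite orbC; case: asboolP => // zd'.
    by case: (lt_irr (x := d)); rewrite -{1}zd'.
  have id_ : i d = true by rewrite /i orbC; case: asboolP.
  have ia z : lt d z -> i z = false.
    move=> dz; rewrite /i; case: asboolP => [zd|_ /=].
      by case: (lt_irr (lt_trans dz zd)).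
    by case: asboolP => // zd; case: (lt_irr (x := d)); rewrite -{2}zd.
  exists i.
    exists d; split=> //; apply: contrapT => /gK; by rewrite gd'.
  split; first by exists d; split=> // z zd; rewrite gg'// ib.
  move=> w [c [wc cf ct]]; exists c.
  case: (lt_total c d) => [cd|e|dc].
  - by split=> //; [move=> z zc; rewrite wc// ib//; exact: lt_trans zc cd|rewrite -ib].
  - by rewrite -e in gd' ib; split=> // z zc; rewrite wc// ib.
  - by rewrite ia in ct.
case hd: (h d); case hd': (h' d); try by case: dP; rewrite hd hd'.
  have [|i iF ic] := main h' h _ hK hd' hd; first by move=> z /eqb.
  by exists i => //; right.
have [i iF ic] := main h h' eqb hK' hd hd'.
by exists i => //; left.
Qed.

(** Each finite list of branches gives a monotone map from the branches to nat, which
    is strictly monotone on the list. *)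
Definition rank (F : seq branch) (h : branch) : nat := count (fun g => `[< lex g h >]) F.

Lemma rank_le F h h' : (forall w, lex w h -> lex w h') -> (rank F h <= rank F h')%N.
Proof. by move=> hh'; apply: sub_count => g /asboolP/hh'/asboolP. Qed.

Lemma rank_lt F h h' : List.In h F -> lex h h' -> (rank F h < rank F h')%N.
Proof.
move=> hF hh'; have sub w : lex w h -> lex w h' by move/lex_trans; apply.
elim: F hF => [//|g F IH] /= [->|/IH hF]; rewrite /rank /=.
  case: asboolP => [/lex_irr//|_]; case: asboolP => // _.
  by rewrite add0n add1n ltnS; exact: rank_le.
rewrite -addnS; apply: leq_add => //.
by case: asboolP => // /sub; case: asboolP.
Qed.

End Branches.

Lemma fine_ultrafilter (T : Type) : exists U : set_system (seq T),
  UltraFilter U /\ forall h, U [set F | List.In h F].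
Proof.
pose G : set_system (seq T) := filter_from setT
  (fun F0 => [set F | forall h, List.In h F0 -> List.In h F]).
have GF : Filter G.
  apply: filter_from_filter => [|F1 F2 _ _]; first by exists [::].
  exists (F1 ++ F2) => // F h; split=> g gF; apply: h; apply: List.in_or_app; [left|right] => //.
have GP : ProperFilter G by apply: filter_from_proper => // F _; exists F.
have [U [UU GU]] := ultraFilterLemma GP; exists U; split=> // h.
by apply: GU; exists [:: h] => // F; apply; left.
Qed.

Lemma formulas_infinite (R : realType) (L : signature R) (G : ctx (lsort L)) (phi : formula G) :
  embeds nat (formulas L).
Proof.
pose negs := fix negs G (p : @formula L G) : nat := if p is Neg q then (negs _ q).+1 else 0%N.
exists (fun n => existT _ G (iter n (@Neg L G) phi)) => m n.
move=> /(congr1 (fun F : formulas L => negs _ (projT2 F))) /=.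
have e k : negs _ (iter k (@Neg L G) phi) = (k + negs _ phi)%N.
  by elim: k => //= k ->.
by rewrite !e => /addIn.
Qed.

Section FewTypes.
Variables (R : realType) (L : signature R) (T : theory L).
Variables (V : set_system nat) (VU : UltraFilter V) (Voo : \oo `<=` V).
Variables (xs ys : ctx (lsort L)) (phi : formula (ctx_cat xs ys)).

(** If phi is unstable, the ladder with values near r and s which it has over nat is
    carried by the ranks to the branches, in an ultrapower over the finite lists of
    branches. A branch h then gives a type over a small submodel which contains the
    second members of the ladder at the nodes only; branches separated by a node have
    types at distance at least |r - s| / 2, and there are too many of them. *)
Lemma few_types_double_limit (Lambda : univ) :
  embeds (formulas L) Lambda ->
  (forall M : structure L, models M T -> structure_density M #<= [set: Lambda] ->
     phitype_density M phi #<= [set: Lambda]) ->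
  double_limit V T phi.
Proof.
move=> formL few; apply: contrapT => /(unstable_subladder VU).
move=> [M [a [b [r [s [e [MT e0 ers ab]]]]]]].
have natL : embeds nat Lambda := embeds_trans (formulas_infinite phi) formL.
have [lt [lt_irr lt_trans lt_total lt_min]] := strict_well_order Lambda.
have [U [UU Uin]] := fine_ultrafilter (Lambda -> bool).
pose Om := ultrapower UU M.
have OmT : models Om T by exact: ultraproduct_models.
pose rk := @rank Lambda lt.
(* Odd indices for the first members and even ones for the second members, so that
   A h and B h are compared strictly. *)
pose A h : tup Om xs := utup UU (fun F => a ((rk F h).*2.+1)).
pose B h : tup Om ys := utup UU (fun F => b ((rk F h).*2)).
have ABE h i : feval phi (tup_cat (A h) (B i)) =
    ulim U (fun F => array phi a b (rk F h).*2.+1 (rk F i).*2).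
  by rewrite /array -feval_utup -utup_cat.
have a01 := array01 phi a b.
have ABr h i : lex lt h i -> `|feval phi (tup_cat (A h) (B i)) - r| <= e.
  move=> hi; rewrite ABE.
  apply: ulim_dist_cst; first by move=> F; exact: a01.
  apply: filterS (Uin h) => F /= hF; have lthi := rank_lt lt_trans lt_total hF hi.
  by have [|/ltW] := ab (rk F h).*2.+1 (rk F i).*2; first by rewrite -doubleS leq_double.
have ABs h i : (forall w, lex lt w i -> lex lt w h) ->
    `|feval phi (tup_cat (A h) (B i)) - s| <= e.
  move=> hi; rewrite ABE.
  apply: ulim_dist_cst; first by move=> F; exact: a01.
  apply: nearW => F /=; have lehi := rank_le F hi.
  by have [|_ /ltW] := ab (rk F i).*2 (rk F h).*2.+1; first by rewrite ltnS leq_double.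
pose I := finally_false lt.
pose Bs : set {t : lsort L & Om t} := [set y | exists i k, I i /\ y = pt (B i) k].
have BsL : embeds Bs Lambda.
  apply: (embeds_trans (B := I * 'I_(arity ys))).
    apply: (embeds_image_sub (f := fun u : I * 'I_(arity ys) => pt (B (set_val u.1)) u.2)).
    by move=> y [i [k [Ii ->]]]; exists (to_sub Ii, k).
  apply: embeds_trans (embeds_square natL); apply: embeds_prod.
    exact: embeds_finally_false.
  by apply: embeds_trans natL; exists val; exact: val_inj.
have [M0 [j [el dM0 M0B]]] := lowenheim_skolem natL formL BsL.
have M0T : models M0 T.
  move=> psi Tpsi; rewrite -(OmT psi Tpsi) -(el _ psi); congr feval.
  by apply: tup_eq => -[].
have Bj i : I i -> exists b0 : tup M0 ys, tup_map j b0 = B i.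
  move=> Ii; have ex k : exists y, j (ys k) y = B i k by apply: M0B; exists i, k.
  have [b0 b0P] := dependent_choice_fun ex; exists b0.
  by apply: tup_eq => k; rewrite /pt /tup_map b0P.
have pex h : exists p : phitype M0 phi, forall b0,
    phi_value p b0 = feval phi (tup_cat (A h) (tup_map j b0)).
  have [q qP] := tp_elementary (A h) el.
  by exists (\pi_(phitype M0 phi) q)%qT => b0; rewrite phi_value_pi qP.
have [p pP] := choice pex.
have far h h' i : I i -> cut_between lt h i h' ->
    `|r - s| / 2 <= phitype_dist (p h) (p h').
  move=> /Bj[b0 b0E] [/ABr hr /ABs hs].
  apply: le_trans (le_phitype_dist _ _ b0); rewrite !pP b0E.
  have t1 := ler_distD (feval phi (tup_cat (A h) (B i))) r s.
  have t2 := ler_distD (feval phi (tup_cat (A h') (B i)))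
    (feval phi (tup_cat (A h) (B i))) s.
  by rewrite (distrC r (feval _ _)) in t1; lra.
have rs0 : 0 < `|r - s| / 4 by lra.
have qex h : exists q : phitype_density M0 phi,
    phitype_dist (p h) (set_val q) < `|r - s| / 4.
  by have [q Dq pq] := phitype_density_dense (p h) rs0; exists (to_sub Dq).
have [q qP] := choice qex.
apply: (many_branches lt_trans lt_total lt_min).
apply: (embeds_trans (B := phitype_density M0 phi)); last first.
  by apply/card_leT_embeds; apply: few.
exists (fun h => q (set_val h)) => h h' qq; apply: val_inj => /=.
apply: contrapT => hh'.
have close : phitype_dist (p (set_val h)) (p (set_val h')) < `|r - s| / 2.
  apply: (@le_lt_trans _ _ (phitype_dist (p (set_val h)) (set_val (q (set_val h))) +
    phitype_dist (p (set_val h')) (set_val (q (set_val h'))))).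
    rewrite -qq; apply: phitype_dist_sup => b0.
    apply: le_trans (ler_distD (phi_value (set_val (q (set_val h))) b0) _ _) _.
    apply: lerD; first exact: le_phitype_dist.
    by rewrite distrC; exact: le_phitype_dist.
  by have := qP (set_val h); have := qP (set_val h'); lra.
have sym (p1 p2 : phitype M0 phi) : phitype_dist p1 p2 <= phitype_dist p2 p1.
  by apply: phitype_dist_sup => b0; rewrite distrC; exact: le_phitype_dist.
have [i Ii [ic|ic]] := branch_cut lt_irr lt_trans lt_total lt_min
  (set_mem (valP h)) (set_mem (valP h')) hh'.
  by have := far _ _ _ Ii ic; lra.
by have := far _ _ _ Ii ic; have := sym (p (set_val h')) (p (set_val h)); lra.
Qed.

End FewTypes.

Theorem proposition7p7 (R : realType) (L : signature R) (T : theory L)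
  (hT : has_canonical_sorts T)
  (xs ys : ctx (lsort L)) (phi : formula (ctx_cat xs ys)) :
  [<-> stable T phi;
       forall M : structure L, models M T ->
         forall p : phitype M phi, definable p;
       forall M : structure L, models M T ->
         phitype_density M phi #<= structure_density M;
       exists Lambda : univ,
         [set: formulas L] #<= [set: Lambda] /\
         forall M : structure L, models M T ->
           structure_density M #<= [set: Lambda] ->
           phitype_density M phi #<= [set: Lambda]].
Proof.
have [V [VU Voo]] := nat_ultrafilter; tfae.
- by move=> /(stable_double_limit VU) DL M MT p; apply: double_limit_definable DL _ p MT.
- move=> /(definable_double_limit VU Voo)/(double_limit_stable VU Voo) st M MT.
  exact: double_limit_density VU Voo hT st MT.
- move=> h; exists (formulas L); split; first exact: card_lexx.
  by move=> M MT; apply: card_le_trans; exact: h.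
- move=> [Lambda [/card_leTT formL few]].
  apply: (double_limit_stable VU Voo); exact: few_types_double_limit formL few.
Qed.
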